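(* Let $\Bbbk$ be an algebraically closed field and let $\Lambda=\Bbbk Q/\mathcal{I}$ be a string category. Let $R(\Lambda)$ be its representation ring, $\mathcal{L}$ the set of isomorphism classes $\overline{\mathbf{F}}$ of linear shapes $\mathbf{F}$ over $Q$ compatible with $\mathcal{I}$, and let $I\subset R(\Lambda)$ be the $\mathbb{Z}$-span of the isoclasses of all strings (it is an ideal of $R(\Lambda)$). All shapes below are assumed compatible with $\mathcal{I}$. The ideal $I$ has a unique $\mathbb{Z}$-basis of pairwise orthogonal idempotents $\{e_{\mathbf{F}}=e_{\overline{\mathbf{F}}}\}_{\overline{\mathbf{F}}\in\mathcal{L}}$ such that the following statements hold: 1. For each linear shape $\mathbf{F}$, \[ [S_{\mathbf{F}}]=\sum_{\overline{\mathbf{F'}}\in\mathcal{L}}|\mathbf{F}:\mathbf{F'}|\,e_{\mathbf{F'}}=\sum_{\overline{\mathbf{F'}}\le\overline{\mathbf{F}}}|\mathbf{F}:\mathbf{F'}|\,e_{\mathbf{F'}}. \] Moreover, $[S_{\mathbf{F}}]e_{\mathbf{F'}}=|\mathbf{F}:\mathbf{F'}|\,e_{\mathbf{F'}}$ for all $\overline{\mathbf{F'}}\in\mathcal{L}$. 2. For each cyclic shape $\mathbf{G}=(G,Z)$, $\gamma\in Z_1$, $\lambda\in\Bbbk\setminus\{0\}$, positive integer $s$ and $\overline{\mathbf{F'}}\in\mathcal{L}$, \[ [B_{\mathbf{G}}(\lambda,s,\gamma)]e_{\mathbf{F'}}=s\,|\mathbf{G}:\mathbf{F'}|\,e_{\mathbf{F'}}.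 \] 3. For each pair of non-isomorphic cyclic shapes $\mathbf{G_1}=(G_1,Z^1)$, $\mathbf{G_2}=(G_2,Z^2)$, $\gamma_1\in Z^1_1$, $\gamma_2\in Z^2_1$, $\lambda,\mu\in\Bbbk\setminus\{0\}$ and positive integers $s,t$, \[ [B_{\mathbf{G_1}}(\lambda,s,\gamma_1)][B_{\mathbf{G_2}}(\mu,t,\gamma_2)]=\sum_{\overline{\mathbf{F'}}\in\mathcal{L}}st\,|\mathbf{G_1}:\mathbf{F'}|\,|\mathbf{G_2}:\mathbf{F'}|\,e_{\mathbf{F'}}. \] Moreover, \[ [B_{\mathbf{G_1}}(\lambda,s,\gamma_1)][B_{\mathbf{G_1}}(\mu,t,\gamma_1)]=\sum_{k\in I_{st}}[B_{\mathbf{G_1}}(\lambda\mu,l_k,\gamma_1)]+\sum_{\overline{\mathbf{F'}}\in\mathcal{L}}st\,|\mathbf{G_1}:\mathbf{F'}|\,(|\mathbf{G_1}:\mathbf{F'}|-1)\,e_{\mathbf{F'}}. \]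
   Context: Quivers and modules. A quiver $Q$ consists of finite sets $Q_0$ (vertices), $Q_1$ (arrows) and maps $t,h:Q_1\to Q_0$ (tail, head); $Q_1(x,y)$ is the set of arrows from $x$ to $y$. The path category $\Bbbk Q$ is the $\Bbbk$-linear category with object set $Q_0$ whose morphism space from $x$ to $y$ has the paths from $x$ to $y$ (including the trivial path $e_x$ if $x=y$) as basis, with composition by concatenation. For a small $\Bbbk$-linear category $\mathcal{A}$, $\mathrm{mod}\,\mathcal{A}$ is the category of $\Bbbk$-linear functors $m$ from $\mathcal{A}$ to vector spaces with all $m(x)$ finite dimensional; for an ideal $\mathcal{I}$ of $\Bbbk Q$ and $\Lambda=\Bbbk Q/\mathcal{I}$, $\mathrm{mod}\,\Lambda$ is identified with the modules in $\mathrm{mod}\,\Bbbk Q$ vanishing on $\mathcal{I}$. The tensor product is $(m\otimes n)(x)=m(x)\otimes n(x)$, $(m\otimes n)(\alpha)=m(\alpha)\otimes n(\alpha)$ for vertices $x$ and arrows $\alpha$. String category. $\Lambda=\Bbbk Q/\mathcal{I}$ is a string category if its morphism spaces are finite dimensional and: (i) $\mathcal{I}$ is generated by a set of paths; (ii) each vertex of $Q$ is the tail of at most two arrows and the head of at most two arrows; (iii) for each arrow $\alpha$ there is at most one arrow $\beta$ such that $\alpha\beta$ is a path not in $\mathcal{I}$ and at most one arrow $\gamma$ such that $\gamma\alpha$ is a path not in $\mathcal{I}$. Wrappings and shapes. A linear functor $F:\Bbbk P\to\Bbbk Q$ is a wrapping if it maps arrows to arrows and induces injective maps $P_1(x,y)\to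 Q_1(Fx,Fy)$ for all $x,y\in P_0$ (so it is induced by a quiver morphism). It is strict if for all distinct arrows $\alpha:x\to y$, $\alpha':x'\to y'$ of $P$, $F\alpha=F\alpha'$ implies $x\ne x'$ and $y\ne y'$. A shape over $Q$ is a pair $\mathbf{F}=(F,P)$ with $P$ a quiver and $F:\Bbbk P\to\Bbbk Q$ a strict wrapping. Shapes $(F_1,P^1)$, $(F_2,P^2)$ are isomorphic if there is a quiver isomorphism $\sigma:P^1\to P^2$ with $F_1=F_2\circ\sigma$; $\overline{\mathbf{F}}$ is the isomorphism class. The shape is compatible with $\mathcal{I}$ if all elements of $\mathcal{I}$ can be written as linear combinations of paths not of the form $F\gamma$ with $\gamma$ a path in $P$. Push-down. For a wrapping $F:\Bbbk P\to\Bbbk Q$ and $m\in\mathrm{mod}\,\Bbbk P$, $F_*m$ is given by $(F_*m)(x')=\bigoplus_{Fx=x'}m(x)$, and for an arrow $\alpha':x'\to y'$, $(F_*m)(\alpha')$ is the linear map whose component from $m(x)$ to $m(y)$ is $m(\alpha)$ if there is $\alpha\in P_1(x,y)$ with $F\alpha=\alpha'$, and $0$ otherwise. If $F$ is compatible with $\mathcal{I}$ then $F_*m$ is a $\Lambda$-module. Strings. A quiver is linear if its underlying graph is of Dynkin type $\mathbb{A}_n$ ($n\ge1$ vertices); a shape $(F,L)$ is linear if $L$ is. $\chi_L$ is the $\Bbbk L$-module with $\chi_L(x)=\Bbbk$ at every vertex and $\chi_L(\alpha)=1_\Bbbk$ for every arrow. The string of a linear shape is $S_{\mathbf{F}}=F_*\chi_L$.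 Bands. A quiver is cyclic if its underlying graph is of extended Dynkin type $\tilde{\mathbb{A}}$ (a single cycle; the one-loop quiver is included). A shape $\mathbf{G}=(G,Z)$ is cyclic if $Z$ is cyclic and $\mathbf{G}$ has trivial automorphism group. For $\gamma\in Z_1$, $\lambda\in\Bbbk\setminus\{0\}$, $s>0$, let $B=B(\lambda,s,\gamma)$ be the $\Bbbk Z$-module with $B(x)=\Bbbk^s$ for all $x\in Z_0$, $B(\alpha)=1_{\Bbbk^s}$ for $\alpha\neq\gamma$, and $B(\gamma)=J_\lambda(s)$, the $s\times s$ upper triangular Jordan block with eigenvalue $\lambda$. The band is $B_{\mathbf{G}}(\lambda,s,\gamma)=G_*B(\lambda,s,\gamma)$. The numbers $l_k$. $(l_k)_{k\in I_{st}}$ is the non-increasing finite sequence of positive integers determined by $J_\lambda(s)\otimes J_\mu(t)\cong\bigoplus_{k\in I_{st}}J_{\lambda\mu}(l_k)$ (for $\lambda,\mu\neq0$). Representation ring. $R(\Lambda)$ is the Grothendieck ring of the semiring of isoclasses $[m]$ of modules $m\in\mathrm{mod}\,\Lambda$ with addition given by $\oplus$ and multiplication by $\otimes$. Rings are not assumed to have an identity element. Factoring. For shapes $\mathbf{F}=(F,P)$, $\mathbf{F'}=(F',P')$ over $Q$, $[\mathbf{F}:\mathbf{F'}]$ is the set of strict wrappings $G:\Bbbk P'\to\Bbbk P$ with $F'=FG$, and $|\mathbf{F}:\mathbf{F'}|$ is its cardinality. $\mathbf{F'}$ is a subshape of $\mathbf{F}$ if some such $G$ is given by a monomorphism of quivers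 $P'\to P$. The partial order on $\mathcal{L}$ is: $\overline{\mathbf{F'}}\le\overline{\mathbf{F}}$ iff $\mathbf{F'}$ is a subshape of $\mathbf{F}$. *)

(* Defs.v *)
From HB Require Import structures.
From mathcomp Require Import all_boot all_order all_algebra.
From mathcomp Require Import boolp mxtens finmap monalg.

Set Implicit Arguments.
Unset Strict Implicit.
Unset Printing Implicit Defensive.

Import GRing.Theory.
Local Open Scope ring_scope.
Local Open Scope quotient_scope.

Record quiver := Quiver {
  vert : finType;
  arrow : finType;
  tail : arrow -> vert;
  head : arrow -> vert
}.
Arguments tail {q}.
Arguments head {q}.

Definition arr (Q : quiver) (x y : vert Q) :=
  {a : arrow Q | (tail a == x) && (head a == y)}.

Inductive qpath (Q : quiver) (x : vert Q) : vert Q -> Type :=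
| qid : qpath x x
| qsnoc y z : qpath x y -> arr y z -> qpath x z.
Arguments qid {Q}.

(* qcat p q is p followed by q. *)
Fixpoint qcat (Q : quiver) (x y z : vert Q) (p : qpath x y) (q : qpath y z) :
    qpath x z :=
  match q in qpath _ z return qpath x z with
  | qid => p
  | qsnoc _ _ q a => qsnoc (qcat p q) a
  end.

Definition qarr (Q : quiver) (x y : vert Q) (a : arr x y) : qpath x y :=
  qsnoc (qid x) a.

HB.instance Definition _ (Q : quiver) (x y : vert Q) :=
  gen_eqMixin (qpath x y).
HB.instance Definition _ (Q : quiver) (x y : vert Q) :=
  gen_choiceMixin (qpath x y).

Section LinExt.
Variables (k : fieldType) (K : choiceType) (V : lmodType k) (h : K -> V).

(* The linear map on the free module on K that extends h. *)
Definition lin_ext (f : {malg k[K]}) : V := \sum_(p <- msupp f) f@_p *: h p.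

Lemma lin_extw (d : {fset K}) f :
  fsubset (msupp f) d -> lin_ext f = \sum_(p <- d) f@_p *: h p.
Proof.
move=> sd; rewrite /lin_ext (big_fset_incl _ sd) //= => p _ /mcoeff_outdom ->.
by rewrite scale0r.
Qed.

Lemma lin_extD f g : lin_ext (f + g) = lin_ext f + lin_ext g.
Proof.
rewrite (lin_extw (msuppD_le f g)) (lin_extw (fsubsetUl (msupp f) (msupp g))).
rewrite (lin_extw (fsubsetUr (msupp f) (msupp g))) -big_split /=.
by apply: eq_bigr => p _; rewrite mcoeffD scalerDl.
Qed.

Lemma lin_extZ c f : lin_ext (c *: f) = c *: lin_ext f.
Proof.
rewrite (lin_extw (msuppZ_le c f)) scaler_sumr.
by apply: eq_bigr => p _; rewrite mcoeffZ scalerA.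
Qed.

Lemma lin_ext0 : lin_ext 0 = 0.
Proof. by rewrite /lin_ext msupp0 big_seq_fset0. Qed.

Lemma lin_extU p : lin_ext << p >> = h p.
Proof. by rewrite /lin_ext msuppU oner_eq0 big_seq_fset1 mcoeffUU scale1r. Qed.

Lemma lin_ext_sum (I : Type) (r : seq I) (F : I -> {malg k[K]}) :
  lin_ext (\sum_(i <- r) F i) = \sum_(i <- r) lin_ext (F i).
Proof. exact: (big_morph _ lin_extD lin_ext0). Qed.
End LinExt.

Section PathCategory.
Variables (k : fieldType) (Q : quiver).

Definition kpath (x y : vert Q) := {malg k[qpath x y]}.

(* Composition in the path category: kcat f g is f followed by g. *)
Definition kcat (x y z : vert Q) (f : kpath x y) (g : kpath y z) : kpath x z :=
  \sum_(p <- msupp f) \sum_(q <- msupp g) (f@_p * g@_q) *: << qcat p q >>.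

Record ideal := Ideal {
  ideal_mem :> forall x y, kpath x y -> Prop;
  ideal0 : forall x y, ideal_mem (0 : kpath x y);
  idealD : forall x y (f g : kpath x y),
    ideal_mem f -> ideal_mem g -> ideal_mem (f + g);
  idealZ : forall x y (c : k) (f : kpath x y),
    ideal_mem f -> ideal_mem (c *: f);
  ideal_catl : forall x y z (f : kpath x y) (g : kpath y z),
    ideal_mem f -> ideal_mem (kcat f g);
  ideal_catr : forall x y z (f : kpath x y) (g : kpath y z),
    ideal_mem g -> ideal_mem (kcat f g)
}.

Definition generated_by (I : ideal) (S : forall x y, qpath x y -> Prop) : Prop :=
  (forall x y (p : qpath x y), S x y p -> I x y << p >>) /\
  (forall J : ideal, (forall x y (p : qpath x y), S x y p -> J x y << p >>) ->
     forall x y (f : kpath x y), I x y f -> J x y f).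

(* Each quotient of kpath x y by I x y is finite dimensional. *)
Definition hom_finite (I : ideal) : Prop :=
  forall x y, exists n, exists b : 'I_n -> kpath x y,
    forall f : kpath x y, exists c : 'I_n -> k, I x y (f - \sum_i c i *: b i).

Record is_string_ideal (I : ideal) : Prop := IsStringIdeal {
  string_hom_finite : hom_finite I;
  string_monomial : exists S, generated_by I S;
  string_tail : forall x, (#|[set a : arrow Q | tail a == x]| <= 2)%N;
  string_head : forall x, (#|[set a : arrow Q | head a == x]| <= 2)%N;
  string_next : forall x y z z' (a : arr x y) (b : arr y z) (b' : arr y z'),
    ~ I x z << qcat (qarr a) (qarr b) >> ->
    ~ I x z' << qcat (qarr a) (qarr b') >> -> val b = val b';
  string_prev : forall x x' y z (a : arr y z) (c : arr x y) (c' : arr x' y),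
    ~ I x z << qcat (qarr c) (qarr a) >> ->
    ~ I x' z << qcat (qarr c') (qarr a) >> -> val c = val c'
}.
End PathCategory.

Record string_category (k : fieldType) := StringCategory {
  sc_quiver :> quiver;
  sc_ideal : ideal k sc_quiver;
  sc_axioms : is_string_ideal sc_ideal
}.

Section Representations.
Variables (k : fieldType) (Q : quiver).

(* A module over the path category is determined by its values on vertices and
   arrows. The space at x is k^(rdim x), regarded as a space of columns, so the
   matrix of an arrow x -> y has rdim y rows and rdim x columns. *)
Record rep := Rep {
  rdim : vert Q -> nat;
  rmx : forall x y, arr x y -> 'M[k]_(rdim y, rdim x)
}.

Fixpoint rep_path (m : rep) (x y : vert Q) (p : qpath x y) :
    'M[k]_(rdim m y, rdim m x) :=
  match p in qpath _ y return 'M[k]_(rdim m y, rdim m x) with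
  | qid => 1%:M
  | qsnoc _ _ p a => rmx m a *m rep_path m p
  end.

Definition rep_lin (m : rep) (x y : vert Q) : kpath k x y -> 'M[k]__ :=
  lin_ext (@rep_path m x y).

Definition rep_iso (m n : rep) : Prop :=
  exists g : forall x, 'M[k]_(rdim n x, rdim m x),
  exists h : forall x, 'M[k]_(rdim m x, rdim n x),
    (forall x, g x *m h x = 1%:M /\ h x *m g x = 1%:M) /\
    (forall x y (a : arr x y), rmx n a *m g x = g y *m rmx m a).

Definition rzero : rep := @Rep (fun _ => 0%N) (fun _ _ _ => 0).

Definition rsum (m n : rep) : rep :=
  @Rep (fun x => rdim m x + rdim n x)%N
       (fun x y a => block_mx (rmx m a) 0 0 (rmx n a)).

Definition rtens (m n : rep) : rep :=
  @Rep (fun x => rdim m x * rdim n x)%N (fun x y a => rmx m a *t rmx n a).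

Lemma rep_path_cat m x y z (p : qpath x y) (q : qpath y z) :
  rep_path m (qcat p q) = rep_path m q *m rep_path m p.
Proof.
elim: q => [|u v q IH a] /=; first by rewrite mul1mx.
by rewrite IH mulmxA.
Qed.

Lemma rep_lin_cat m x y z (f : kpath k x y) (g : kpath k y z) :
  rep_lin m (kcat f g) = rep_lin m g *m rep_lin m f.
Proof.
rewrite /rep_lin /kcat lin_ext_sum {3}/lin_ext mulmx_sumr.
apply: eq_bigr => p _; rewrite lin_ext_sum /lin_ext mulmx_suml.
apply: eq_bigr => q _.
rewrite -/(lin_ext (@rep_path m x z) _) lin_extZ lin_extU rep_path_cat.
by rewrite -scalemxAl -scalemxAr scalerA mulrC.
Qed.

Lemma rep_path_sum m n x y (p : qpath x y) :
  rep_path (rsum m n) p = block_mx (rep_path m p) 0 0 (rep_path n p).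
Proof.
elim: p => [|u v p IH a] /=; first by rewrite -scalar_mx_block.
by rewrite IH mulmx_block !mulmx0 !mul0mx !addr0 !add0r.
Qed.

Lemma tens11 a b : (1%:M : 'M[k]_a) *t (1%:M : 'M[k]_b) = 1%:M.
Proof.
apply/matrixP => i j.
case: (mxtens_indexP i) => i0 i1; case: (mxtens_indexP j) => j0 j1.
rewrite tensmxE !mxE -natrM mulnb (can_eq (@mxtens_indexK a b)).
by rewrite xpair_eqE.
Qed.

Lemma rep_path_tens m n x y (p : qpath x y) :
  rep_path (rtens m n) p = rep_path m p *t rep_path n p.
Proof.
elim: p => [|u v p IH a] /=; first by rewrite tens11.
by rewrite IH tensmx_mul.
Qed.

Lemma rep_iso_refl m : rep_iso m m.
Proof.
exists (fun x => 1%:M), (fun x => 1%:M); split=> [x|x y a].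
  by rewrite mulmx1.
by rewrite mulmx1 mul1mx.
Qed.

Lemma rep_iso_sym m n : rep_iso m n -> rep_iso n m.
Proof.
move=> [g [h [gh nat]]]; exists h, g; split=> [x|x y a].
  by case: (gh x).
have [_ hgx] := gh y; have [ghx _] := gh x.
rewrite -[LHS]mul1mx -hgx -!mulmxA; congr (_ *m _).
by rewrite !mulmxA -nat -mulmxA ghx mulmx1.
Qed.

Lemma rep_iso_trans m n p : rep_iso m n -> rep_iso n p -> rep_iso m p.
Proof.
move=> [g [h [gh nat]]] [g' [h' [gh' nat']]].
exists (fun x => g' x *m g x), (fun x => h x *m h' x); split=> [x|x y a].
  have [e1 e2] := gh x; have [e1' e2'] := gh' x; split.
    by rewrite mulmxA -(mulmxA (g' x)) e1 mulmx1.
  by rewrite mulmxA -(mulmxA (h x)) e2' mulmx1.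
by rewrite mulmxA nat' -!mulmxA nat.
Qed.

Lemma rep_iso_perm m n (f : forall x, 'I_(rdim m x) -> 'I_(rdim n x)) :
  (forall x, injective (f x)) -> (forall x, rdim m x = rdim n x) ->
  (forall x y (a : arr x y) i j, rmx n a (f y i) (f x j) = rmx m a i j) ->
  rep_iso m n.
Proof.
move=> finj mn fE.
have fbij x : bijective (f x).
  by apply: inj_card_bij (@finj x) _; rewrite !card_ord mn.
exists (fun x => \matrix_(i, j) (i == f x j)%:R).
exists (fun x => \matrix_(i, j) (f x i == j)%:R); split=> [x|x y a].
  split; apply/matrixP => i j; rewrite !mxE.
    have [f' fK f'K] := fbij x.
    rewrite (bigD1 (f' i)) //= !mxE f'K eqxx mul1r big1 ?addr0 // => l ne.
    rewrite !mxE; case: eqP => [e|]; last by rewrite mul0r.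
    by rewrite e fK eqxx in ne.
  rewrite (bigD1 (f x i)) //= !mxE eqxx mul1r (inj_eq (@finj x)).
  rewrite big1 ?addr0 // => l ne.
  by rewrite !mxE eq_sym (negPf ne) mul0r.
have [f' fK f'K] := fbij y.
apply/matrixP => i j; rewrite !mxE.
rewrite (bigD1 (f x j)) //= mxE eqxx mulr1 big1 ?addr0; last first.
  by move=> l ne; rewrite !mxE (negPf ne) mulr0.
rewrite (bigD1 (f' i)) //= mxE f'K eqxx mul1r big1 ?addr0; last first.
  move=> l ne; rewrite !mxE; case: eqP => [e|]; last by rewrite mul0r.
  by rewrite e fK eqxx in ne.
by rewrite -fE f'K.
Qed.

Lemma rsum_iso m m' n n' :
  rep_iso m m' -> rep_iso n n' -> rep_iso (rsum m n) (rsum m' n').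
Proof.
move=> [g [h [gh nat]]] [g' [h' [gh' nat']]].
exists (fun x => block_mx (g x) 0 0 (g' x)).
exists (fun x => block_mx (h x) 0 0 (h' x)); split=> [x|x y a] /=.
  have [e1 e2] := gh x; have [e1' e2'] := gh' x.
  rewrite !mulmx_block !mulmx0 !mul0mx !addr0 !add0r e1 e2 e1' e2'.
  by rewrite -!scalar_mx_block.
by rewrite !mulmx_block !mulmx0 !mul0mx !addr0 !add0r nat nat'.
Qed.

Lemma rtens_iso m m' n n' :
  rep_iso m m' -> rep_iso n n' -> rep_iso (rtens m n) (rtens m' n').
Proof.
move=> [g [h [gh nat]]] [g' [h' [gh' nat']]].
exists (fun x => g x *t g' x), (fun x => h x *t h' x); split=> [x|x y a] /=.
  have [e1 e2] := gh x; have [e1' e2'] := gh' x.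
  by rewrite !tensmx_mul e1 e2 e1' e2' !tens11.
by rewrite !tensmx_mul nat nat'.
Qed.

Definition block_mxE := (block_mxEul, block_mxEur, block_mxEdl, block_mxEdr).

Lemma split_lshift a b (i : 'I_a) : split (lshift b i) = inl i.
Proof. exact: (unsplitK (inl i)). Qed.

Lemma split_rshift a b (i : 'I_b) : split (rshift a i) = inr i.
Proof. exact: (unsplitK (inr i)). Qed.

Lemma rsumC m n : rep_iso (rsum m n) (rsum n m).
Proof.
pose f x (i : 'I_(rdim m x + rdim n x)) : 'I_(rdim n x + rdim m x) :=
  unsplit (match split i with inl i => inr i | inr i => inl i end).
apply: (@rep_iso_perm (rsum m n) (rsum n m) f)
  => [x i j|x|x y a i j] /=.
- move/(can_inj (@unsplitK _ _)) => e; apply: (can_inj (@splitK _ _)).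
  by case: (split i) (split j) e => i' [] j' // [->].
- exact: addnC.
- rewrite /f; case: (split_ordP i) => i' ->; case: (split_ordP j) => j' ->;
  by rewrite ?split_lshift ?split_rshift /= !block_mxE ?mxE.
Qed.

Lemma rsumA m n p : rep_iso (rsum m (rsum n p)) (rsum (rsum m n) p).
Proof.
pose f x (i : 'I_(rdim m x + (rdim n x + rdim p x))) :
    'I_(rdim m x + rdim n x + rdim p x) :=
  match split i with
  | inl i => lshift _ (lshift _ i)
  | inr i => match split i with
             | inl i => lshift _ (rshift _ i)
             | inr i => rshift _ i
             end
  end.
have fE x (i : 'I_(rdim m x + (rdim n x + rdim p x))) : f x i = i :> nat.
  rewrite /f; case: (split_ordP i) => i' ->;
    rewrite ?split_lshift ?split_rshift //.
  case: (split_ordP i') => j ->; rewrite ?split_lshift ?split_rshift //=.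
  by rewrite addnA.
apply: (@rep_iso_perm (rsum m (rsum n p)) (rsum (rsum m n) p) f)
  => [x i j e|x|x y a i j] /=.
- by apply: val_inj; rewrite /= -!fE e.
- exact: addnA.
- rewrite /f; case: (split_ordP i) => {}i ->; case: (split_ordP j) => {}j ->;
  rewrite ?split_lshift ?split_rshift ?block_mxE //;
  try (case: (split_ordP i) => {}i ->); try (case: (split_ordP j) => {}j ->);
  by rewrite ?split_lshift ?split_rshift ?block_mxE ?mxE ?block_mxE ?mxE.
Qed.

Lemma rsum0m m : rep_iso (rsum rzero m) m.
Proof.
apply: rep_iso_sym.
apply: (@rep_iso_perm _ (rsum rzero m) (fun x => @rshift 0 _)) => //.
- by move=> x; apply: rshift_inj.
- by move=> x y a i j; rewrite block_mxEdr.
Qed.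

Lemma rtensC m n : rep_iso (rtens m n) (rtens n m).
Proof.
pose f x (i : 'I_(rdim m x * rdim n x)) : 'I_(rdim n x * rdim m x) :=
  mxtens_index ((mxtens_unindex i).2, (mxtens_unindex i).1).
apply: (@rep_iso_perm (rtens m n) (rtens n m) f)
  => [x i j|x|x y a i j] /=.
- case: (mxtens_indexP i) => i0 i1; case: (mxtens_indexP j) => j0 j1.
  rewrite /f !mxtens_indexK /= => /(can_inj (@mxtens_indexK _ _)).
  by case=> -> ->.
- exact: mulnC.
- case: (mxtens_indexP i) => i0 i1; case: (mxtens_indexP j) => j0 j1.
  by rewrite /f !mxtens_indexK /= !tensmxE mulrC.
Qed.

Lemma rtensA m n p : rep_iso (rtens m (rtens n p)) (rtens (rtens m n) p).
Proof.
pose f x (i : 'I_(rdim m x * (rdim n x * rdim p x))) :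
    'I_(rdim m x * rdim n x * rdim p x) :=
  let u := mxtens_unindex i in let v := mxtens_unindex u.2 in
  mxtens_index (mxtens_index (u.1, v.1), v.2).
have fE x i1 i2 i3 : f x (mxtens_index (i1, mxtens_index (i2, i3))) =
    mxtens_index (mxtens_index (i1, i2), i3).
  by rewrite /f !mxtens_indexK.
apply: (@rep_iso_perm (rtens m (rtens n p)) (rtens (rtens m n) p) f)
  => [x i j|x|x y a i j] /=.
- case: (mxtens_indexP i) => i0 i1; case: (mxtens_indexP j) => j0 j1.
  case: (mxtens_indexP i1) => i2 i3; case: (mxtens_indexP j1) => j2 j3.
  rewrite !fE => /(can_inj (@mxtens_indexK _ _)) e.
  have /= /(can_inj (@mxtens_indexK _ _)) [-> ->] := congr1 fst e.
  by have /= -> := congr1 snd e.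
- exact: mulnA.
- case: (mxtens_indexP i) => i0 i1; case: (mxtens_indexP j) => j0 j1.
  case: (mxtens_indexP i1) => i2 i3; case: (mxtens_indexP j1) => j2 j3.
  by rewrite !fE !tensmxE mulrA.
Qed.

Lemma rtensDl m n p :
  rep_iso (rtens (rsum m n) p) (rsum (rtens m p) (rtens n p)).
Proof.
pose f x (i : 'I_((rdim m x + rdim n x) * rdim p x)) :
    'I_(rdim m x * rdim p x + rdim n x * rdim p x) :=
  let u := mxtens_unindex i in
  match split u.1 with
  | inl i => lshift _ (mxtens_index (i, u.2))
  | inr i => rshift _ (mxtens_index (i, u.2))
  end.
apply: (@rep_iso_perm (rtens (rsum m n) p) (rsum (rtens m p) (rtens n p)) f)
  => [x i j|x|x y a i j] /=.
- case: (mxtens_indexP i) => i0 i1; case: (mxtens_indexP j) => j0 j1.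
  rewrite /f !mxtens_indexK /=.
  case: (split_ordP i0) => {}i0 ->; case: (split_ordP j0) => {}j0 ->;
  rewrite ?split_lshift ?split_rshift.
  + by move/lshift_inj/(can_inj (@mxtens_indexK _ _)) => [-> ->].
  + by move/eqP; rewrite eq_lrshift.
  + by move/eqP; rewrite eq_rlshift.
  + by move/rshift_inj/(can_inj (@mxtens_indexK _ _)) => [-> ->].
- exact: mulnDl.
- case: (mxtens_indexP i) => i0 i1; case: (mxtens_indexP j) => j0 j1.
  rewrite /f !mxtens_indexK /= tensmxE.
  case: (split_ordP i0) => {}i0 ->; case: (split_ordP j0) => {}j0 ->;
  by rewrite ?split_lshift ?split_rshift !block_mxE ?mxE ?mul0r ?mxtens_indexK.
Qed.
End Representations.

Section ModLambda.
Variables (k : fieldType) (L : string_category k).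

Record lmodule := LModule {
  lrep :> rep k L;
  lrep_ann : forall x y (f : kpath k x y), ideal_mem (sc_ideal L) f -> rep_lin lrep f = 0
}.

Definition ann_ideal (m : rep k L) : ideal k L.
Proof.
refine (@Ideal _ _ (fun x y (f : kpath k x y) => rep_lin m f = 0) _ _ _ _ _).
- by move=> x y; apply: lin_ext0.
- by move=> x y f g f0 g0; rewrite /rep_lin lin_extD -!/(rep_lin _ _) f0 g0 addr0.
- by move=> x y c f f0; rewrite /rep_lin lin_extZ -/(rep_lin _ _) f0 scaler0.
- by move=> x y z f g f0; rewrite rep_lin_cat f0 mulmx0.
- by move=> x y z f g g0; rewrite rep_lin_cat g0 mul0mx.
Defined.

Lemma lzero_ann x y (f : kpath k x y) :
  ideal_mem (sc_ideal L) f -> rep_lin (rzero k L) f = 0.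
Proof. by move=> _; apply/matrixP => -[]. Qed.
Definition lzero : lmodule := LModule lzero_ann.

Lemma lsum_ann (m n : lmodule) x y (f : kpath k x y) :
  ideal_mem (sc_ideal L) f -> rep_lin (rsum m n) f = 0.
Proof.
move=> If; suff -> : rep_lin (rsum m n) f =
    block_mx (rep_lin m f) 0 0 (rep_lin n f).
  rewrite (lrep_ann m If) (lrep_ann n If); apply/matrixP => i j.
  by case: (split_ordP i) => {}i ->; case: (split_ordP j) => {}j ->;
    rewrite block_mxE !mxE.
rewrite /rep_lin /lin_ext.
apply: (big_ind3 (fun A B C => C = block_mx A 0 0 B)) => //.
- apply/matrixP => i j.
  by case: (split_ordP i) => {}i ->; case: (split_ordP j) => {}j ->;
    rewrite block_mxE !mxE.
- by move=> A B C A' B' C' -> ->; rewrite add_block_mx !addr0.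
- by move=> p _; rewrite rep_path_sum scale_block_mx !scaler0.
Qed.
Definition lsum (m n : lmodule) : lmodule := LModule (lsum_ann m n).

Lemma ltens_ann (m n : lmodule) x y (f : kpath k x y) :
  ideal_mem (sc_ideal L) f -> rep_lin (rtens m n) f = 0.
Proof.
have [S [Sin Smin]] := string_monomial (sc_axioms L).
apply: (Smin (ann_ideal (rtens m n))) => x' y' p Sp /=.
have := lrep_ann m (Sin _ _ _ Sp); rewrite /rep_lin !lin_extU => mp0.
by rewrite rep_path_tens mp0 tens0mx.
Qed.
Definition ltens (m n : lmodule) : lmodule := LModule (ltens_ann m n).

HB.instance Definition _ := gen_eqMixin lmodule.
HB.instance Definition _ := gen_choiceMixin lmodule.

Definition liso (m n : lmodule) : bool := `[< rep_iso m n >].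

Lemma liso_refl : reflexive liso.
Proof. by move=> m; apply/asboolP/rep_iso_refl. Qed.
Lemma liso_sym : symmetric liso.
Proof. by move=> m n; apply/asboolP/asboolP; apply: rep_iso_sym. Qed.
Lemma liso_trans : transitive liso.
Proof.
by move=> n m p /asboolP mn /asboolP np; apply/asboolP/(rep_iso_trans mn np).
Qed.
Canonical liso_equiv := EquivRel liso liso_refl liso_sym liso_trans.

Definition isoclass := {eq_quot liso_equiv}.
HB.instance Definition _ := Choice.on isoclass.
HB.instance Definition _ := EqQuotient.on isoclass.

Definition icls (m : lmodule) : isoclass := \pi_isoclass m.

Lemma iclsP m n : icls m = icls n <-> rep_iso m n.
Proof. by split=> [/eqmodP/asboolP|mn]; [|apply/eqmodP/asboolP]. Qed.

Definition iadd (u v : isoclass) : isoclass := icls (lsum (repr u) (repr v)).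
Definition imul (u v : isoclass) : isoclass := icls (ltens (repr u) (repr v)).

Lemma icls_repr u : icls (repr u) = u.
Proof. exact: reprK. Qed.

Lemma isoclassW (P : isoclass -> Prop) : (forall m, P (icls m)) -> forall u, P u.
Proof. by move=> H u; rewrite -(icls_repr u). Qed.

Lemma iaddE m n : iadd (icls m) (icls n) = icls (lsum m n).
Proof. by apply/iclsP/rsum_iso; apply/iclsP; rewrite icls_repr. Qed.

Lemma imulE m n : imul (icls m) (icls n) = icls (ltens m n).
Proof. by apply/iclsP/rtens_iso; apply/iclsP; rewrite icls_repr. Qed.

Lemma iaddA : associative iadd.
Proof.
elim/isoclassW => m; elim/isoclassW => n; elim/isoclassW => p.
by rewrite !iaddE; apply/iclsP/rsumA.
Qed.
Lemma iaddC : commutative iadd.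
Proof.
elim/isoclassW => m; elim/isoclassW => n.
by rewrite !iaddE; apply/iclsP/rsumC.
Qed.
Lemma iadd0 : left_id (icls lzero) iadd.
Proof. by elim/isoclassW => m; rewrite !iaddE; apply/iclsP/rsum0m. Qed.

HB.instance Definition _ := GRing.isNmodule.Build isoclass iaddA iaddC iadd0.

Lemma imulA : associative imul.
Proof.
elim/isoclassW => m; elim/isoclassW => n; elim/isoclassW => p.
by rewrite !imulE; apply/iclsP/rtensA.
Qed.
Lemma imulC : commutative imul.
Proof.
elim/isoclassW => m; elim/isoclassW => n.
by rewrite !imulE; apply/iclsP/rtensC.
Qed.
Lemma imulDl : left_distributive imul +%R.
Proof.
elim/isoclassW => m; elim/isoclassW => n; elim/isoclassW => p.
by rewrite /+%R /= iaddE !imulE iaddE; apply/iclsP/rtensDl.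
Qed.
Lemma imul0 u : imul 0 u = 0.
Proof.
elim/isoclassW: u => m; rewrite /0%R /= imulE; apply/iclsP.
apply: (@rep_iso_perm _ _ (rtens (rzero _ _) m) (rzero _ _) (fun x => id)) => //.
  by move=> x [].
by move=> x y a [].
Qed.
End ModLambda.

Section Grothendieck.
Variable M : nmodType.

(* The pair (a, b) stands for the difference a - b. *)
Definition groth_rel (u v : M * M) : bool :=
  `[< exists p, u.1 + v.2 + p = v.1 + u.2 + p >].

Lemma groth_refl : reflexive groth_rel.
Proof. by move=> u; apply/asboolP; exists 0. Qed.
Lemma groth_sym : symmetric groth_rel.
Proof. by move=> u v; apply/asboolP/asboolP => -[p e]; exists p. Qed.
Lemma groth_trans : transitive groth_rel.
Proof.
move=> v u w /asboolP[p e] /asboolP[q e']; apply/asboolP.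
exists (v.1 + v.2 + p + q).
rewrite [LHS](AC (2*4) ((1*4*5)*(3*2*6))) /= e e'.
by rewrite [LHS](AC (3*3) ((4*2)*(1*5*3*6))).
Qed.
Canonical groth_equiv := EquivRel groth_rel groth_refl groth_sym groth_trans.

Definition groth := {eq_quot groth_equiv}.
HB.instance Definition _ := Choice.on groth.
HB.instance Definition _ := EqQuotient.on groth.

Definition gcls (a : M) : groth := \pi_groth (a, 0).
Definition gpi (u : M * M) : groth := \pi_groth u.

Lemma gpiP u v : gpi u = gpi v <-> exists p, u.1 + v.2 + p = v.1 + u.2 + p.
Proof. by split=> [/eqmodP/asboolP|uv]; [|apply/eqmodP/asboolP]. Qed.

Lemma gpi_repr x : gpi (repr x) = x.
Proof. exact: reprK. Qed.

Lemma grothW (P : groth -> Prop) : (forall u, P (gpi u)) -> forall x, P x.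
Proof. by move=> H x; rewrite -(gpi_repr x). Qed.

Definition gadd (x y : groth) : groth :=
  let u := repr x in let v := repr y in gpi (u.1 + v.1, u.2 + v.2).
Definition gopp (x : groth) : groth := let u := repr x in gpi (u.2, u.1).

Lemma gaddE u v : gadd (gpi u) (gpi v) = gpi (u.1 + v.1, u.2 + v.2).
Proof.
have /gpiP[p e] := gpi_repr (gpi u); have /gpiP[q e'] := gpi_repr (gpi v).
apply/gpiP; exists (p + q) => /=.
rewrite [LHS](AC (2*2*2) ((1*3*5)*(2*4*6))) /= e e'.
by rewrite [RHS](AC (2*2*2) ((1*3*5)*(2*4*6))).
Qed.

Lemma goppE u : gopp (gpi u) = gpi (u.2, u.1).
Proof.
have /gpiP[p e] := gpi_repr (gpi u).
by apply/gpiP; exists p; rewrite /= [_ + u.1]addrC -e [u.2 + _]addrC.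
Qed.

Lemma gaddA : associative gadd.
Proof.
elim/grothW => u; elim/grothW => v; elim/grothW => w.
by rewrite !gaddE /= !addrA.
Qed.
Lemma gaddC : commutative gadd.
Proof.
elim/grothW => u; elim/grothW => v.
by rewrite !gaddE /= addrC [v.2 + _]addrC.
Qed.
Lemma gadd0 : left_id (gpi 0) gadd.
Proof. by elim/grothW => -[a b]; rewrite gaddE /= !add0r. Qed.
Lemma gaddN : left_inverse (gpi 0) gopp gadd.
Proof.
elim/grothW => u; rewrite goppE gaddE.
by apply/gpiP; exists 0; rewrite /= !addr0 add0r addrC.
Qed.
HB.instance Definition _ := GRing.isZmodule.Build groth gaddA gaddC gadd0 gaddN.

Lemma gpiD u v : gpi u + gpi v = gpi (u.1 + v.1, u.2 + v.2).
Proof. exact: gaddE. Qed.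

Lemma gclsD a b : gcls (a + b) = gcls a + gcls b.
Proof. by rewrite [RHS]gpiD /= addr0. Qed.

Section Mul.
Variable mul : M -> M -> M.
Hypotheses (mulA : associative mul) (mulC : commutative mul).
Hypothesis mulDl : left_distributive mul +%R.

Definition gmul (x y : groth) : groth :=
  let u := repr x in let v := repr y in
  gpi (mul u.1 v.1 + mul u.2 v.2, mul u.1 v.2 + mul u.2 v.1).

Let mulDr : right_distributive mul +%R.
Proof. by move=> a b c; rewrite !(mulC a) mulDl. Qed.

Lemma gmulE u v : gmul (gpi u) (gpi v) =
  gpi (mul u.1 v.1 + mul u.2 v.2, mul u.1 v.2 + mul u.2 v.1).
Proof.
pose m (u v : M * M) :=
  gpi (mul u.1 v.1 + mul u.2 v.2, mul u.1 v.2 + mul u.2 v.1).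
have mC u1 v1 : m u1 v1 = m v1 u1.
  by rewrite /m !(mulC v1.1) !(mulC v1.2) [X in (_, X)]addrC.
have mE u1 u2 v1 : gpi u1 = gpi u2 -> m u1 v1 = m u2 v1.
  case/gpiP=> p e; apply/gpiP => /=.
  exists (mul p v1.1 + mul p v1.2).
  transitivity (mul (u1.1 + u2.2 + p) v1.1 + mul (u2.1 + u1.2 + p) v1.2).
    rewrite !mulDl.
    by rewrite [LHS](AC (2*2*2) ((1*4*5)*(3*2*6))).
  rewrite -e {1}e !mulDl.
  by rewrite [LHS](AC (3*3) ((1*5)*(4*2)*(3*6))).
rewrite [LHS](mE _ u _ (gpi_repr _)) mC (mE _ v _ (gpi_repr _)).
by rewrite mC.
Qed.

Lemma gmulA : associative gmul.
Proof.
elim/grothW => u; elim/grothW => v; elim/grothW => w.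
rewrite !gmulE /=; congr (gpi (_, _)); rewrite !(mulDl, mulDr) !mulA;
by rewrite [RHS](AC (2*2) ((1*3)*(4*2))).
Qed.
Lemma gmulC : commutative gmul.
Proof.
elim/grothW => u; elim/grothW => v; rewrite !gmulE.
by rewrite !(mulC v.1) !(mulC v.2) [X in (_, X)]addrC.
Qed.
Lemma gmulDl : left_distributive gmul +%R.
Proof.
elim/grothW => u; elim/grothW => v; elim/grothW => w.
rewrite gpiD !gmulE gpiD /= !mulDl.
by congr (gpi (_, _)); rewrite addrACA.
Qed.

Lemma gcls_mul : (forall a, mul 0 a = 0) ->
  forall a b, gmul (gcls a) (gcls b) = gcls (mul a b).
Proof.
move=> mul0 a b; rewrite gmulE /=.
by rewrite (mulC a 0) !mul0 !addr0.
Qed.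
End Mul.
End Grothendieck.

(* R(L) need not have an identity, so its product is not a ring structure of the
   library. *)
Section RepresentationRing.
Variables (k : fieldType) (L : string_category k).

Definition repring := groth (isoclass L).
HB.instance Definition _ := GRing.Zmodule.on repring.

Definition rmul (u v : repring) : repring := gmul (@imul k L) u v.

Definition rcls (m : lmodule L) : repring := gcls (icls m).

Lemma rcls_iso (m n : lmodule L) : rep_iso m n -> rcls m = rcls n.
Proof. by move/iclsP; rewrite /rcls => ->. Qed.
Lemma rclsD (m n : lmodule L) : rcls (lsum m n) = rcls m + rcls n.
Proof. by rewrite /rcls -gclsD -iaddE. Qed.
Lemma rclsM (m n : lmodule L) : rcls (ltens m n) = rmul (rcls m) (rcls n).
Proof.
rewrite /rcls /rmul gcls_mul ?imulE //.
- exact: imulC.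
- exact: imulDl.
- exact: imul0.
Qed.
Lemma rmulA : associative rmul.
Proof. by apply: gmulA; [exact: imulA | exact: imulC | exact: imulDl]. Qed.
Lemma rmulC : commutative rmul.
Proof. by apply: gmulC; [exact: imulC | exact: imulDl]. Qed.
Lemma rmulDl : left_distributive rmul +%R.
Proof. by apply: gmulDl; [exact: imulC | exact: imulDl]. Qed.
End RepresentationRing.

(* A functor between path categories that maps arrows to arrows is given by its
   effect on vertices and on arrows. *)
Definition qmap (P Q : quiver) : finType :=
  ({ffun vert P -> vert Q} * {ffun arrow P -> arrow Q})%type.

Section Wrappings.
Variables P Q : quiver.
Implicit Type F : qmap P Q.

Definition is_qmor F : bool :=
  [forall a, (tail (F.2 a) == F.1 (tail a)) && (head (F.2 a) == F.1 (head a))].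

Definition is_wrapping F : bool :=
  is_qmor F && [forall x, forall y, [forall a : arr x y, forall b : arr x y,
    (F.2 (val a) == F.2 (val b)) ==> (a == b)]].

Definition is_strict F : bool :=
  [forall a, forall b, (a != b) && (F.2 a == F.2 b) ==>
    (tail a != tail b) && (head a != head b)].

Definition is_strict_wrapping F : bool := is_wrapping F && is_strict F.

Definition is_qmono F : Prop := injective F.1 /\ injective F.2.

Definition is_qiso F : Prop := [/\ is_qmor F, bijective F.1 & bijective F.2].

Lemma strict_wrapping_qmor F : is_strict_wrapping F -> is_qmor F.
Proof. by case/andP => /andP[]. Qed.

Section PathMap.
Variables (F : qmap P Q) (hF : is_qmor F).

Lemma amap_proof x y (a : arr x y) :
  (tail (F.2 (val a)) == F.1 x) && (head (F.2 (val a)) == F.1 y).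
Proof.
have /andP[/eqP -> /eqP ->] := forallP hF (val a).
by have /andP[/eqP -> /eqP ->] := valP a; rewrite !eqxx.
Qed.

Definition amap x y (a : arr x y) : arr (F.1 x) (F.1 y) :=
  exist _ (F.2 (val a)) (amap_proof a).

Fixpoint pmap x y (p : qpath x y) : qpath (F.1 x) (F.1 y) :=
  match p in qpath _ y return qpath (F.1 x) (F.1 y) with
  | qid => qid (F.1 x)
  | qsnoc _ _ p a => qsnoc (pmap p) (amap a)
  end.

(* is_image c p means that p is the image of the path c. *)
Inductive is_image u v (c : qpath u v) : forall x y : vert Q, qpath x y -> Prop :=
| IsImage : is_image c (pmap c).

Definition lifts x y (p : qpath x y) : Prop :=
  exists u v (c : qpath u v), is_image c p.

Lemma is_image_snoc u v w (c : qpath u v) (b : arr v w) x y z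
    (p : qpath x y) (a : arr y z) :
  is_image c p -> F.2 (val b) = val a -> F.1 w = z ->
  is_image (qsnoc c b) (qsnoc p a).
Proof.
move=> cp ba wz; case: z / wz a ba => a; case: cp a => a ba.
have -> : a = amap b by apply: val_inj.
exact: (IsImage (qsnoc c b)).
Qed.
End PathMap.
End Wrappings.

Definition qcomp (P Q R : quiver) (F : qmap Q R) (G : qmap P Q) : qmap P R :=
  ([ffun x => F.1 (G.1 x)], [ffun a => F.2 (G.2 a)]).

Definition qidmap (P : quiver) : qmap P P := ([ffun x => x], [ffun a => a]).

Record shape (Q : quiver) := Shape {
  sdom : quiver;
  smap : qmap sdom Q;
  sstrict : is_strict_wrapping smap
}.

Definition smor (Q : quiver) (F : shape Q) : is_qmor (smap F) :=
  strict_wrapping_qmor (sstrict F).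

Definition shape_iso (Q : quiver) (F1 F2 : shape Q) : Prop :=
  exists2 s : qmap (sdom F1) (sdom F2), is_qiso s & smap F1 = qcomp (smap F2) s.

(* factoring F F' is [F : F'] and nfact F F' is |F : F'|. *)
Definition factoring (Q : quiver) (F F' : shape Q) :
    {set qmap (sdom F') (sdom F)} :=
  [set G | is_strict_wrapping G & smap F' == qcomp (smap F) G].

Definition nfact (Q : quiver) (F F' : shape Q) : nat := #|factoring F F'|.

Definition subshape (Q : quiver) (F' F : shape Q) : Prop :=
  exists2 G, G \in factoring F F' & is_qmono G.

Definition compatible (k : fieldType) (Q : quiver) (I : ideal k Q) (F : shape Q)
    : Prop :=
  forall x y (f : kpath k x y), ideal_mem I f ->
    exists n (c : 'I_n -> k) (p : 'I_n -> qpath x y),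
      (forall i, ~ lifts (smor F) (p i)) /\ f = \sum_i c i *: << p i >>.

Definition joins (Q : quiver) (a : arrow Q) (x y : vert Q) : Prop :=
  (tail a = x /\ head a = y) \/ (tail a = y /\ head a = x).

Definition linear_quiver (Q : quiver) : Prop :=
  exists n (v : 'I_n.+1 -> vert Q) (a : 'I_n -> arrow Q),
    [/\ bijective v, bijective a &
        forall i, joins (a i) (v (widen_ord (leqnSn n) i)) (v (lift ord0 i))].

(* ordS is the cyclic successor on 'I_n.+1. *)
Definition cyclic_quiver (Q : quiver) : Prop :=
  exists n (v : 'I_n.+1 -> vert Q) (a : 'I_n.+1 -> arrow Q),
    [/\ bijective v, bijective a & forall i, joins (a i) (v i) (v (ordS i))].

Definition trivial_aut (Q : quiver) (F : shape Q) : Prop :=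
  forall s : qmap (sdom F) (sdom F),
    is_qiso s -> smap F = qcomp (smap F) s -> s = qidmap (sdom F).

Section PushDown.
Variables (k : fieldType) (P Q : quiver) (F : qmap P Q) (m : rep k P).

(* A basis of the direct sum of the m(x) with F x = x', made of the standard
   bases of the m(x). *)
Definition pd_basis (x' : vert Q) : finType :=
  {x : {u : vert P | F.1 u == x'} & 'I_(rdim m (val x))}.

Definition pd_entry x' y' (a' : arr x' y') (v : pd_basis y') (u : pd_basis x') :
    k :=
  if [pick a : arr (val (tag u)) (val (tag v)) | F.2 (val a) == val a'] is Some a
  then rmx m a (tagged v) (tagged u) else 0.

Definition push_down : rep k Q :=
  @Rep k Q (fun x' => #|pd_basis x'|)
    (fun x' y' a' => \matrix_(j, i) pd_entry a' (enum_val j) (enum_val i)).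

Lemma push_down_path (hF : is_qmor F) x' y' (p : qpath x' y') i j :
  rep_path push_down p j i != 0 ->
  exists c : qpath (val (tag (enum_val i))) (val (tag (enum_val j))),
    is_image hF c p.
Proof.
elim: p j => [|y z p IH a] j /=.
  rewrite mxE; case: (j =P i) => [<- _|_]; last by rewrite mulr0n eqxx.
  case: (enum_val j) => -[w hw] _ /=; exists (qid w).
  by case: _ / (eqP hw); apply: (IsImage hF (qid w)).
rewrite mxE => /eqP nz.
have [l] : exists l, rmx push_down a j l * rep_path push_down p l i != 0.
  apply: contra_notP nz => /forallNP nz; apply: big1 => l _.
  by apply/eqP; apply: contra_notT (nz l).
rewrite mulf_eq0 negb_or => /andP[+ /IH[c hc]].
rewrite mxE /pd_entry; case: pickP => [b /eqP ba _|]; last by rewrite eqxx.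
exists (qsnoc c b); apply: is_image_snoc => //.
exact/eqP/(valP (tag (enum_val j))).
Qed.
End PushDown.

Definition constant_rep (k : fieldType) (P : quiver) : rep k P :=
  @Rep k P (fun _ => 1%N) (fun _ _ _ => 1%:M).

Definition jordan (k : fieldType) (lam : k) (s : nat) : 'M[k]_s :=
  \matrix_(i, j) if i == j then lam else (i.+1 == j :> nat)%:R.

Definition band_rep (k : fieldType) (Z : quiver) (gam : arrow Z) (lam : k)
    (s : nat) : rep k Z :=
  @Rep k Z (fun _ => s)
    (fun x y a => if val a == gam then jordan lam s else 1%:M).

Section Shapes.
Variables (k : fieldType) (L : string_category k).

Record cshape := CShape {
  cshape_shape :> shape L;
  cshape_compatible : compatible (sc_ideal L) cshape_shape
}.

Record linear_shape := LinearShape {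
  linear_cshape :> cshape;
  linear_shapeP : linear_quiver (sdom linear_cshape)
}.

Record cyclic_shape := CyclicShape {
  cyclic_cshape :> cshape;
  cyclic_shapeP : cyclic_quiver (sdom cyclic_cshape);
  cyclic_shape_aut : trivial_aut cyclic_cshape
}.

Lemma push_down_ann (F : cshape) (m : rep k (sdom F)) x y (f : kpath k x y) :
  ideal_mem (sc_ideal L) f -> rep_lin (push_down (smap F) m) f = 0.
Proof.
move=> /(cshape_compatible F)[n [c [p [np ->]]]].
rewrite /rep_lin lin_ext_sum big1 // => i _; rewrite lin_extZ lin_extU.
apply/matrixP => u v; rewrite !mxE.
have [->|/(push_down_path (smor F))[q hq]] :=
  eqVneq (rep_path (push_down (smap F) m) (p i) u v) 0; first by rewrite mulr0.
by case: (np i); exists _, _, q.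
Qed.

Definition lpush_down (F : cshape) (m : rep k (sdom F)) : lmodule L :=
  LModule (@push_down_ann F m).

Definition string (F : linear_shape) : lmodule L :=
  lpush_down (constant_rep k (sdom F)).

Definition band (G : cyclic_shape) (gam : arrow (sdom G)) (lam : k) (s : nat) :
    lmodule L :=
  lpush_down (band_rep gam lam s).

Definition noniso n (F : 'I_n -> linear_shape) : Prop :=
  forall i j, shape_iso (F i) (F j) -> i = j.

Definition string_span (r : repring L) : Prop :=
  exists n (F : 'I_n -> linear_shape) (c : 'I_n -> int),
    r = \sum_i rcls (string (F i)) *~ c i.

Definition is_ring_ideal (I : repring L -> Prop) : Prop :=
  [/\ I 0, forall u v, I u -> I v -> I (u - v) &
      forall u v, I v -> I (rmul u v) /\ I (rmul v u)].

(* Families indexed by the isomorphism classes of linear shapes are represented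
   by functions on linear shapes that are constant on isomorphism classes. *)
Definition class_function (T : Type) (f : linear_shape -> T) : Prop :=
  forall F F' : linear_shape, shape_iso F F' -> f F = f F'.

Definition is_basis (I : repring L -> Prop) (e : linear_shape -> repring L) :
    Prop :=
  [/\ forall F, I (e F),
      forall r, I r -> exists n (F : 'I_n -> linear_shape) (c : 'I_n -> int),
        r = \sum_i e (F i) *~ c i &
      forall n (F : 'I_n -> linear_shape) (c : 'I_n -> int), noniso F ->
        \sum_i e (F i) *~ c i = 0 -> forall i, c i = 0].

(* For a class function f, class_sum D f r means that f F is nonzero for finitely
   many isomorphism classes of linear shapes F with D F, and that r is the sum
   of f over the classes in D. *)
Definition class_sum (D : linear_shape -> Prop) (f : linear_shape -> repring L)
    (r : repring L) : Prop :=
  exists n (F : 'I_n -> linear_shape),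
    [/\ noniso F, forall i, D (F i),
        forall F' : linear_shape, D F' -> f F' <> 0 -> exists i, shape_iso F' (F i)
      & r = \sum_i f (F i)].
End Shapes.

(* The sequence l is (l_k) for the matrices J_lam(s) and J_mu(t). *)
Definition jordan_type (k : fieldType) (lam mu : k) (s t : nat) (l : seq nat) :
    Prop :=
  [/\ sorted geq l, all (leq 1) l &
      exists g, exists h, [/\ g *m h = 1%:M, h *m g = 1%:M &
        g *m (jordan lam s *t jordan mu t) =
        \mxdiag_(i < size l) jordan (lam * mu) (nth 0%N l i) *m g]].

Section ClassSum.
Variables (k : fieldType) (L : string_category k).

Lemma shape_iso_sym (Q : quiver) (F1 F2 : shape Q) :
  shape_iso F1 F2 -> shape_iso F2 F1.
Proof.
case=> s [smr [f fK f'K] [g gK g'K]] e.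
exists ([ffun x => f x], [ffun a => g a]).
  split=> /=; last 2 first.
  - by exists s.1 => x; rewrite ffunE.
  - by exists s.2 => x; rewrite ffunE.
  apply/forallP => a /=; rewrite !ffunE.
  have /andP[/eqP e1 /eqP e2] := forallP smr (g a).
  rewrite !g'K in e1 e2.
  by rewrite e1 e2 !fK !eqxx.
rewrite e /qcomp /= [LHS]surjective_pairing; congr (_, _); apply/ffunP => x.
  by rewrite !ffunE f'K.
by rewrite !ffunE g'K.
Qed.

Lemma shape_iso_trans (Q : quiver) (F1 F2 F3 : shape Q) :
  shape_iso F1 F2 -> shape_iso F2 F3 -> shape_iso F1 F3.
Proof.
case=> s [smr sb1 sb2] e [s' [smr' sb1' sb2'] e'].
exists (qcomp s' s).
  split=> /=.
  - apply/forallP => a; rewrite !ffunE.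
    have /andP[/eqP e1 /eqP e2] := forallP smr a.
    have /andP[/eqP -> /eqP ->] := forallP smr' (s.2 a).
    by rewrite e1 e2 !eqxx.
  - by apply: eq_bij (bij_comp sb1' sb1) _ _ => x; rewrite ffunE.
  - by apply: eq_bij (bij_comp sb2' sb2) _ _ => x; rewrite ffunE.
rewrite e e' /qcomp /=; congr (_, _); apply/ffunP => x; by rewrite !ffunE.
Qed.

Lemma class_sum_uniq (D : linear_shape L -> Prop) f (r r' : repring L) :
  class_function f -> class_sum D f r -> class_sum D f r' -> r = r'.
Proof.
move=> fc [n [F [nF DF sF ->]]] [n' [F' [nF' DF' sF' ->]]].
have half N N' (A : 'I_N -> linear_shape L) (B : 'I_N' -> linear_shape L) :
    noniso B -> (forall i, D (A i)) ->
    (forall C : linear_shape L, D C -> f C <> 0 -> exists i, shape_iso C (B i)) ->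
    \sum_i f (A i) =
    \sum_i \sum_j (if `[< shape_iso (A i) (B j) >] then f (B j) else 0).
  move=> nB DA sB; apply: eq_bigr => i _.
  have [f0|/eqP f0] := eqVneq (f (A i)) 0.
    rewrite f0 big1 // => j _; case: asboolP => // /fc <-; exact: f0.
  have [j ij] := sB _ (DA i) f0.
  rewrite (bigD1 j) //= asboolT // -(fc _ _ ij) big1 ?addr0 // => l ne.
  case: asboolP => // il; case/eqP: ne; apply: nB.
  exact: shape_iso_trans (shape_iso_sym il) ij.
rewrite (half _ _ _ _ nF' DF sF') (half _ _ _ _ nF DF' sF) exchange_big /=.
apply: eq_bigr => i _; apply: eq_bigr => j _.
case: asboolP => [/[dup] /fc <- /shape_iso_sym h|h]; first by rewrite asboolT.
by rewrite asboolF // => /shape_iso_sym.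
Qed.
End ClassSum.

(* Main.v *)
From HB Require Import structures.
From mathcomp Require Import all_boot all_order all_algebra.
From mathcomp Require Import boolp mxtens zify.
Require Import Defs.

(** For a linear shape F with vertices v_0, ..., v_n, let phi_F be the
    multiplicity of the interval {v_0, ..., v_n} in the pullback of a module to
    F, computed as the rank difference of the two subspaces at v_n related to
    the whole space and to 0 at v_0. It is additive, and its value on the
    push-down of the constant module of a shape X is |X : F|. Push-downs of
    tensor products are push-downs along fibre products of shapes, and a shape
    without cycles is a disjoint union of linear shapes, so that its push-downs
    of invertible constant-rank modules are multiples of sums of strings.

    Since factorings between linear shapes are monomorphisms, the matrix
    |F : F'| is unitriangular, so the phi_F separate the elements of the span I
    of the strings. The idempotent e_F is obtained from the push-downs of the
    full subshapes of F by inclusion-exclusion: phi_F' (e_F) counts the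
    factorings F' -> F that are surjective, which is 1 if F and F' are
    isomorphic and 0 otherwise. Every identity in I is then checked on the
    phi_F. I is an ideal because the pullback of a module to a linear shape is a
    sum of interval modules.

    The fibre product of two cyclic shapes has a cycle only when the shapes are
    isomorphic, and if they are equal then the only cycle is the diagonal: along
    a cycle the labels of one shape are periodic with the length of the other,
    and a period that is not a multiple of the length would give a nontrivial
    automorphism. *)


Set Implicit Arguments.
Unset Strict Implicit.
Unset Printing Implicit Defensive.

Import GRing.Theory.
Local Open Scope ring_scope.

(** * Push-downs *)

(** The obstacle is linear independence in a Grothendieck group: a relation there yields an
    isomorphism only after adding an unknown module. An additive isomorphism invariant such as [phi]
    survives this, without a classification of modules or a Krull-Schmidt theorem.

    Strictness is used as unique lifting: an arrow of a shape is determined by its image together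
    with one endpoint. Hence the push-down of a constant line has partial permutation matrices, a
    factoring from a linear shape is determined by the image of one vertex, and fibre products of
    shapes are again shapes.

    Arrows of linear and cyclic quivers point either way, so a Boolean [o] on arrows records the
    direction in which each edge is traversed. Having at most one edge leaving and one entering each
    vertex, and having no cycle, then pull back along strict wrappings, which treats subshapes and
    fibre products without a case analysis of graphs.

    Uniqueness of the basis rests on statement 1: it forces every element of the span to act on the
    idempotent of [F] through [phi F]. *)

Section EnumMatrix.
Variables (k : fieldType).

Definition emx (S T : finType) (f : S -> T -> k) : 'M[k]_(#|S|, #|T|) :=
  \matrix_(j, i) f (enum_val j) (enum_val i).

Lemma emx_mul (S T U : finType) (f : S -> T -> k) (g : T -> U -> k) :
  emx f *m emx g = emx (fun j i => \sum_l f j l * g l i).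
Proof.
apply/matrixP => j i; rewrite !mxE [RHS](eq_bigl (mem T)) // [RHS]big_enum_val.
by apply: eq_bigr => l _; rewrite !mxE.
Qed.

Lemma eq_emx (S T : finType) (f g : S -> T -> k) : f =2 g -> emx f = emx g.
Proof. by move=> fg; apply/matrixP => j i; rewrite !mxE fg. Qed.

Lemma emx1 (S : finType) : emx (fun j i : S => (j == i)%:R) = 1%:M.
Proof. by apply/matrixP => j i; rewrite !mxE (inj_eq enum_val_inj). Qed.
End EnumMatrix.

Section FinRep.
Variables (k : fieldType) (Q : quiver).

Definition fentry (B : vert Q -> finType) :=
  forall x y, arr x y -> B y -> B x -> k.

(** Bases are arbitrary finite types here, so that an isomorphism can be given as a bijection of
    bases preserving matrix entries, without arithmetic on ordinals. *)
Definition frep (B : vert Q -> finType) (E : fentry B) : rep k Q :=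
  @Rep k Q (fun x => #|B x|)
    (fun x y a => emx (E x y a)).

Lemma frep_iso B (E : fentry B) B' (E' : fentry B') (f : forall x, B x -> B' x) :
  (forall x, bijective (f x)) ->
  (forall x y (a : arr x y) j i, E' x y a (f y j) (f x i) = E x y a j i) ->
  rep_iso (@frep B E) (@frep B' E').
Proof.
move=> fbij fE.
pose h x (i : 'I_#|B x|) : 'I_#|B' x| := enum_rank (f x (enum_val i)).
apply: (@rep_iso_perm _ _ (frep E) (frep E') h) => [x|x|x y a i j] /=.
- move=> i j /enum_rank_inj /(bij_inj (fbij x)); exact: enum_val_inj.
- exact: bij_eq_card (fbij x).
- by rewrite !mxE !enum_rankK fE.
Qed.

Lemma rep_frep (m : rep k Q) :
  rep_iso m (@frep (fun x => 'I_(rdim m x)) (fun x y a => rmx m a)).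
Proof.
apply: (@rep_iso_perm _ _ m (frep _) (fun x => enum_rank)) => [x|x|x y a i j] /=.
- exact: enum_rank_inj.
- by rewrite card_ord.
- by rewrite mxE !enum_rankK.
Qed.

Lemma frep_tens B (E : fentry B) B' (E' : fentry B') :
  rep_iso (rtens (@frep B E) (@frep B' E'))
    (@frep (fun x => (B x * B' x)%type)
       (fun x y a j i => E x y a j.1 i.1 * E' x y a j.2 i.2)).
Proof.
pose h x (i : 'I_(#|B x| * #|B' x|)) : 'I_#|((B x * B' x)%type : finType)| :=
  enum_rank (enum_val (mxtens_unindex i).1, enum_val (mxtens_unindex i).2).
apply: (@rep_iso_perm _ _ (rtens (frep E) (frep E')) (frep _) h)
  => [x|x|x y a i j] /=.
- move=> i j; case: (mxtens_indexP i) => i0 i1; case: (mxtens_indexP j) => j0 j1.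
  rewrite /h !mxtens_indexK /= => /enum_rank_inj [].
  by move=> /enum_val_inj -> /enum_val_inj ->.
- by rewrite card_prod.
- case: (mxtens_indexP i) => i0 i1; case: (mxtens_indexP j) => j0 j1.
  by rewrite tensmxE /h mxE !enum_rankK !mxtens_indexK !mxE.
Qed.

Definition sum_entry (A A' B B' : Type) (E : A -> B -> k) (E' : A' -> B' -> k)
    (j : A + A') (i : B + B') : k :=
  match j, i with
  | inl j, inl i => E j i
  | inr j, inr i => E' j i
  | _, _ => 0
  end.

Lemma frep_sum B (E : fentry B) B' (E' : fentry B') :
  rep_iso (rsum (@frep B E) (@frep B' E'))
    (@frep (fun x => (B x + B' x)%type)
       (fun x y a => sum_entry (E x y a) (E' x y a))).
Proof.
pose h x (i : 'I_(#|B x| + #|B' x|)) : 'I_#|((B x + B' x)%type : finType)| :=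
  enum_rank (match split i with
             | inl i => inl (enum_val i) | inr i => inr (enum_val i) end).
apply: (@rep_iso_perm _ _ (rsum (frep E) (frep E')) (frep _) h)
  => [x|x|x y a i j] /=.
- move=> i j; case: (split_ordP i) => i' ->; case: (split_ordP j) => j' ->;
  rewrite /h ?split_lshift ?split_rshift => /enum_rank_inj [] //;
  by move=> /enum_val_inj ->.
- by rewrite card_sum.
- case: (split_ordP i) => i' ->; case: (split_ordP j) => j' ->;
  by rewrite /h ?split_lshift ?split_rshift !mxE !enum_rankK ?block_mxE
    ?split_lshift ?split_rshift !mxE ?split_lshift ?split_rshift ?mxE.
Qed.
End FinRep.

Section PushDownFunctor.
Variables (k : fieldType) (P Q : quiver) (F : qmap P Q).
Implicit Types m n : rep k P.

Lemma push_downE m : push_down F m =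
  @frep k Q (@pd_basis k P Q F m) (@pd_entry k P Q F m).
Proof. by []. Qed.

Lemma push_down_sum m n :
  rep_iso (push_down F (rsum m n)) (rsum (push_down F m) (push_down F n)).
Proof.
apply: rep_iso_sym; rewrite !push_downE.
apply: rep_iso_trans (frep_sum _ _) _.
pose f x (i : pd_basis F m x + pd_basis F n x) : pd_basis F (rsum m n) x :=
  match i with
  | inl u => Tagged (fun y : {u : vert P | F.1 u == x} =>
               'I_(rdim m (val y) + rdim n (val y))) (lshift _ (tagged u))
  | inr u => Tagged (fun y : {u : vert P | F.1 u == x} =>
               'I_(rdim m (val y) + rdim n (val y))) (rshift _ (tagged u))
  end.
apply: (@frep_iso _ _ _ _ _ _ f) => [x|x y a j i].
  pose g (u : pd_basis F (rsum m n) x) : pd_basis F m x + pd_basis F n x :=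
    match split (tagged u) with
    | inl i => inl (Tagged (fun y : {u : vert P | F.1 u == x} =>
                             'I_(rdim m (val y))) i)
    | inr i => inr (Tagged (fun y : {u : vert P | F.1 u == x} =>
                             'I_(rdim n (val y))) i)
    end.
  exists g.
    by case=> -[u i]; rewrite /g /f /= ?split_lshift ?split_rshift.
  case=> u i; rewrite /g /=.
  by case: (split_ordP i) => i' ->; rewrite ?split_lshift ?split_rshift.
case: j => -[v j]; case: i => -[u i];
rewrite /f /pd_entry /=; case: pickP => [b ba|//]; by rewrite ?block_mxE ?mxE.
Qed.

Lemma push_down_empty m : (forall x, rdim m x = 0%N) ->
  rep_iso (push_down F m) (rzero k Q).
Proof.
move=> m0.
pose f x (i : 'I_(rdim (push_down F m) x)) : 'I_0 :=
  cast_ord (m0 _) (tagged (enum_val i)).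
apply: (@rep_iso_perm _ _ (push_down F m) (rzero k Q) f).
- by move=> x i; case: (f x i).
- by move=> x /=; apply: eq_card0 => u; have [] := cast_ord (m0 _) (tagged u).
- by move=> x y a i; case: (f y i).
Qed.

Section Block.
Variables (I : finType).
Implicit Types a b : I -> nat.
(** A block-diagonal matrix with blocks of varying sizes: when the tags agree, the row index is
    transported along that equality before the block is read. *)
Definition blk a b (g : forall x, 'M[k]_(a x, b x))
    (v : {x : I & 'I_(a x)}) (u : {x : I & 'I_(b x)}) : k :=
  if tag v =P tag u is ReflectT e
  then g (tag u) (ecast x 'I_(a x) e (tagged v)) (tagged u) else 0.

Lemma blkE a b (g : forall x, 'M_(a x, b x)) x i j :
  @blk a b g (Tagged (fun x => 'I_(a x)) i) (Tagged (fun x => 'I_(b x)) j) =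
  g x i j.
Proof. by rewrite /blk /=; case: eqP => // e; rewrite (eq_axiomK e). Qed.

Lemma blkN a b (g : forall x, 'M_(a x, b x)) u v : tag v != tag u -> @blk a b g v u = 0.
Proof. by rewrite /blk; case: eqP. Qed.

Lemma big_tagged_ord b (f : {x : I & 'I_(b x)} -> k) :
  \sum_u f u = \sum_x \sum_i f (Tagged (fun x => 'I_(b x)) (i : 'I_(b x))).
Proof.
rewrite (@sig_big_dep _ _ _ I (fun x => 'I_(b x)) xpredT (fun _ _ => true)
  (fun x i => f (Tagged (fun x => 'I_(b x)) i))) /=.
by apply: eq_bigr => -[].
Qed.

Lemma sum_blkl a b (g : forall x, 'M_(a x, b x)) v f :
  \sum_u @blk a b g v u * f u =
  \sum_i g (tag v) (tagged v) i * f (Tagged (fun x => 'I_(b x)) i).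
Proof.
case: v => x j /=; rewrite big_tagged_ord.
rewrite (bigD1 x) //= [X in _ + X]big1 ?addr0; last first.
  by move=> y ne; apply: big1 => i _; rewrite blkN ?mul0r // eq_sym.
by apply: eq_bigr => i _; rewrite blkE.
Qed.

Lemma sum_blkr a b (g : forall x, 'M_(a x, b x)) u f :
  \sum_v f v * @blk a b g v u =
  \sum_i f (Tagged (fun x => 'I_(a x)) i) * g (tag u) i (tagged u).
Proof.
case: u => x j /=; rewrite big_tagged_ord.
rewrite (bigD1 x) //= [X in _ + X]big1 ?addr0; last first.
  by move=> y ne; apply: big1 => i _; rewrite blkN ?mulr0.
by apply: eq_bigr => i _; rewrite blkE.
Qed.
End Block.

Lemma push_down_iso m n : rep_iso m n -> rep_iso (push_down F m) (push_down F n).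
Proof.
pose G (m1 m2 : rep k P) (g : forall x, 'M[k]_(rdim m2 x, rdim m1 x)) x' :=
  emx (blk (fun u : {u : vert P | F.1 u == x'} => g (val u))).
have inv m1 m2 (g : forall x, 'M[k]_(rdim m2 x, rdim m1 x))
    (h : forall x, 'M[k]_(rdim m1 x, rdim m2 x)) x' :
    (forall x, h x *m g x = 1%:M) -> G _ _ h x' *m G _ _ g x' = 1%:M.
  move=> hg; rewrite emx_mul -[RHS]emx1; apply: eq_emx => v u.
  rewrite sum_blkl; case: v => y j; case: u => z i /=.
  have [yz|ne] := eqVneq y z; last first.
    rewrite big1 => [|l _]; last by rewrite blkN ?mulr0.
    by case: eqP => // /(congr1 tag) /= e; rewrite e eqxx in ne.
  case: z / yz i => i.
  rewrite (eq_bigr (fun l => h (val y) j l * g (val y) l i)); last first.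
    by move=> l _; rewrite blkE.
  by have /matrixP/(_ j i) := hg (val y); rewrite !mxE => ->; rewrite eq_Tagged.
move=> [g [h [gh nat]]]; exists (G m n g), (G n m h); split=> [x'|x' y' a'].
  by split; apply: inv => x; case: (gh x).
(* The arrow picked by [pd_entry] depends only on the two vertices, so both products involve the
   same arrow [b], and the claim is naturality at [b]. *)
apply: etrans (emx_mul (pd_entry a') _) _; apply: esym.
apply: etrans (emx_mul _ (pd_entry a')) _; apply: eq_emx => v u.
rewrite sum_blkl sum_blkr /pd_entry /=.
case: pickP => [b ba|_]; last first.
  by rewrite !big1 // => l _; rewrite ?mul0r ?mulr0.
by have /matrixP/(_ (tagged v) (tagged u)) := nat _ _ b; rewrite !mxE => ->.
Qed.
End PushDownFunctor.

(** * Shapes over a quiver *)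

Lemma inj_surj_bij (S T : Type) (f : S -> T) :
  injective f -> (forall y, exists x, f x = y) -> bijective f.
Proof.
move=> fI fS; exists (fun y => projT1 (cid (fS y))).
  by move=> x; case: cid => x' /= /fI.
by move=> y; case: cid.
Qed.

Section QuiverMorphisms.
Variables P Q : quiver.
Implicit Type F : qmap P Q.

Lemma qmor_tail F a : is_qmor F -> F.1 (tail a) = tail (F.2 a).
Proof. by move=> /forallP/(_ a)/andP[/eqP ->]. Qed.

Lemma qmor_head F a : is_qmor F -> F.1 (head a) = head (F.2 a).
Proof. by move=> /forallP/(_ a)/andP[_ /eqP ->]. Qed.

Lemma is_qmorI F : (forall a, tail (F.2 a) = F.1 (tail a)) ->
  (forall a, head (F.2 a) = F.1 (head a)) -> is_qmor F.
Proof. by move=> Ft Fh; apply/forallP => a; rewrite Ft Fh !eqxx. Qed.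

(** Strictness as unique lifting, at tails here and at heads in the next lemma; this is the form in
    which it is used everywhere below. *)
Lemma strict_tail F a b : is_strict_wrapping F ->
  F.2 a = F.2 b -> tail a = tail b -> a = b.
Proof.
case/andP=> _ /forallP/(_ a)/forallP/(_ b) + e t.
by case: (eqVneq a b) => //= _; rewrite e t !eqxx.
Qed.

Lemma strict_head F a b : is_strict_wrapping F ->
  F.2 a = F.2 b -> head a = head b -> a = b.
Proof.
case/andP=> _ /forallP/(_ a)/forallP/(_ b) + e t.
by case: (eqVneq a b) => //= _; rewrite e t !eqxx andbF.
Qed.

Lemma is_strict_wrappingI F : is_qmor F ->
  (forall a b, F.2 a = F.2 b -> tail a = tail b -> a = b) ->
  (forall a b, F.2 a = F.2 b -> head a = head b -> a = b) ->
  is_strict_wrapping F.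
Proof.
move=> hF Ft Fh; apply/andP; split.
  rewrite /is_wrapping hF; apply/forallP => x; apply/forallP => y.
  apply/forallP => a; apply/forallP => b; apply/implyP => /eqP e.
  have /andP[/eqP ta _] := valP a; have /andP[/eqP tb _] := valP b.
  by apply/eqP/val_inj/Ft => //; rewrite ta tb.
apply/forallP => a; apply/forallP => b; apply/implyP => /andP[ne /eqP e].
by apply/andP; split; apply: contraNneq ne => ?; apply/eqP; [exact: Ft|exact: Fh].
Qed.
End QuiverMorphisms.

Section ShapeMorphisms.
Variables Q : quiver.
Implicit Types F X Y : shape Q.

(** Strictness of [G] is automatic: arrows identified by [G] are identified by [smap Y], which is
    strict. *)
Lemma factoringP X Y G :
  reflect (is_qmor G /\ smap Y = qcomp (smap X) G) (G \in factoring X Y).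
Proof.
rewrite inE; apply: (iffP andP) => [[/strict_wrapping_qmor ? /eqP]|[hG e]] //.
rewrite e eqxx; split=> //; apply: is_strict_wrappingI => // a b ab.
  by apply: (strict_tail (sstrict Y)); rewrite e /= !ffunE ab.
by apply: (strict_head (sstrict Y)); rewrite e /= !ffunE ab.
Qed.

Lemma factoring_strict X Y G : G \in factoring X Y -> is_strict_wrapping G.
Proof. by rewrite inE => /andP[]. Qed.

Lemma factoring_qmor X Y G : G \in factoring X Y -> is_qmor G.
Proof. by case/factoringP. Qed.

Lemma factoring_vert X Y G x : G \in factoring X Y ->
  (smap X).1 (G.1 x) = (smap Y).1 x.
Proof. by case/factoringP => _ ->; rewrite ffunE. Qed.

Lemma factoring_arrow X Y G a : G \in factoring X Y ->
  (smap X).2 (G.2 a) = (smap Y).2 a.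
Proof. by case/factoringP => _ ->; rewrite ffunE. Qed.

Lemma factoringI X Y (G : qmap (sdom Y) (sdom X)) : is_qmor G ->
  (forall x, (smap X).1 (G.1 x) = (smap Y).1 x) ->
  (forall a, (smap X).2 (G.2 a) = (smap Y).2 a) -> G \in factoring X Y.
Proof.
move=> hG Gv Ga; apply/factoringP; split=> //.
by rewrite [LHS]surjective_pairing; congr (_, _); apply/ffunP => x; rewrite ffunE.
Qed.

Lemma factoring_inj_arrow X Y G : G \in factoring X Y ->
  injective G.1 -> injective G.2.
Proof.
move=> /factoring_strict hG Ginj a b ab.
apply: (strict_tail hG ab); apply: Ginj.
by rewrite !qmor_tail ?ab //; apply: strict_wrapping_qmor.
Qed.

Lemma factoring_comp X Y Z G H : G \in factoring X Y -> H \in factoring Y Z ->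
  qcomp G H \in factoring X Z.
Proof.
move=> GP HP; have hG := factoring_qmor GP; have hH := factoring_qmor HP.
apply: factoringI => [|x|a]; last 2 first.
- by rewrite ffunE (factoring_vert _ GP) (factoring_vert _ HP).
- by rewrite ffunE (factoring_arrow _ GP) (factoring_arrow _ HP).
by apply: is_qmorI => a; rewrite !ffunE -?qmor_tail -?qmor_head.
Qed.

Section Prod.
Variables F1 F2 : shape Q.

(** The fibre product over [Q]. Its fibre over a vertex of [Q] is the product of the two fibres,
    which matches the basis of a tensor product of push-downs. *)
Definition fp_vert : finType :=
  {x : vert (sdom F1) * vert (sdom F2) | (smap F1).1 x.1 == (smap F2).1 x.2}.
Definition fp_arrow : finType :=
  {a : arrow (sdom F1) * arrow (sdom F2) | (smap F1).2 a.1 == (smap F2).2 a.2}.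

Lemma fp_tail_proof (a : fp_arrow) :
  (smap F1).1 (tail (val a).1) == (smap F2).1 (tail (val a).2).
Proof. by rewrite !qmor_tail ?smor // (eqP (valP a)). Qed.

Lemma fp_head_proof (a : fp_arrow) :
  (smap F1).1 (head (val a).1) == (smap F2).1 (head (val a).2).
Proof. by rewrite !qmor_head ?smor // (eqP (valP a)). Qed.

Definition fp_quiver : quiver :=
  @Quiver fp_vert fp_arrow
    (fun a => exist _ (tail (val a).1, tail (val a).2) (fp_tail_proof a))
    (fun a => exist _ (head (val a).1, head (val a).2) (fp_head_proof a)).

Definition fp_map : qmap fp_quiver Q :=
  ([ffun x : fp_vert => (smap F1).1 (val x).1],
   [ffun a : fp_arrow => (smap F1).2 (val a).1]).

Lemma fp_strict : is_strict_wrapping fp_map.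
Proof.
apply: is_strict_wrappingI => [|a b|a b].
- by apply: is_qmorI => a; rewrite /= !ffunE /= (qmor_tail, qmor_head) ?smor.
- rewrite /= !ffunE => e /(congr1 val) /= [t1 t2].
  apply: val_inj; rewrite [LHS]surjective_pairing [RHS]surjective_pairing.
  congr (_, _); first exact: (strict_tail (sstrict F1)).
  apply: (strict_tail (sstrict F2)) => //.
  by rewrite -(eqP (valP a)) -(eqP (valP b)).
- rewrite /= !ffunE => e /(congr1 val) /= [t1 t2].
  apply: val_inj; rewrite [LHS]surjective_pairing [RHS]surjective_pairing.
  congr (_, _); first exact: (strict_head (sstrict F1)).
  apply: (strict_head (sstrict F2)) => //.
  by rewrite -(eqP (valP a)) -(eqP (valP b)).
Qed.

Definition fp_shape : shape Q := Shape fp_strict.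

Definition fp_fst : qmap fp_quiver (sdom F1) :=
  ([ffun x : fp_vert => (val x).1], [ffun a : fp_arrow => (val a).1]).
Definition fp_snd : qmap fp_quiver (sdom F2) :=
  ([ffun x : fp_vert => (val x).2], [ffun a : fp_arrow => (val a).2]).

Lemma fp_fstP : fp_fst \in factoring F1 fp_shape.
Proof.
by apply: factoringI => [|x|a]; rewrite ?ffunE //; apply: is_qmorI => a;
  rewrite !ffunE.
Qed.

Lemma fp_sndP : fp_snd \in factoring F2 fp_shape.
Proof.
apply: factoringI => [|x|a]; rewrite ?ffunE; last 2 first.
- by rewrite (eqP (valP x)).
- by rewrite (eqP (valP a)).
by apply: is_qmorI => a; rewrite !ffunE.
Qed.
End Prod.

Section Sub.
Variables (F : shape Q) (A : {set vert (sdom F)}).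

Definition sub_vert : finType := {x : vert (sdom F) | x \in A}.
Definition sub_arrow : finType :=
  {a : arrow (sdom F) | (tail a \in A) && (head a \in A)}.

Lemma sub_tail_proof (a : sub_arrow) : tail (val a) \in A.
Proof. by case/andP: (valP a). Qed.
Lemma sub_head_proof (a : sub_arrow) : head (val a) \in A.
Proof. by case/andP: (valP a). Qed.

Definition sub_quiver : quiver :=
  @Quiver sub_vert sub_arrow (fun a => exist _ (tail (val a)) (sub_tail_proof a))
    (fun a => exist _ (head (val a)) (sub_head_proof a)).

Definition sub_map : qmap sub_quiver Q :=
  ([ffun x : sub_vert => (smap F).1 (val x)],
   [ffun a : sub_arrow => (smap F).2 (val a)]).

Lemma sub_strict : is_strict_wrapping sub_map.
Proof.
apply: is_strict_wrappingI => [|a b|a b].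
- by apply: is_qmorI => a; rewrite /= !ffunE /= (qmor_tail, qmor_head) ?smor.
- rewrite /= !ffunE => e /(congr1 val) /= t.
  exact/val_inj/(strict_tail (sstrict F)).
- rewrite /= !ffunE => e /(congr1 val) /= t.
  exact/val_inj/(strict_head (sstrict F)).
Qed.

Definition sub_shape : shape Q := Shape sub_strict.

Definition sub_incl : qmap sub_quiver (sdom F) :=
  ([ffun x : sub_vert => val x], [ffun a : sub_arrow => val a]).

Lemma sub_inclP : sub_incl \in factoring F sub_shape.
Proof.
by apply: factoringI => [|x|a]; rewrite ?ffunE //; apply: is_qmorI => a;
  rewrite !ffunE.
Qed.

Lemma sub_incl_inj : injective sub_incl.1.
Proof. by move=> x y; rewrite !ffunE; apply: val_inj. Qed.
End Sub.
End ShapeMorphisms.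

(** * Push-downs of modules of constant dimension *)

Section ConstRep.
Variables (k : fieldType) (P : quiver).

(** The modules defining strings and bands both have this form, and so do their products along fibre
    products. One dimension at all vertices avoids transports. *)
Definition crep s (A : arrow P -> 'M[k]_s) : rep k P :=
  @Rep k P (fun _ => s) (fun x y a => A (val a)).
End ConstRep.

Section PushConst.
Variables (k : fieldType) (Q : quiver).
Implicit Types X Y : shape Q.

Notation pdb X A x' := (@pd_basis k (sdom X) Q (smap X) (crep A) x').

Definition pdbI X s (A : arrow (sdom X) -> 'M[k]_s) x' (u : vert (sdom X))
    (h : (smap X).1 u == x') (i : 'I_s) : pdb X A x' :=
  existT (fun x : {u : vert (sdom X) | (smap X).1 u == x'} => 'I_s) (exist _ u h) i.

Lemma pdbI_inj X s (A : arrow (sdom X) -> 'M[k]_s) x' u h i u' h' i' :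
  u = u' -> i = i' -> @pdbI X s A x' u h i = @pdbI X s A x' u' h' i'.
Proof. by move=> uu; case: u' / uu h' => h' <-; rewrite (bool_irrelevance h h'). Qed.

Lemma pdbI_vert X s (A : arrow (sdom X) -> 'M[k]_s) x' u h i u' h' i' :
  @pdbI X s A x' u h i = @pdbI X s A x' u' h' i' -> u = u'.
Proof. by move=> /(congr1 tag)/(congr1 val). Qed.

Lemma pdbI_ord X s (A : arrow (sdom X) -> 'M[k]_s) x' u h i u' h' i' :
  @pdbI X s A x' u h i = @pdbI X s A x' u' h' i' -> i = i'.
Proof. by move=> /(congr1 (fun u : pdb X A x' => (tagged u : 'I_s))). Qed.

Lemma pdb_eq X s (A : arrow (sdom X) -> 'M[k]_s) x' (u v : pdb X A x') :
  val (tag u) = val (tag v) -> (tagged u : 'I_s) = tagged v -> u = v.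
Proof. by case: u => -[u hu] i; case: v => -[v hv] j; apply: pdbI_inj. Qed.

(** The arrow picked by [pd_entry] has the same image and the same tail as [b], hence is [b] by
    strictness. *)
Lemma crep_entry1 X s (A : arrow (sdom X) -> 'M[k]_s) x' y' (a' : arr x' y')
    (v : pdb X A y') (u : pdb X A x') b :
  (smap X).2 b = val a' -> val (tag u) = tail b -> val (tag v) = head b ->
  pd_entry a' v u = A b (tagged v) (tagged u).
Proof.
move=> ba ub vb; rewrite /pd_entry; case: pickP => [c /eqP ca|no] /=.
  have /andP[/eqP ct _] := valP c.
  by congr (A _ _ _); apply: (strict_tail (sstrict X)); rewrite ?ca ?ba // ct.
have hb : (tail b == val (tag u)) && (head b == val (tag v)).
  by rewrite ub vb !eqxx.
by have := no (exist _ b hb); rewrite /= ba eqxx.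
Qed.

Lemma crep_entry0 X s (A : arrow (sdom X) -> 'M[k]_s) x' y' (a' : arr x' y')
    (v : pdb X A y') (u : pdb X A x') :
  (forall b, (smap X).2 b = val a' -> tail b = val (tag u) ->
     head b = val (tag v) -> False) ->
  pd_entry a' v u = 0.
Proof.
move=> no; rewrite /pd_entry; case: pickP => [c /eqP ca|//].
by have /andP[/eqP ct /eqP ch] := valP c; case: (no (val c)).
Qed.

(** Joint bijectivity on vertices matches the bases. Joint surjectivity on arrows leaves no arrow
    between the two images, so the mixed entries vanish. *)
Lemma push_split X Y1 Y2 f1 f2 s (A : arrow (sdom X) -> 'M[k]_s) :
  f1 \in factoring X Y1 -> f2 \in factoring X Y2 ->
  injective f1.1 -> injective f2.1 ->
  (forall x y, f1.1 x != f2.1 y) ->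
  (forall x, (exists y, f1.1 y = x) \/ exists y, f2.1 y = x) ->
  (forall a, (exists b, f1.2 b = a) \/ exists b, f2.2 b = a) ->
  rep_iso (push_down (smap X) (crep A))
    (rsum (push_down (smap Y1) (crep (fun b => A (f1.2 b))))
          (push_down (smap Y2) (crep (fun b => A (f2.2 b))))).
Proof.
move=> h1 h2 i1 i2 dis covv cova; apply: rep_iso_sym.
rewrite !push_downE; apply: rep_iso_trans (frep_sum _ _) _.
have fP Y (f : qmap (sdom Y) (sdom X)) : f \in factoring X Y ->
    forall x' (y : {u : vert (sdom Y) | (smap Y).1 u == x'}),
    (smap X).1 (f.1 (val y)) == x'.
  by move=> hf x' y; rewrite (factoring_vert _ hf) (valP y).
pose f x' (u : pdb Y1 (fun b => A (f1.2 b)) x' + pdb Y2 (fun b => A (f2.2 b)) x') :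
    pdb X A x' :=
  match u with
  | inl u => pdbI A (fP _ _ h1 _ (tag u)) (tagged u)
  | inr u => pdbI A (fP _ _ h2 _ (tag u)) (tagged u)
  end.
apply: (@frep_iso _ _ _ _ _ _ f) => [x'|x' y' a' v u].
  apply: inj_surj_bij => [[] u [] v /= e|[[u hu] i]].
  - by congr inl; apply: pdb_eq; [apply/i1/(pdbI_vert e)|apply: (pdbI_ord e)].
  - by have /= /eqP := pdbI_vert e; rewrite (negPf (dis _ _)).
  - by have /= /esym/eqP := pdbI_vert e; rewrite (negPf (dis _ _)).
  - by congr inr; apply: pdb_eq; [apply/i2/(pdbI_vert e)|apply: (pdbI_ord e)].
  - case: (covv u) => -[y yu].
      have hy : (smap Y1).1 y == x' by rewrite -(factoring_vert _ h1) yu.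
      by exists (inl (pdbI (fun b => A (f1.2 b)) hy i)); apply: pdbI_inj.
    have hy : (smap Y2).1 y == x' by rewrite -(factoring_vert _ h2) yu.
    by exists (inr (pdbI (fun b => A (f2.2 b)) hy i)); apply: pdbI_inj.
have q1 := factoring_qmor h1; have q2 := factoring_qmor h2.
(* Inside one piece: [gcov] says that every arrow leaving the image of [g] comes from [Y], so an
   entry is nonzero for the same reason on both sides. *)
have same Y (g : qmap (sdom Y) (sdom X)) (hg : g \in factoring X Y)
    (v1 : pdb Y (fun b => A (g.2 b)) y') (u1 : pdb Y (fun b => A (g.2 b)) x') :
    injective g.1 ->
    (forall b c, tail b = g.1 c -> exists d, g.2 d = b) ->
    pd_entry a' (pdbI A (fP _ _ hg _ (tag v1)) (tagged v1))
      (pdbI A (fP _ _ hg _ (tag u1)) (tagged u1)) = pd_entry a' v1 u1.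
  move=> gI gcov; have qg := factoring_qmor hg.
  have [[b [ba bt bh]]|no] := pselect (exists b, [/\ (smap Y).2 b = val a',
    val (tag u1) = tail b & val (tag v1) = head b]).
    rewrite (crep_entry1 (b := b) ba bt bh).
    rewrite (crep_entry1 (b := g.2 b)) ?(factoring_arrow _ hg) //=.
      by rewrite bt qmor_tail.
    by rewrite bh qmor_head.
  rewrite [RHS]crep_entry0 => [|b ba bt bh]; last by case: no; exists b.
  apply: crep_entry0 => b ba /= bt bh; case: no.
  have [d db] := gcov _ _ bt; exists d; split.
  - by rewrite -(factoring_arrow _ hg) db.
  - by apply: gI; rewrite -bt -db qmor_tail.
  - by apply: gI; rewrite -bh -db qmor_head.
case: v => v; case: u => u /=.
- apply: same => // b c bc; case: (cova b) => -[d db]; first by exists d.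
  by have := dis c (tail d); rewrite -bc -db qmor_tail // eqxx.
- apply: crep_entry0 => b ba /= bt bh; case: (cova b) => -[d db].
    by have /negP[] := dis (tail d) (val (tag u)); rewrite -bt qmor_tail // db.
  by have /negP[] := dis (val (tag v)) (head d); rewrite -bh qmor_head // db.
- apply: crep_entry0 => b ba /= bt bh; case: (cova b) => -[d db].
    by have /negP[] := dis (head d) (val (tag v)); rewrite -bh qmor_head // db.
  by have /negP[] := dis (val (tag u)) (tail d); rewrite -bt qmor_tail // db.
- apply: same => // b c bc; case: (cova b) => -[d db]; last by exists d.
  by have := dis (tail d) c; rewrite -bc -db qmor_tail // eqxx.
Qed.

Lemma push_prod X1 X2 s1 s2 (A1 : arrow (sdom X1) -> 'M[k]_s1)
    (A2 : arrow (sdom X2) -> 'M[k]_s2) :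
  rep_iso
    (rtens (push_down (smap X1) (crep A1)) (push_down (smap X2) (crep A2)))
    (push_down (smap (fp_shape X1 X2))
      (crep (fun a : arrow (fp_quiver X1 X2) => A1 (val a).1 *t A2 (val a).2))).
Proof.
set X := fp_shape X1 X2; set A := fun a : arrow (fp_quiver X1 X2) => _.
rewrite !push_downE; apply: rep_iso_trans (frep_tens _ _) _.
have P1 x' (u : pdb X1 A1 x' * pdb X2 A2 x') :
    (smap X1).1 (val (tag u.1)) == (smap X2).1 (val (tag u.2)).
  by rewrite (eqP (valP (tag u.1))) (eqP (valP (tag u.2))).
have P2 x' (u : pdb X1 A1 x' * pdb X2 A2 x') :
    (smap X).1 (exist _ (val (tag u.1), val (tag u.2)) (P1 _ u)) == x'.
  by rewrite /= ffunE /= (valP (tag u.1)).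
pose f x' (u : pdb X1 A1 x' * pdb X2 A2 x') : pdb X A x' :=
  @pdbI X _ A _ _ (P2 _ u) (mxtens_index (tagged u.1, tagged u.2)).
apply: (@frep_iso _ _ _ _ _ _ f) => [x'|x' y' a' v u].
  apply: inj_surj_bij => [[u1 u2] [v1 v2]|].
    move=> e; have /= [uu vv] := congr1 val (pdbI_vert e).
    have /= /(can_inj (@mxtens_indexK _ _)) [ii jj] := pdbI_ord e.
    by congr (_, _); apply: pdb_eq.
  case=> -[[[u v] /= huv] hu] i.
  have hu1 : (smap X1).1 u == x' by move: (hu); rewrite /= ffunE.
  have hv1 : (smap X2).1 v == x' by rewrite -(eqP huv).
  exists (pdbI A1 hu1 (mxtens_unindex i).1, pdbI A2 hv1 (mxtens_unindex i).2).
  apply: (@pdb_eq X _ A x'); first exact: val_inj.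
  by rewrite /= -[RHS]mxtens_unindexK [mxtens_unindex i]surjective_pairing.
have [[b [ba bt bh]]|no] := pselect (exists b : arrow (sdom X),
    [/\ (smap X).2 b = val a', val (tag (f _ u)) = tail b &
        val (tag (f _ v)) = head b]).
  rewrite (@crep_entry1 X _ A _ _ a' (f _ v) (f _ u) b ba bt bh).
  have [/= t1 t2] := congr1 val bt; have [/= h1 h2] := congr1 val bh.
  have ba' : (smap X1).2 (val b).1 = val a' by rewrite -ba /= ffunE.
  rewrite (@crep_entry1 X1 _ A1 _ _ a' v.1 u.1 (val b).1) //.
  rewrite (@crep_entry1 X2 _ A2 _ _ a' v.2 u.2 (val b).2) //.
    by rewrite /A /f /= tensmxE.
  by rewrite -(eqP (valP b)).
rewrite [LHS](@crep_entry0 X _ A) => [|b ba bt bh]; last by case: no; exists b.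
(* Without a lift in one factor the product of entries is zero; lifts in both factors would combine
   into an arrow of the fibre product. *)
have [[b1 [b1a t1 h1]]|no1] := pselect (exists b, [/\ (smap X1).2 b = val a',
    val (tag u.1) = tail b & val (tag v.1) = head b]); last first.
  rewrite crep_entry0 ?mul0r // => b ba bt bh.
  by case: no1; exists b.
have [[b2 [b2a t2 h2]]|no2] := pselect (exists b, [/\ (smap X2).2 b = val a',
    val (tag u.2) = tail b & val (tag v.2) = head b]); last first.
  rewrite [X in _ * X]crep_entry0 ?mulr0 // => b ba bt bh.
  by case: no2; exists b.
have hb : (smap X1).2 (b1, b2).1 == (smap X2).2 (b1, b2).2.
  by rewrite /= b1a b2a.
case: no; exists (exist _ (b1, b2) hb : arrow (sdom X)); split.
- by rewrite /= ffunE.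
- by apply: val_inj; rewrite /= t1 t2.
- by apply: val_inj; rewrite /= h1 h2.
Qed.
End PushConst.

Section Projection.
Variables (k : fieldType) (Q : quiver) (F : shape Q).

Definition pullback (m : rep k Q) : rep k (sdom F) :=
  @Rep k (sdom F) (fun x => rdim m ((smap F).1 x))
    (fun x y a => rmx m (amap (smor F) a)).

Lemma rmx_cast (m : rep k Q) x y x0 y0 (ex : x0 = x) (ey : y0 = y)
    (a : arr x0 y0) (a' : arr x y) j i : val a = val a' ->
  rmx m a (cast_ord (congr1 (rdim m) (esym ey)) j)
    (cast_ord (congr1 (rdim m) (esym ex)) i) = rmx m a' j i.
Proof.
case: x / ex a' i; case: y / ey j => j a' i aa'.
by have -> : a = a' by [apply: val_inj]; rewrite !cast_ord_id.
Qed.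

(** The projection formula. It shows that a string times any module is still pushed down from the
    linear shape, which makes the span of strings an ideal. *)
Lemma push_proj (m : rep k Q) :
  rep_iso (rtens (push_down (smap F) (constant_rep k (sdom F))) m)
    (push_down (smap F) (pullback m)).
Proof.
apply: rep_iso_trans (rtens_iso (rep_iso_refl _) (rep_frep m)) _.
rewrite !push_downE; apply: rep_iso_trans (frep_tens _ _) _.
pose ev x' (u : {u : vert (sdom F) | (smap F).1 u == x'}) := eqP (valP u).
pose f x' (u : pd_basis (smap F) (constant_rep k (sdom F)) x' * 'I_(rdim m x')) :
    pd_basis (smap F) (pullback m) x' :=
  existT (fun v : {u : vert (sdom F) | (smap F).1 u == x'} =>
      'I_(rdim m ((smap F).1 (val v)))) (tag u.1)
    (cast_ord (congr1 (rdim m) (esym (ev x' (tag u.1)))) u.2).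
apply: (@frep_iso _ _ _ _ _ _ f) => [x'|x' y' a' v u].
  exists (fun w => (existT (fun v : {u : vert (sdom F) | (smap F).1 u == x'} => 'I_1)
      (tag w) ord0, cast_ord (congr1 (rdim m) (ev x' (tag w))) (tagged w))).
    case=> -[u i] j /=; congr (existT _ _ _, _); first by rewrite (ord1 i).
    exact: val_inj.
  by case=> u i; rewrite /f /=; congr (existT _ _ _); apply: val_inj.
rewrite /pd_entry /=; case: pickP => [b /eqP ba|_]; last by rewrite mul0r.
rewrite (@rmx_cast m _ _ _ _ _ _ (amap (smor F) b) a') //.
by rewrite mxE (ord1 (tagged u.1)) (ord1 (tagged v.1)) eqxx mul1r.
Qed.
End Projection.

(** * Chains and the decomposition of acyclic shapes *)

Section Orientation.
Variables (P : quiver) (o : arrow P -> bool).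

(** [o a] tells whether the edge [a] is traversed from tail to head or backwards; [osrc] and [otgt]
    are its ends in traversal order. *)
Definition osrc a := if o a then tail a else head a.
Definition otgt a := if o a then head a else tail a.

Definition chainlike : Prop := injective osrc /\ injective otgt.

(** On a finite quiver a nonempty set in which every vertex has a successor contains a traversal
    cycle. Phrased with sets, the property passes to a source quiver by taking images. *)
Definition acyclic : Prop := forall A : {set vert P},
  (forall x, x \in A -> exists2 a, osrc a = x & otgt a \in A) -> A = set0.
End Orientation.

Section OrientationPullback.
Variables (P Z : quiver) (f : qmap P Z) (o : arrow Z -> bool).

Lemma osrc_map a : is_qmor f ->
  f.1 (osrc (fun b => o (f.2 b)) a) = osrc o (f.2 a).
Proof. by move=> hf; rewrite /osrc; case: ifP; rewrite ?qmor_tail ?qmor_head. Qed.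

Lemma otgt_map a : is_qmor f ->
  f.1 (otgt (fun b => o (f.2 b)) a) = otgt o (f.2 a).
Proof. by move=> hf; rewrite /otgt; case: ifP; rewrite ?qmor_tail ?qmor_head. Qed.

Lemma chainlike_map : is_strict_wrapping f -> chainlike o ->
  chainlike (fun a => o (f.2 a)).
Proof.
move=> hf [si ti]; have qf := strict_wrapping_qmor hf.
split=> a b ab.
  have fab : f.2 a = f.2 b by apply: si; rewrite -!osrc_map // ab.
  move: ab; rewrite /osrc fab; case: ifP => _.
    exact: strict_tail hf fab.
  exact: strict_head hf fab.
have fab : f.2 a = f.2 b by apply: ti; rewrite -!otgt_map // ab.
move: ab; rewrite /otgt fab; case: ifP => _.
  exact: strict_head hf fab.
exact: strict_tail hf fab.
Qed.

Lemma acyclic_map : is_qmor f -> acyclic o -> acyclic (fun a => o (f.2 a)).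
Proof.
move=> hf ac A hA; apply/eqP; rewrite -(imset_eq0 f.1); apply/eqP/ac => x.
case/imsetP=> y /hA[a <- ta] ->; exists (f.2 a); first by rewrite osrc_map.
by rewrite -otgt_map // imset_f.
Qed.
End OrientationPullback.

Lemma linear_orientation P : linear_quiver P ->
  exists2 o : arrow P -> bool, chainlike o & acyclic o.
Proof.
case=> n [v [a [[v' vK v'K] [a' aK a'K] va]]].
pose o e := tail e == v (widen_ord (leqnSn n) (a' e)).
have vs (i : 'I_n) : v (widen_ord (leqnSn n) i) <> v (lift ord0 i).
  by move/(can_inj vK)/(congr1 val) => /=; rewrite /bump /=; lia.
have se i : osrc o (a i) = v (widen_ord (leqnSn n) i).
  rewrite /osrc /o aK; case: eqP => // ne.
  by case: (va i) => -[t h] //; rewrite t in ne.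
have te i : otgt o (a i) = v (lift ord0 i).
  rewrite /otgt /o aK; case: eqP => // ne.
    by case: (va i) => -[t h] //; case: (vs i); rewrite -ne.
  by case: (va i) => -[t h] //; rewrite t in ne.
exists o; first split.
- move=> x y; rewrite -(a'K x) -(a'K y) !se => /(can_inj vK)/(congr1 val) /= e.
  by congr a; apply: val_inj.
- move=> x y; rewrite -(a'K x) -(a'K y) !te => /(can_inj vK)/lift_inj e.
  by rewrite e.
move=> A hA; apply/eqP; apply: contraT => /set0Pn[x0 x0A].
(* Each step inside [A] raises the position in the chain, so positions in [A] would be unbounded. *)
have lv m : exists2 x, x \in A & (m <= v' x)%N.
  elim: m => [|m [x xA mx]]; first by exists x0.
  have [e ex eA] := hA _ xA; exists (otgt o e) => //.
  move: mx; rewrite -ex -(a'K e) se te !vK /= /bump /=; lia.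
by have [x _] := lv n.+1; have := ltn_ord (v' x); lia.
Qed.

Section Chain.
Variables (Q : quiver) (X : shape Q) (o : arrow (sdom X) -> bool).
Hypotheses (cho : chainlike o) (x0 : vert (sdom X)).
Hypothesis sink : forall a, osrc o a <> x0.

(** Walk backwards from [x0] until a vertex with no incoming edge is reached. Each vertex has at
    most one edge in and one out, so no further arrow touches the walk. *)
Lemma chain_component : exists C : {set vert (sdom X)},
  [/\ x0 \in C, forall a, (tail a \in C) = (head a \in C) &
      linear_quiver (sub_quiver C)].
Proof.
have [si ti] := cho.
pose p x := if [pick a | otgt o a == x] is Some a then osrc o a else x.
pose has x := [exists a, otgt o a == x].
have pE a : p (otgt o a) = osrc o a.
  rewrite /p; case: pickP => [b /eqP/ti -> //|/(_ a)]; by rewrite eqxx.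
have hasP x : has x -> exists2 a, otgt o a = x & osrc o a = p x.
  by move=> /existsP[a /eqP <-]; exists a.
pose x i := iter i p x0.
(* A repetition can be shifted down by injectivity of [osrc] until one of the indices is 0; then
   [x0] would be the source of an edge, against [sink]. *)
have xinj n i j : (forall l, (l < n)%N -> has (x l)) -> (i <= n)%N -> (j <= n)%N ->
    x i = x j -> i = j.
  move=> hn; wlog ij : i j / (i <= j)%N.
    move=> W li lj e; case: (leqP i j) => [/W|/ltnW/W]; first exact.
    by move=> W'; apply/esym/W'.
  elim: i j ij => [|i IH] [|j] //.
    move=> _ _ lj; have [a _ e] := hasP _ (hn _ lj); move=> e'.
    by case: (@sink a); apply: etrans e (esym e').
  rewrite ltnS => ij li lj /= e; congr _.+1; apply: IH => //; try exact: ltnW.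
  have [a at' e1] := hasP _ (hn _ li); have [b bt e2] := hasP _ (hn _ lj).
  by rewrite -at' -bt; congr (otgt o _); apply: si; rewrite e1 e2.
have [n0 hn0] : exists n, ~~ has (x n).
  apply: contrapT => /forallNP no.
  have h l : has (x l) by apply: contraT => hl; case: (no l).
  pose g (i : 'I_#|vert (sdom X)|.+1) := x i.
  have gI : injective g.
    move=> i j /(xinj #|vert (sdom X)|) e; apply: val_inj; apply: e => //=;
    by rewrite -ltnS.
  by have := leq_card g gI; rewrite card_ord ltnn.
have [n hn nmin] := ex_minnP (ex_intro (fun n => ~~ has (x n)) n0 hn0).
have hl l : (l < n)%N -> has (x l).
  by move=> ln; apply: contraT => /nmin; rewrite leqNgt ln.
have [a aP] : exists a : 'I_n -> arrow (sdom X), forall i : 'I_n,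
    otgt o (a i) = x i /\ osrc o (a i) = x i.+1.
  have ex (i : 'I_n) : exists e, otgt o e = x i /\ osrc o e = x i.+1.
    by have [e ? ?] := hasP _ (hl i (ltn_ord i)); exists e.
  by exists (fun i => projT1 (cid (ex i))) => i; case: cid.
pose C := [set x i | i : 'I_n.+1].
have xC i : (i <= n)%N -> x i \in C.
  by rewrite -ltnS => li; apply/imsetP; exists (Ordinal li).
have Ct e : otgt o e \in C -> exists i, e = a i.
  case/imsetP=> i _ ei; have [ti' |/ltnSE ni] := ltnP i n.
    by exists (Ordinal ti'); apply: ti; case: (aP (Ordinal ti')) => ->.
  have ein : val i = n by have := ltn_ord i; move: ni => /=; lia.
  have /existsPn/(_ e) := hn.
  by rewrite -[X in x X]ein -ei eqxx.
have Cs e : osrc o e \in C -> exists i, e = a i.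
  case/imsetP=> -[[|i] hi] _ ei; first by case: (@sink e).
  by exists (Ordinal (hi : (i < n)%N)); apply: si; case: (aP (Ordinal (hi : (i < n)%N))) => _ ->.
have aC i : (otgt o (a i) \in C) && (osrc o (a i) \in C).
  have [-> ->] := aP i; rewrite !xC //; exact: ltnW.
have aC' i : (tail (a i) \in C) && (head (a i) \in C).
  move: (aC i); rewrite /osrc /otgt; case: ifP => _ /andP[-> ->] //.
exists C; split; first exact: (xC 0%N).
- move=> e; apply/idP/idP => eC.
    have [i ->] : exists i, e = a i.
      case oe: (o e); [apply: Cs|apply: Ct]; by rewrite /osrc /otgt oe.
    by case/andP: (aC' i).
  have [i ->] : exists i, e = a i.
    case oe: (o e); [apply: Ct|apply: Cs]; by rewrite /osrc /otgt oe.
  by case/andP: (aC' i).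
pose vv (i : 'I_n.+1) : vert (sub_quiver C) := exist _ (x i) (xC _ (ltnSE (ltn_ord i))).
pose aa (i : 'I_n) : arrow (sub_quiver C) := exist _ (a i) (aC' i).
exists n, vv, aa; split.
- apply: inj_surj_bij => [i j /(congr1 val) /= |[y yC]].
    by move/(xinj n) => e; apply: val_inj; apply: e => //=; rewrite -ltnS.
  by have [i _ yi] := imsetP yC; exists i; apply: val_inj.
- apply: inj_surj_bij => [i j /(congr1 val) /= e|[e eC]].
    apply: val_inj; have [i1 i2] := aP i; have [j1 j2] := aP j.
    by apply: (xinj n) => //=; rewrite ?(ltnW (ltn_ord _)) // -i1 -j1 e.
  have [i ei] : exists i, e = a i.
    by apply: Ct; case/andP: eC => t h; rewrite /otgt; case: ifP.
  by exists i; apply: val_inj.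
- move=> i; have [t s] := aP i.
  rewrite /joins; case oe : (o (a i)); [right|left]; move: t s;
  by rewrite /osrc /otgt oe => t s; split; apply: val_inj; rewrite /= ?t ?s.
Qed.
End Chain.

Section Compatible.
Variables (Q : quiver) (X Y : shape Q) (G : qmap (sdom Y) (sdom X)).
Hypothesis hG : G \in factoring X Y.

Lemma is_image_factoring u v (c : qpath u v) :
  is_image (smor X) (pmap (factoring_qmor hG) c) (pmap (smor Y) c).
Proof.
elim: c => [|y z c IH a] /=.
  by case: _ / (factoring_vert u hG); apply: (IsImage (smor X) (qid _)).
apply: is_image_snoc => //=; first exact: factoring_arrow.
exact: factoring_vert.
Qed.

Lemma lifts_factoring x y (p : qpath x y) : lifts (smor Y) p -> lifts (smor X) p.
Proof.
case=> u [v [c [] {x y p}]]; do 3 eexists; exact: is_image_factoring.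
Qed.

(** A path that lifts to [Y] lifts to [X] through [G], so avoiding the paths of [X] suffices.
    Subshapes and fibre products inherit compatibility this way. *)
Lemma compatible_factoring (k : fieldType) (I : ideal k Q) :
  compatible I X -> compatible I Y.
Proof.
move=> cX x y f /cX[n [c [p [np fE]]]]; exists n, c, p; split=> // i.
by move/lifts_factoring; apply: np.
Qed.
End Compatible.

Section Gauge.
Variables (k : fieldType) (P : quiver).

Lemma crep_gauge s t (A : arrow P -> 'M[k]_s) (B : arrow P -> 'M[k]_t)
    (g : vert P -> 'M[k]_(t, s)) (h : vert P -> 'M[k]_(s, t)) :
  (forall x, g x *m h x = 1%:M) -> (forall x, h x *m g x = 1%:M) ->
  (forall a, B a *m g (tail a) = g (head a) *m A a) ->
  rep_iso (crep A) (crep B).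
Proof.
move=> gh hg nat; exists g, h; split=> [x|x y [a xay]] //=.
by have /andP[/eqP <- /eqP <-] := xay.
Qed.

(** A chain has no cycle, so invertible matrices on its edges carry no monodromy: accumulating them
    from the first vertex gives a change of basis that trivialises them. *)
Lemma linear_gauge s (A : arrow P -> 'M[k]_s) :
  linear_quiver P -> (forall a, A a \in unitmx) ->
  rep_iso (crep (fun _ => 1%:M : 'M_s)) (crep A).
Proof.
case=> n [v [a [[v' vK v'K] [a' aK a'K] va]]] uA.
(* The transition from the [i]-th vertex to the next one, inverted when the arrow points back. The
   default [1%:M] in [g] serves only indices past the end. *)
pose st (i : 'I_n) : 'M[k]_s :=
  if tail (a i) == v (widen_ord (leqnSn n) i) then A (a i) else invmx (A (a i)).
have stu i : st i \in unitmx by rewrite /st; case: ifP; rewrite ?unitmx_inv.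
pose g := fix g (i : nat) : 'M[k]_s :=
  if i is i.+1 then (if insub i is Some j then st j else 1%:M) *m g i else 1%:M.
have gu i : g i \in unitmx.
  elim: i => [|i IH] /=; first exact: unitmx1.
  by rewrite unitmx_mul IH andbT; case: insubP => [j _ _|_]; rewrite ?unitmx1.
apply: (@crep_gauge _ _ _ _ (fun x => g (v' x)) (fun x => invmx (g (v' x)))) => x.
- exact: mulmxV.
- exact: mulVmx.
rewrite mulmx1 -(a'K x); set i := a' x.
have gS : g (v' (v (lift ord0 i))) = st i *m g (v' (v (widen_ord (leqnSn n) i))).
  by rewrite !vK /= add0n; case: insubP => [j _ /val_inj ->|]; rewrite ?ltn_ord.
move: gS (stu i); rewrite /st; case: eqP => [t|ne].
  case: (va i) => -[e1 e2]; first by rewrite e1 e2 => ->.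
  have /(can_inj vK)/(congr1 val) /= := etrans (esym t) e1.
  by rewrite /bump /=; lia.
case: (va i) => -[e1 e2] //; rewrite e1 e2 => -> _.
by rewrite mulmxA mulmxV ?mul1mx.
Qed.
End Gauge.

Section Decomposition.
Variables (k : fieldType) (L : string_category k).
Implicit Types X Y : cshape L.

Definition lpush X s (A : arrow (sdom X) -> 'M[k]_s) : lmodule L :=
  lpush_down (F := X) (crep A).

Definition cfactor X (Y : shape L) G (hG : G \in factoring X Y) : cshape L :=
  CShape (compatible_factoring hG (@cshape_compatible k L X)).

Definition csub X (A : {set vert (sdom X)}) : cshape L :=
  cfactor (sub_inclP A).

Definition cprod X (Y : shape L) : cshape L := cfactor (fp_fstP X Y).

Lemma rcls0 : rcls (lzero L) = 0.
Proof. by []. Qed.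

Lemma rcls_sum (m n p : lmodule L) :
  rep_iso m (rsum n p) -> rcls m = rcls n + rcls p.
Proof. by move=> h; rewrite -rclsD; apply: rcls_iso. Qed.

Lemma rcls_tens (m n p : lmodule L) :
  rep_iso (rtens m n) p -> rmul (rcls m) (rcls n) = rcls p.
Proof. by move=> h; rewrite -rclsM; apply: rcls_iso. Qed.

Lemma lpush_empty X s (A : arrow (sdom X) -> 'M[k]_s) :
  #|vert (sdom X)| = 0%N -> rcls (lpush A) = 0.
Proof.
move=> X0; rewrite -rcls0; apply: rcls_iso.
pose m0 := @Rep k (sdom X) (fun _ => 0%N) (fun _ _ _ => 0).
apply: rep_iso_trans (push_down_empty _ (m := m0) _) => //.
apply: push_down_iso.
by exists (fun x => 0), (fun x => 0); split=> [x|x]; have := fintype0 x X0.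
Qed.

Lemma lpush_trivS X s :
  rcls (lpush (fun _ : arrow (sdom X) => 1%:M : 'M[k]_s.+1)) =
  rcls (lpush (fun _ : arrow (sdom X) => 1%:M : 'M[k]_1)) +
  rcls (lpush (fun _ : arrow (sdom X) => 1%:M : 'M[k]_s)).
Proof.
apply: rcls_sum; apply: rep_iso_trans (push_down_sum _ _ _).
apply: push_down_iso; exists (fun x => 1%:M), (fun x => 1%:M).
split=> [x|x y a] /=; rewrite !mulmx1 ?mul1mx //.
by rewrite -scalar_mx_block.
Qed.

Lemma lpush_triv X s :
  rcls (lpush (fun _ : arrow (sdom X) => 1%:M : 'M[k]_s)) =
  rcls (lpush (fun _ : arrow (sdom X) => 1%:M : 'M[k]_1)) *+ s.
Proof.
elim: s => [|s IH]; last by rewrite lpush_trivS IH mulrS.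
rewrite mulr0n -rcls0; apply: rcls_iso; exact: push_down_empty.
Qed.

Lemma lpush_linear (F : linear_shape L) s (A : arrow (sdom F) -> 'M[k]_s) :
  (forall a, A a \in unitmx) -> rcls (lpush A) = rcls (string F) *+ s.
Proof.
move=> uA; rewrite -[RHS]lpush_triv; apply/esym/rcls_iso.
exact/push_down_iso/linear_gauge/uA/linear_shapeP.
Qed.

Lemma lpush_split X Y1 Y2 f1 f2 s (A : arrow (sdom X) -> 'M[k]_s) :
  f1 \in factoring X Y1 -> f2 \in factoring X Y2 ->
  injective f1.1 -> injective f2.1 ->
  (forall x y, f1.1 x != f2.1 y) ->
  (forall x, (exists y, f1.1 y = x) \/ exists y, f2.1 y = x) ->
  (forall a, (exists b, f1.2 b = a) \/ exists b, f2.2 b = a) ->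
  rcls (lpush A) = rcls (lpush (X := Y1) (fun b => A (f1.2 b))) +
                   rcls (lpush (X := Y2) (fun b => A (f2.2 b))).
Proof. by move=> *; apply/rcls_sum/push_split. Qed.

Lemma lpush_closed X (C : {set vert (sdom X)}) s (A : arrow (sdom X) -> 'M[k]_s) :
  (forall a, (tail a \in C) = (head a \in C)) ->
  rcls (lpush A) =
  rcls (lpush (X := csub C) (fun b : sub_arrow C => A (val b))) +
  rcls (lpush (X := csub (~: C)) (fun b : sub_arrow (~: C) => A (val b))).
Proof.
move=> hC.
rewrite (@lpush_split X (csub C) (csub (~: C)) _ _ _ A (sub_inclP C)
  (sub_inclP (~: C))).
- by congr (rcls (@lpush (csub C) s _) + rcls (@lpush (csub (~: C)) s _));
    apply/funext => b; rewrite ffunE.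
- exact: sub_incl_inj.
- exact: sub_incl_inj.
- move=> x y; rewrite !ffunE; apply: contraTneq (valP x) => ->.
  by have := valP y; rewrite inE.
- move=> x; have [xC|xC] := boolP (x \in C).
    by left; exists (exist _ x xC); rewrite ffunE.
  have xC' : x \in ~: C by rewrite inE.
  by right; exists (exist _ x xC'); rewrite ffunE.
- move=> a; have [aC|aC] := boolP (tail a \in C).
    have aC' : (tail a \in C) && (head a \in C) by rewrite -hC aC.
    by left; exists (exist _ a aC'); rewrite ffunE.
  have aC' : (tail a \in ~: C) && (head a \in ~: C) by rewrite !inE -hC aC.
  by right; exists (exist _ a aC'); rewrite ffunE.
Qed.

(** Acyclicity provides a sink, whose component splits off as a chain; induction treats the
    complement. [S] is chosen before [s] and [A], so that push-downs of different modules from the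
    same shape can be compared, and the size bound feeds the inductions on shapes. *)
Theorem chain_decomposition X (o : arrow (sdom X) -> bool) :
  chainlike o -> acyclic o ->
  exists2 S : seq (linear_shape L),
    (forall F, List.In F S -> #|vert (sdom F)| <= #|vert (sdom X)|)%N &
    forall s (A : arrow (sdom X) -> 'M[k]_s), (forall a, A a \in unitmx) ->
      rcls (lpush A) = \sum_(F <- S) rcls (string F) *+ s.
Proof.
move: {2}#|_|.+1 (ltnSn #|vert (sdom X)|) => N.
elim: N X o => // N IH X o leN cho ac.
have [X0|] := eqVneq #|vert (sdom X)| 0%N.
  by exists [::] => // s A _; rewrite big_nil lpush_empty.
move=> X0; have X1 : [set: vert (sdom X)] != set0 by rewrite -card_gt0 cardsT lt0n.
have [x0 sink] : exists x0, forall a, osrc o a <> x0.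
  apply: contrapT => no; case/eqP: X1.
  apply/ac => x _; apply: contrapT => nx; apply: no; exists x => a ax.
  by apply: nx; exists a; rewrite ?inE.
have [C [x0C hC lC]] := chain_component cho sink.
pose FC := LinearShape (linear_cshape := csub C) lC.
pose Y := csub (~: C).
have st := factoring_strict (sub_inclP (~: C)).
have cY : (#|vert (sdom Y)| < #|vert (sdom X)|)%N.
  have -> : #|vert (sdom Y)| = #|~: C| by rewrite card_sig; apply: eq_card.
  by rewrite -(cardsC C) -[X in (X < _)%N]add0n ltn_add2r; apply/card_gt0P; exists x0.
have [S sz dec] := IH Y _ (leq_trans cY leN) (chainlike_map st cho)
  (acyclic_map (strict_wrapping_qmor st) ac).
exists (FC :: S).
  move=> F [<-|/sz h].
    by rewrite /= card_sig; apply: max_card.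
  exact: leq_trans h (ltnW cY).
move=> s A uA; rewrite (lpush_closed A hC) big_cons; congr (_ + _).
  exact: (@lpush_linear FC).
exact: dec.
Qed.
End Decomposition.

(** * Zigzags and interval summands *)

Section Subspaces.
Variable k : fieldType.

Lemma eqmxI p q d (A : 'M[k]_(p, d)) (B : 'M[k]_(q, d)) :
  (forall m (U : 'M_(m, d)), (U <= A)%MS = (U <= B)%MS) -> (A :=: B)%MS.
Proof. by move=> H; apply/eqmxP; rewrite -H submx_refl H submx_refl. Qed.

Definition premx p q d (A : 'M[k]_(p, d)) (B : 'M[k]_(q, d)) : 'M[k]_q :=
  kermx (B *m cokermx A).

Lemma sub_premx p q d m (A : 'M[k]_(p, d)) (B : 'M[k]_(q, d)) (U : 'M_(m, q)) :
  (U <= premx A B)%MS = (U *m B <= A)%MS.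
Proof. by rewrite sub_kermx mulmxA submxE. Qed.

Lemma sub_block p p' d d' m (A : 'M[k]_(p, d)) (B : 'M[k]_(p', d'))
    (U : 'M_(m, d + d')) :
  (U <= block_mx A 0 0 B)%MS = (lsubmx U <= A)%MS && (rsubmx U <= B)%MS.
Proof.
apply/idP/andP => [/submxP[D ->]|[/submxP[C lU] /submxP[D rU]]].
  by rewrite -[D]hsubmxK mul_row_block !mulmx0 addr0 add0r row_mxKl row_mxKr
    !submxMl.
rewrite -[U]hsubmxK lU rU; apply/submxP; exists (row_mx C D).
by rewrite mul_row_block !mulmx0 addr0 add0r.
Qed.

Lemma premx_block p p' q q' d d' (A : 'M[k]_(p, d)) (A' : 'M[k]_(p', d'))
    (B : 'M[k]_(q, d)) (B' : 'M[k]_(q', d')) :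
  (premx (block_mx A 0 0 A') (block_mx B 0 0 B') :=:
   block_mx (premx A B) 0 0 (premx A' B'))%MS.
Proof.
apply: eqmxI => m U; rewrite sub_premx !sub_block !sub_premx.
by rewrite -[U]hsubmxK mul_row_block !mulmx0 addr0 add0r !row_mxKl !row_mxKr.
Qed.

Lemma separating_covector p d (A : 'M[k]_(p, d)) (w : 'rV[k]_d) :
  ~~ (w <= A)%MS -> exists f : 'cV[k]_d, A *m f = 0 /\ w *m f = 1%:M.
Proof.
rewrite submxE; set u := w *m _ => u0.
have /rV0Pn[j uj] := u0.
exists ((u 0 j)^-1 *: (cokermx A *m delta_mx j 0)); split.
  by rewrite -scalemxAr mulmxA mulmx_coker mul0mx scaler0.
rewrite -scalemxAr mulmxA -/u -colE; clearbody u; apply/matrixP => i l.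
by rewrite !mxE (ord1 i) (ord1 l) mulVf.
Qed.

(** A covector that vanishes on the kernel of [B *m cokermx A] factors through this matrix, and the
    part starting with [cokermx A] is the extension. *)
Lemma extend_covector p q d (A : 'M[k]_(p, d)) (B : 'M[k]_(q, d)) (f : 'cV[k]_q) :
  premx A B *m f = 0 -> exists f' : 'cV[k]_d, A *m f' = 0 /\ B *m f' = f.
Proof.
move=> f0; have : (f^T <= (B *m cokermx A)^T)%MS.
  rewrite submxE; apply/eqP.
  have : (cokermx (B *m cokermx A)^T)^T *m f = 0.
    have /submxP[D ->] : ((cokermx (B *m cokermx A)^T)^T <= premx A B)%MS.
      apply/sub_kermxP.
      by rewrite -[LHS]trmxK trmx_mul trmxK mulmx_coker trmx0.
    by rewrite -mulmxA f0 mulmx0.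
  by move/(congr1 trmx); rewrite trmx_mul trmxK trmx0.
case/submxP=> D /(congr1 trmx); rewrite trmxK trmx_mul trmxK => ->.
by exists (cokermx A *m D^T); rewrite mulmxA mulmx_coker mul0mx -[B *m _ *m _]mulmxA.
Qed.
End Subspaces.

Section Zigzag.
Variables (k : fieldType) (P : quiver) (vtx : nat -> vert P).
Implicit Type V : rep k P.

Definition fwd i : option (arr (vtx i) (vtx i.+1)) := [pick a | true].
Definition bwd i : option (arr (vtx i.+1) (vtx i)) := [pick a | true].

(** Modules act on columns while subspaces are row spaces, hence the transpose. *)
Definition tmx V x y (a : arr x y) : 'M[k]_(rdim V x, rdim V y) := (rmx V a)^T.

Definition bmx V i : 'M[k]_(rdim V (vtx i.+1), rdim V (vtx i)) :=
  if bwd i is Some a then tmx V a else 0.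

(** Image along a forward arrow, preimage along a backward one; [genmx] keeps the result square. *)
Definition zstep V i (X : 'M[k]_(rdim V (vtx i))) : 'M[k]_(rdim V (vtx i.+1)) :=
  if fwd i is Some a then <<X *m tmx V a>>%MS else premx X (bmx V i).

(* The subspace of V (vtx i) related to X along the zigzag from vtx 0 to vtx i,
   every map being read as a linear relation. *)
Fixpoint zz V (X : 'M[k]_(rdim V (vtx 0))) i : 'M[k]_(rdim V (vtx i)) :=
  if i is i.+1 then zstep (zz X i) else X.

Lemma zstepS V i (X Y : 'M[k]_(rdim V (vtx i))) :
  (X <= Y)%MS -> (zstep X <= zstep Y)%MS.
Proof.
rewrite /zstep => XY; case: (fwd i) => [a|]; first by rewrite !genmxE submxMr.
by rewrite sub_premx (submx_trans _ XY) // -sub_premx.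
Qed.

Lemma zzS V (X Y : 'M[k]_(rdim V (vtx 0))) i :
  (X <= Y)%MS -> (zz X i <= zz Y i)%MS.
Proof. by move=> XY; elim: i => //= i IH; apply: zstepS. Qed.

Lemma zz_sum V V' (X : 'M[k]_(rdim V (vtx 0))) (Y : 'M[k]_(rdim V' (vtx 0))) i :
  (@zz (rsum V V') (block_mx X 0 0 Y) i :=: block_mx (zz X i) 0 0 (zz Y i))%MS.
Proof.
elim: i => [|i IH] //=; rewrite /zstep; case E: (fwd i) => [a|].
  apply: eqmx_trans (genmxE _) _; apply: eqmx_trans (eqmxMr _ IH) _.
  apply: eqmxI => m U; rewrite sub_block !genmxE /tmx /= tr_block_mx !trmx0.
  by rewrite mulmx_block !mulmx0 !mul0mx !addr0 add0r sub_block.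
have -> : bmx (rsum V V') i = block_mx (bmx V i) 0 0 (bmx V' i).
  rewrite /bmx; case: (bwd i) => [a|]; first by rewrite /tmx /= tr_block_mx !trmx0.
  by apply/matrixP => u v; case: (split_ordP u) => u' ->;
    case: (split_ordP v) => v' ->; rewrite block_mxE !mxE.
apply: eqmx_trans (premx_block _ _ _ _).
by apply: eqmxI => m U; rewrite !sub_premx IH.
Qed.

Lemma zz_iso V V' (g : forall x, 'M[k]_(rdim V' x, rdim V x))
    (h : forall x, 'M[k]_(rdim V x, rdim V' x))
    (X : 'M[k]_(rdim V (vtx 0))) (X' : 'M[k]_(rdim V' (vtx 0))) i :
  (forall x, g x *m h x = 1%:M /\ h x *m g x = 1%:M) ->
  (forall x y (a : arr x y), rmx V' a *m g x = g y *m rmx V a) ->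
  (X' :=: X *m (g (vtx 0))^T)%MS -> (zz X' i :=: zz X i *m (g (vtx i))^T)%MS.
Proof.
move=> gh nat X0; elim: i => [|i IH] //=; rewrite /zstep.
have natT x y (a : arr x y) : (g x)^T *m tmx V' a = tmx V a *m (g y)^T.
  by rewrite /tmx -!trmx_mul nat.
have ghT x : (h x)^T *m (g x)^T = 1%:M by rewrite -trmx_mul (gh x).1 trmx1.
have hgT x : (g x)^T *m (h x)^T = 1%:M by rewrite -trmx_mul (gh x).2 trmx1.
case: (fwd i) => [a|].
  apply: eqmx_trans (genmxE _) _; apply: eqmx_trans (eqmxMr _ IH) _.
  rewrite -mulmxA natT mulmxA; apply: eqmxMr; exact/eqmx_sym/genmxE.
have natB : (g (vtx i.+1))^T *m bmx V' i = bmx V i *m (g (vtx i))^T.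
  by rewrite /bmx; case: (bwd i) => [a|]; rewrite ?natT ?mulmx0 ?mul0mx.
have subg m p x (A : 'M_(p, _)) (U : 'M_(m, _)) :
    (U <= A *m (g x)^T)%MS = (U *m (h x)^T <= A)%MS.
  apply/idP/idP => [/(submxMr (h x)^T)|/(submxMr (g x)^T)].
    by rewrite -mulmxA hgT mulmx1.
  by rewrite -mulmxA ghT mulmx1.
apply: eqmxI => m U; rewrite sub_premx IH !subg sub_premx.
congr (_ <= _)%MS; rewrite -!mulmxA; congr (_ *m _).
by rewrite -[bmx V i]mulmx1 -(hgT (vtx i)) [bmx V i *m _]mulmxA -natB !mulmxA
  ghT mul1mx.
Qed.

(* The multiplicity of the full interval in the zigzag from vtx 0 to vtx n. *)
Definition zrank n V : int :=
  (\rank (@zz V 1%:M n))%:Z - (\rank (@zz V 0 n))%:Z.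

Lemma zrank_iso n V V' : rep_iso V V' -> zrank n V = zrank n V'.
Proof.
move=> [g [h [gh nat]]]; rewrite /zrank.
have fr x : row_free (g x)^T.
  by apply/row_freeP; exists (h x)^T; rewrite -trmx_mul (gh x).2 trmx1.
rewrite !(@zz_iso _ _ g h 1%:M 1%:M n gh nat); last first.
  rewrite mul1mx; apply/eqmxP; rewrite submx1 andbT sub1mx.
  by apply/row_fullP; exists (h (vtx 0))^T; rewrite -trmx_mul (gh _).1 trmx1.
rewrite !(@zz_iso _ _ g h 0 0 n gh nat); last by rewrite mul0mx; apply/eqmxP; rewrite !sub0mx.
by rewrite !mxrankMfree.
Qed.

Lemma zrank_sum n V V' : zrank n (rsum V V') = zrank n V + zrank n V'.
Proof.
rewrite /zrank.
have -> : @zz (rsum V V') 1%:M n = zz (V := rsum V V') (block_mx 1%:M 0 0 1%:M) n.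
  by rewrite -scalar_mx_block.
have -> : @zz (rsum V V') 0 n = zz (V := rsum V V') (block_mx 0 0 0 0) n.
  by rewrite block_mx0.
by rewrite !zz_sum !rank_diag_block_mx !PoszD; lia.
Qed.
End Zigzag.

Section ChainEnumeration.
Variable P : quiver.

(** [linear_quiver] with vertices indexed by [nat]: successors then carry no bound, and values
    beyond [n] are not constrained. *)
Record chain_enum (n : nat) (vtx : nat -> vert P) : Prop := ChainEnum {
  chain_inj : forall i j, (i <= n)%N -> (j <= n)%N -> vtx i = vtx j -> i = j;
  chain_vert : forall x, exists2 i, (i <= n)%N & vtx i = x;
  chain_arrow : forall e, exists2 i, (i < n)%N & joins e (vtx i) (vtx i.+1);
  chain_edge : forall i, (i < n)%N -> exists e, joins e (vtx i) (vtx i.+1);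
  chain_uniq : forall i e e', (i < n)%N -> joins e (vtx i) (vtx i.+1) ->
    joins e' (vtx i) (vtx i.+1) -> e = e'
}.

Lemma linear_chain_enum : linear_quiver P -> exists n vtx, chain_enum n vtx.
Proof.
case=> n [v [a [[v' vK v'K] [a' aK a'K] va]]].
exists n, (fun i => v (inord i)).
have ii i : (i < n)%N -> exists j : 'I_n,
    [/\ val j = i, inord i = widen_ord (leqnSn n) j & inord i.+1 = lift ord0 j].
  move=> lt_in; exists (Ordinal lt_in); split=> //; apply: val_inj => /=;
  by rewrite inordK //= ltnS ltnW.
have ji (j : 'I_n) : inord j = widen_ord (leqnSn n) j.
  by apply: val_inj; rewrite /= inordK // ltnS ltnW.
have jiS (j : 'I_n) : inord j.+1 = lift ord0 j.
  by apply: val_inj; rewrite /= inordK // ltnS.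
split.
- move=> i j li lj /(can_inj vK)/(congr1 val) /=; by rewrite !inordK.
- by move=> x; exists (v' x); rewrite ?inord_val // -ltnS.
- by move=> e; exists (a' e) => //; rewrite ji jiS -{1}(a'K e).
- by move=> i /ii[j [<- -> ->]]; exists (a j).
- move=> i e e' /ii[j [_ -> ->]].
  suff H x : joins x (v (widen_ord (leqnSn n) j)) (v (lift ord0 j)) -> x = a j.
    by move=> /H -> /H ->.
  rewrite -{1}(a'K x); set l := a' x => jn; rewrite -(a'K x) -/l; congr a.
  apply: val_inj; move: (va l) jn; rewrite /joins.
  case=> -[-> ->] [] [] /(can_inj vK)/(congr1 val) /= +
    /(can_inj vK)/(congr1 val) /=; rewrite /bump /=; lia.
Qed.

Variables (n : nat) (vtx : nat -> vert P).
Hypothesis ce : chain_enum n vtx.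

Lemma chain_neqS i : (i < n)%N -> vtx i != vtx i.+1.
Proof.
by move=> lt_in; apply/eqP => /(chain_inj ce) e; have := e (ltnW lt_in) lt_in; lia.
Qed.

Lemma joinsF (x y : vert P) (a : arr x y) : joins (val a) x y.
Proof. by have /andP[/eqP ? /eqP ?] := valP a; left. Qed.

Lemma joinsB (x y : vert P) (a : arr y x) : joins (val a) x y.
Proof. by have /andP[/eqP ? /eqP ?] := valP a; right. Qed.

Lemma chain_fwd i (a : arr (vtx i) (vtx i.+1)) : (i < n)%N -> fwd vtx i = Some a.
Proof.
move=> lt_in; rewrite /fwd; case: pickP => [b _|/(_ a) //]; congr Some.
apply: val_inj; exact: (chain_uniq ce) lt_in (joinsF b) (joinsF a).
Qed.

Lemma chain_bwd i (a : arr (vtx i.+1) (vtx i)) : (i < n)%N ->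
  fwd vtx i = None /\ bwd vtx i = Some a.
Proof.
move=> lt_in; split; last first.
  rewrite /bwd; case: pickP => [b _|/(_ a) //]; congr Some.
  apply: val_inj; exact: (chain_uniq ce) lt_in (joinsB b) (joinsB a).
rewrite /fwd; case: pickP => // b _.
have e := chain_uniq ce lt_in (joinsF b) (joinsB a).
have /andP[/eqP ta _] := valP a; have /andP[/eqP tb _] := valP b.
by case/eqP: (chain_neqS lt_in); apply: etrans (esym tb) (etrans (congr1 tail e) ta).
Qed.

Lemma chain_dich i : (i < n)%N -> (exists a, fwd vtx i = Some a) \/
  (exists a, fwd vtx i = None /\ bwd vtx i = Some a).
Proof.
move=> lt_in; have [e [[t h]|[t h]]] := chain_edge ce lt_in.
  have he : (tail e == vtx i) && (head e == vtx i.+1) by rewrite t h !eqxx.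
  by left; exists (exist _ e he); apply: chain_fwd.
have he : (tail e == vtx i.+1) && (head e == vtx i) by rewrite t h !eqxx.
by right; exists (exist _ e he); apply: chain_bwd.
Qed.
End ChainEnumeration.

Section IntervalSummand.
Variables (k : fieldType) (P : quiver).
Implicit Types V : rep k P.

(* Lifts a vector and a covector at the end of a zigzag to a map from the
   interval module and a map to it whose composition is the identity. *)
Lemma zigzag_backprop V (u : nat -> vert P) i :
  (forall j l, (j <= i)%N -> (l <= i)%N -> u j = u l -> j = l) ->
  (forall j, (j < i)%N -> (exists a, fwd u j = Some a) \/
     (exists a, fwd u j = None /\ bwd u j = Some a)) ->
  forall (w : 'rV_(rdim V (u i))) (f : 'cV_(rdim V (u i))),
  (w <= zz (V := V) (vtx := u) 1%:M i)%MS -> zz (V := V) (vtx := u) 0 i *m f = 0 ->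
  w *m f = 1%:M ->
  exists (ws : forall x, 'rV_(rdim V x)) (fs : forall x, 'cV_(rdim V x)),
  [/\ ws (u i) = w, fs (u i) = f,
      forall j, (j <= i)%N -> ws (u j) *m fs (u j) = 1%:M,
      forall j, (j < i)%N -> forall a, fwd u j = Some a ->
        ws (u j) *m tmx V a = ws (u j.+1) /\ tmx V a *m fs (u j.+1) = fs (u j) &
      forall j, (j < i)%N -> forall a, fwd u j = None -> bwd u j = Some a ->
        ws (u j.+1) *m tmx V a = ws (u j) /\ tmx V a *m fs (u j) = fs (u j.+1)].
Proof.
elim: i => [|i IH] uI dich w f.
  move=> _ _ wf; exists (dfwith (fun x => 0 : 'rV_(rdim V x)) w).
  exists (dfwith (fun x => 0 : 'cV_(rdim V x)) f).
  split=> //; rewrite ?dfwith_in // => j; rewrite leqn0 => /eqP ->.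
  by rewrite !dfwith_in.
move=> ww uf wf.
(* One step back. Along a forward arrow [w] is lifted to a preimage and [f] is composed with the
   map; along a backward arrow [w] is mapped and [f] is extended by [extend_covector]. The pairing
   stays 1 in both cases. *)
have [w' [f' [w'w u'f' w'f' edgeF edgeB]]] :
    exists (w' : 'rV_(rdim V (u i))) (f' : 'cV_(rdim V (u i))),
    [/\ (w' <= zz (V := V) (vtx := u) 1%:M i)%MS,
        zz (V := V) (vtx := u) 0 i *m f' = 0, w' *m f' = 1%:M,
        forall a, fwd u i = Some a -> w' *m tmx V a = w /\ tmx V a *m f = f' &
        forall a, fwd u i = None -> bwd u i = Some a ->
          w *m tmx V a = w' /\ tmx V a *m f' = f].
  move: ww uf; rewrite /= /zstep.
  case: (dich i (ltnSn i)) => [[a ea]|[a [ea eb]]]; rewrite ea.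
    rewrite genmxE => /submxP[D wD] uf.
    exists (D *m zz (V := V) (vtx := u) 1%:M i), (tmx V a *m f); split=> //.
    - exact: submxMl.
    - set X := zz _ _ *m _ in uf.
      have /submxP[E XE] : (X <= <<X>>)%MS by rewrite genmxE.
      by rewrite mulmxA -/X XE -mulmxA uf mulmx0.
    - by rewrite mulmxA -(mulmxA D) -wD.
    - by move=> _ [<-]; rewrite -mulmxA -wD.
  rewrite sub_premx => ww uf.
  have eB : bmx u V i = tmx V a by rewrite /bmx eb.
  rewrite eB in ww uf.
  have [f' [uf' af']] := extend_covector uf.
  exists (w *m tmx V a), f'; split=> //.
    by rewrite -mulmxA af'.
  by move=> b _; rewrite eb => -[<-].
have [||ws [fs [wsi fsi wsfs wsF wsB]]] := IH _ _ w' f' w'w u'f' w'f'.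
- by move=> j l ji li; apply: uI; apply: leqW.
- by move=> j ji; apply: dich; apply: ltnW.
have ne j : (j <= i)%N -> u i.+1 != u j.
  by move=> ji; apply/eqP => /uI e; have := e (leqnn _) (leqW ji); lia.
exists (dfwith ws w), (dfwith fs f); split; rewrite ?dfwith_in //.
- move=> j; rewrite leq_eqVlt => /orP[/eqP ->|ji]; first by rewrite !dfwith_in.
  by rewrite !dfwith_out ?ne // wsfs.
- move=> j ji a ea; rewrite !(dfwith_out _ _ (ne j ji)).
  move: ji; rewrite ltnS leq_eqVlt => /orP[/eqP e|ji].
    by subst j; rewrite !dfwith_in wsi fsi; apply: edgeF.
  by rewrite !dfwith_out ?ne //; apply: wsF.
- move=> j ji a ea eb; rewrite !(dfwith_out _ _ (ne j ji)).
  move: ji; rewrite ltnS leq_eqVlt => /orP[/eqP e|ji].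
    by subst j; rewrite !dfwith_in wsi fsi; apply: edgeB.
  by rewrite !dfwith_out ?ne //; apply: wsB.
Qed.
End IntervalSummand.

Section IntervalSummand.
Variables (k : fieldType) (P : quiver) (n : nat) (vtx : nat -> vert P).
Hypothesis ce : chain_enum n vtx.
Variable V : rep k P.

(* The interval ends at the last vertex where the subspace related to everything
   differs from the subspace related to 0. *)
Lemma interval_summand x0 : rdim V x0 != 0%N ->
  exists (I : {set vert P}) (ws : forall x, 'rV[k]_(rdim V x))
         (fs : forall x, 'cV[k]_(rdim V x)),
  [/\ I != set0, forall x, x \in I -> ws x *m fs x = 1%:M,
      forall x y (a : arr x y), x \in I ->
        ws x *m tmx V a = if y \in I then ws y else 0 &
      forall x y (a : arr x y), y \in I ->
        tmx V a *m fs y = if x \in I then fs x else 0].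
Proof.
move=> x0V.
have exa : exists i, (i <= n)%N && (rdim V (vtx i) != 0%N).
  by have [i li xi] := chain_vert ce x0; exists i; rewrite li xi.
(* Starting at the first nonzero space makes [W] and [U] differ at index 0, and makes the maps to
   and from earlier vertices zero. *)
have [a0 /andP[la0 a0V] a0min] := ex_minnP exa.
have V0 i : (i < a0)%N -> rdim V (vtx i) = 0%N.
  by move=> ia; apply/eqP; apply: contraT => Vi; have := a0min i; rewrite Vi andbT; lia.
pose u j := vtx (j + a0)%N.
pose W := zz (V := V) (vtx := u) 1%:M; pose U := zz (V := V) (vtx := u) 0.
have exb : exists j, (j + a0 <= n)%N && ~~ (W j <= U j)%MS.
  by exists 0%N; rewrite la0 /= submx0 -mxrank_eq0 mxrank1.
have [b /andP[lb WUb] bmax] : exists2 b, (b + a0 <= n)%N && ~~ (W b <= U b)%MS &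
    forall j, (j + a0 <= n)%N && ~~ (W j <= U j)%MS -> (j <= b)%N.
  have ub j : (j + a0 <= n)%N && ~~ (W j <= U j)%MS -> (j <= n)%N.
    by case/andP=> h _; lia.
  by have [b hb bm] := ex_maxnP exb ub; exists b.
have UW j : (U j <= W j)%MS by apply: zzS; apply: sub0mx.
have dich j : (j + a0 < n)%N -> (exists a, fwd u j = Some a) \/
   (exists a, fwd u j = None /\ bwd u j = Some a).
  exact: (chain_dich ce).
have [w [f [wW Uf wf bF bB]]] : exists (w : 'rV_(rdim V (u b))) (f : 'cV_(rdim V (u b))),
    [/\ (w <= W b)%MS, U b *m f = 0, w *m f = 1%:M,
        (b + a0 < n)%N -> forall a, fwd u b = Some a -> w *m tmx V a = 0 &
        (b + a0 < n)%N -> forall a, fwd u b = None -> bwd u b = Some a ->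
          tmx V a *m f = 0].
  have /row_subPn[i wi] := WUb; set w := row i (W b) in wi.
  have wW : (w <= W b)%MS by apply: row_sub.
  have [lb'|nb] := ltnP (b + a0) n; last first.
    have [f [Uf wf]] := separating_covector wi.
    by exists w, f; split=> // h; move: nb; rewrite leqNgt h.
  have WUb1 : (W b.+1 <= U b.+1)%MS.
    by apply: contraT => h; have := bmax b.+1; rewrite h addSn lb' ltnn => /(_ isT).
  move: WUb1; rewrite /W /U /= -/(W b) -/(U b) /zstep.
  case: (dich b lb') => [[a ea]|[a [ea eb]]]; rewrite ea.
    rewrite !genmxE => /(submx_trans (submxMr _ wW))/submxP[D wD].
    (* After this step the image of [W b] lies in that of [U b], so subtracting an element of [U b]
       makes [w] die along the outgoing arrow while staying outside [U b]. *)
    set w' := w - D *m U b.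
    have w'U : ~~ (w' <= U b)%MS.
      apply: contra wi => w'U; rewrite -(subrK (D *m U b) w).
      by rewrite addmx_sub // submxMl.
    have [f [Uf wf]] := separating_covector w'U.
    exists w', f; split=> //.
    - by rewrite addmx_sub // eqmx_opp (submx_trans _ (UW b)) // submxMl.
    - by move=> _ c [<-]; rewrite mulmxBl wD mulmxA subrr.
  have eB : bmx u V b = tmx V a by rewrite /bmx eb.
  rewrite eB => WUb1.
  (* Now [f] must also vanish on the image of [a]. A vector of that image lying in [W b] lies in
     [U b] by [WUb1], so [w] is outside the sum of [U b] and this image. *)
  have wi' : ~~ (w <= col_mx (U b) (tmx V a))%MS.
    apply: contra wi => /submxP[D]; rewrite -[D]hsubmxK mul_row_col.
    set D1 := lsubmx D; set D2 := rsubmx D => wD.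
    have DW : (D2 *m tmx V a <= W b)%MS.
      have -> : D2 *m tmx V a = w - D1 *m U b by rewrite wD addrC addKr.
      by rewrite addmx_sub // eqmx_opp (submx_trans _ (UW b)) // submxMl.
    have DU : (D2 *m tmx V a <= U b)%MS.
      by rewrite -sub_premx; apply: submx_trans WUb1; rewrite sub_premx.
    by rewrite wD addmx_sub // submxMl.
  have [f [Uf wf]] := separating_covector wi'.
  move: Uf; rewrite mul_col_mx => /eqP; rewrite col_mx_eq0 => /andP[/eqP Uf /eqP af].
  exists w, f; split=> //.
  by move=> _ c _; rewrite eb => -[<-].
have uI j l : (j + a0 <= n)%N -> (l + a0 <= n)%N -> u j = u l -> j = l.
  by move=> lj ll /(chain_inj ce) e; have := e lj ll; lia.
have [||ws [fs [wsb fsb wsfs wsF wsB]]] := @zigzag_backprop _ _ V u b _ _ w f wW Uf wf.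
- by move=> j l jb lb2; apply: uI; lia.
- by move=> j jb; apply: dich; lia.
pose I := [set x | [exists j : 'I_b.+1, u j == x]].
have uIn j : (j + a0 <= n)%N -> (u j \in I) = (j <= b)%N.
  move=> lj; rewrite inE; apply/existsP/idP => [[i /eqP /uI e]|jb].
    by have := e _ lj; have := ltn_ord i; lia.
  by exists (Ordinal (jb : (j < b.+1)%N)).
have vIn i : (i < a0)%N -> (vtx i \in I) = false.
  move=> ia; apply/negP; rewrite inE => /existsP[j /eqP].
  by move=> /(chain_inj ce) e; have := ltn_ord j; have := e; lia.
have wF j (a : arr (u j) (u j.+1)) : (j + a0 < n)%N -> u j \in I ->
    ws (u j) *m tmx V a = if u j.+1 \in I then ws (u j.+1) else 0.
  move=> lj; have ea : fwd u j = Some a := chain_fwd ce a lj.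
  rewrite (uIn j.+1) // uIn ?(ltnW lj) // leq_eqVlt => /orP[/eqP jb|jb].
    by subst j; rewrite ltnn wsb; apply: bF.
  by rewrite jb; case: (wsF j jb a ea).
have fF j (a : arr (u j) (u j.+1)) : (j + a0 < n)%N -> u j.+1 \in I ->
    tmx V a *m fs (u j.+1) = if u j \in I then fs (u j) else 0.
  move=> lj; have ea : fwd u j = Some a := chain_fwd ce a lj.
  rewrite (uIn j.+1) // uIn ?(ltnW lj) // => jb.
  by rewrite (ltnW jb); case: (wsF j jb a ea).
have wB j (a : arr (u j.+1) (u j)) : (j + a0 < n)%N -> u j.+1 \in I ->
    ws (u j.+1) *m tmx V a = if u j \in I then ws (u j) else 0.
  move=> lj; have [ea eb] : fwd u j = None /\ bwd u j = Some a := chain_bwd ce a lj.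
  rewrite (uIn j.+1) // uIn ?(ltnW lj) // => jb.
  by rewrite (ltnW jb); case: (wsB j jb a ea eb).
have fB j (a : arr (u j.+1) (u j)) : (j + a0 < n)%N -> u j \in I ->
    tmx V a *m fs (u j) = if u j.+1 \in I then fs (u j.+1) else 0.
  move=> lj; have [ea eb] : fwd u j = None /\ bwd u j = Some a := chain_bwd ce a lj.
  rewrite (uIn j.+1) // uIn ?(ltnW lj) // leq_eqVlt => /orP[/eqP jb|jb].
    by subst j; rewrite ltnn fsb; apply: bB.
  by rewrite jb; case: (wsB j jb a ea eb).
have arrowP x y (a : arr x y) : exists2 i, (i < n)%N &
    (x = vtx i /\ y = vtx i.+1) \/ (x = vtx i.+1 /\ y = vtx i).
  have [i lt_in] := chain_arrow ce (val a).
  have /andP[/eqP ta /eqP ha] := valP a; rewrite /joins ta ha => e.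
  by exists i.
exists I, ws, fs; split.
- by apply/set0Pn; exists (u 0%N); rewrite uIn.
- move=> x; rewrite inE => /existsP[j /eqP <-]; apply: wsfs; exact: ltnSE.
- move=> x y a xI; have [i lt_in e] := arrowP _ _ a.
  have [ia0|ia0] := ltnP i a0; last first.
    have ei : ((i - a0) + a0 = i)%N by lia.
    move: (i - a0)%N ei lt_in e => j <- {ia0 i} lt_jn.
    by case=> -[ex ey]; subst x y; [apply: wF|apply: wB].
  case: e => -[ex ey]; subst x y; first by rewrite vIn in xI.
  rewrite vIn //; by apply/rowP => l; case: (cast_ord (V0 i ia0) l).
- move=> x y a yI; have [i lt_in e] := arrowP _ _ a.
  have [ia0|ia0] := ltnP i a0; last first.
    have ei : ((i - a0) + a0 = i)%N by lia.
    move: (i - a0)%N ei lt_in e => j <- {ia0 i} lt_jn.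
    by case=> -[ex ey]; subst x y; [apply: fF|apply: fB].
  case: e => -[ex ey]; subst x y; last by rewrite vIn in yI.
  rewrite vIn //; by apply/colP => l; case: (cast_ord (V0 i ia0) l).
Qed.
End IntervalSummand.

(** * The span of the strings *)

Section Retract.
Variables (k : fieldType) (P : quiver).
Implicit Types m n : rep k P.

Lemma rep_iso_dim m n x : rep_iso m n -> rdim m x = rdim n x.
Proof.
case=> g [h [gh _]]; have [e1 e2] := gh x; apply/eqP; rewrite eqn_leq.
by have := mulmx1_min e1; have := mulmx1_min e2 => -> ->.
Qed.

(** The complement is the image of the idempotent [1 - p q]. Its rank factorisation [s t] satisfies
    [t s = 1], so [t] and [s] are the projection and the inclusion. *)
Lemma rep_retract m n (p : forall x, 'M[k]_(rdim n x, rdim m x))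
    (q : forall x, 'M[k]_(rdim m x, rdim n x)) :
  (forall x, q x *m p x = 1%:M) ->
  (forall x y (a : arr x y), rmx n a *m p x = p y *m rmx m a) ->
  (forall x y (a : arr x y), rmx m a *m q x = q y *m rmx n a) ->
  exists m', rep_iso n (rsum m m').
Proof.
move=> qp pn qn; pose e x := 1%:M - p x *m q x.
pose s x := col_base (e x); pose t x := row_base (e x).
have st x : s x *m t x = e x by apply: mulmx_base.
have [ti tti] : exists ti, forall x, t x *m ti x = 1%:M.
  have H x : exists B, t x *m B = 1%:M by apply/row_freeP/row_base_free.
  by exists (fun x => projT1 (cid (H x))) => x; case: cid.
have [si sis] : exists si, forall x, si x *m s x = 1%:M.
  have H x : exists B, B *m s x = 1%:M by apply/row_fullP/col_base_full.
  by exists (fun x => projT1 (cid (H x))) => x; case: cid.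
have ee x : e x *m e x = e x.
  rewrite /e mulmxBl mul1mx mulmxBr mulmx1 mulmxA -(mulmxA (p x)) qp mulmx1.
  by rewrite subrr subr0.
have qe x : q x *m e x = 0 by rewrite /e mulmxBr mulmx1 mulmxA qp mul1mx subrr.
have ep x : e x *m p x = 0 by rewrite /e mulmxBl mul1mx -mulmxA qp mulmx1 subrr.
have gen d r (S : 'M[k]_(d, r)) T Si Ti : S *m T *m (S *m T) = S *m T ->
    Si *m S = 1%:M -> T *m Ti = 1%:M -> T *m S = 1%:M.
  move=> STST SiS TTi; transitivity (Si *m (S *m T *m (S *m T)) *m Ti).
    by rewrite !mulmxA SiS mul1mx -!mulmxA TTi mulmx1.
  by rewrite STST !mulmxA SiS mul1mx TTi.
have ts x : t x *m s x = 1%:M.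
  by apply: gen (sis x) (tti x); rewrite st ee.
have qs x : q x *m s x = 0.
  by rewrite -[LHS]mulmx1 -(tti x) mulmxA -(mulmxA (q x)) st qe mul0mx.
have tp x : t x *m p x = 0.
  by rewrite -[LHS]mul1mx -(sis x) -mulmxA (mulmxA (s x)) st ep mulmx0.
exists (@Rep k P (fun x => \rank (e x)) (fun x y a => t y *m rmx n a *m s x)).
exists (fun x => col_mx (q x) (t x)), (fun x => row_mx (p x) (s x)).
split=> [x|x y a] /=.
  split; last by rewrite mul_row_col st addrC subrK.
  by rewrite mul_col_row qp qs tp ts -scalar_mx_block.
rewrite mul_block_col !mul0mx addr0 add0r mul_col_mx qn; congr col_mx.
rewrite -(mulmxA (t y *m rmx n a)) st /e mulmxBr mulmx1 mulmxA.
by rewrite -(mulmxA (t y)) pn mulmxA tp !mul0mx subr0.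
Qed.

(** [const_mx 1] is the 1 by 1 identity between vertices of [I] and an empty matrix elsewhere. *)
Definition chi_rep (I : {set vert P}) : rep k P :=
  @Rep k P (fun x => (x \in I) : nat) (fun _ _ _ => const_mx 1).

Lemma linear_chi_summand m x0 : linear_quiver P -> rdim m x0 != 0%N ->
  exists I m', I != set0 /\ rep_iso m (rsum (chi_rep I) m').
Proof.
move=> /linear_chain_enum[n [vtx ce]] /(interval_summand ce).
case=> I [ws [fs [I0 wfs wI fI]]]; exists I.
pose p x : 'M[k]_(rdim m x, (x \in I)) := \matrix_(i, j) ws x 0 i.
pose q x : 'M[k]_((x \in I), rdim m x) := \matrix_(i, j) fs x j 0.
have tI x (j : 'I_(x \in I)) : x \in I by case: (x \in I) j => // -[].
have uI x (i j : 'I_(x \in I)) : i = j.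
  by apply: val_inj; case: (x \in I) i j => -[[|i] // hi] [[|j] // hj].
suff [m' ?] : exists m', rep_iso m (rsum (chi_rep I) m') by exists m'.
apply: (@rep_retract (chi_rep I) m p q) => [x|x y a|x y a].
- apply/matrixP => i j; have /matrixP/(_ 0 0) := wfs _ (tI _ i).
  rewrite (uI _ i j) !mxE !eqxx => <-; apply: eq_bigr => l _.
  by rewrite !mxE mulrC.
- apply/matrixP => i j; rewrite mxE; have /rowP/(_ i) := wI _ _ a (tI _ j).
  rewrite mxE => e; transitivity ((if y \in I then ws y else 0) 0 i).
    by rewrite -e; apply: eq_bigr => l _; rewrite !mxE mulrC.
  rewrite mxE; case yI: (y \in I).
    have i0 : 'I_(y \in I) by rewrite yI; apply: ord0.
    by rewrite (big_ord1_eq _ _ 0) || (rewrite (bigD1 i0) //= big1 ?addr0 => [|l];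
      rewrite ?(uI _ l i0) ?eqxx // !mxE mulr1).
  by rewrite big1 ?mxE // => l; have := tI _ l; rewrite yI.
- apply/matrixP => i j; rewrite [RHS]mxE; have /colP/(_ j) := fI _ _ a (tI _ i).
  rewrite mxE => e; transitivity ((if x \in I then fs x else 0) j 0); last first.
    by rewrite -e; apply: eq_bigr => l _; rewrite !mxE mulrC.
  rewrite mxE; case xI: (x \in I).
    have i0 : 'I_(x \in I) by rewrite xI; apply: ord0.
    by rewrite (bigD1 i0) //= big1 ?addr0 => [|l];
      rewrite ?(uI _ l i0) ?eqxx // !mxE mul1r.
  by rewrite big1 ?mxE // => l; have := tI _ l; rewrite xI.
Qed.
End Retract.

Section Span.
Variables (k : fieldType) (L : string_category k).
Notation span := (@string_span k L).

Section GenericSpan.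
Variable g : linear_shape L -> repring L.

(** Used for two families: the strings, where it is [string_span], and the idempotents
    [shape_mobius]. *)
Definition lspan (r : repring L) : Prop :=
  exists n (F : 'I_n -> linear_shape L) (c : 'I_n -> int),
    r = \sum_i g (F i) *~ c i.

Lemma lspan0 : lspan 0.
Proof.
have F0 : 'I_0 -> linear_shape L by case.
by exists 0%N, F0, (fun _ => 0); rewrite big_ord0.
Qed.

Lemma lspan_gen F : lspan (g F).
Proof. by exists 1%N, (fun _ => F), (fun _ => 1); rewrite big_ord1. Qed.

Lemma lspanD u v : lspan u -> lspan v -> lspan (u + v).
Proof.
case=> n [F [c ->]] [n' [F' [c' ->]]].
exists (n + n')%N, (fun i => match split i with inl i => F i | inr i => F' i end).
exists (fun i => match split i with inl i => c i | inr i => c' i end).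
rewrite big_split_ord; congr (_ + _); apply: eq_bigr => i _.
  by rewrite split_lshift.
by rewrite split_rshift.
Qed.

Lemma lspanN u : lspan u -> lspan (- u).
Proof.
case=> n [F [c ->]]; exists n, F, (fun i => - c i).
by rewrite -sumrN; apply: eq_bigr => i _; rewrite mulrNz.
Qed.

Lemma lspanB u v : lspan u -> lspan v -> lspan (u - v).
Proof. by move=> su /lspanN; apply: lspanD. Qed.

Lemma lspanMn u n : lspan u -> lspan (u *+ n).
Proof.
by move=> su; elim: n => [|n IH]; [apply: lspan0|rewrite mulrS; apply: lspanD].
Qed.

Lemma lspanMz u c : lspan u -> lspan (u *~ c).
Proof. by move=> su; case: c => n; [|apply: lspanN]; apply: lspanMn. Qed.

Lemma lspan_sum (I : Type) (r : seq I) (p : pred I) (f : I -> repring L) :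
  (forall i, p i -> lspan (f i)) -> lspan (\sum_(i <- r | p i) f i).
Proof. by move=> sf; apply: big_ind sf; [exact: lspan0|exact: lspanD]. Qed.
End GenericSpan.

Let strcls (F : linear_shape L) := rcls (string F).

Lemma span0 : span 0. Proof. exact: (lspan0 strcls). Qed.

Lemma span_string F : span (rcls (string F)).
Proof. exact: (lspan_gen strcls). Qed.

Lemma spanB u v : span u -> span v -> span (u - v).
Proof. exact: (@lspanB strcls). Qed.

Lemma spanD u v : span u -> span v -> span (u + v).
Proof. exact: (@lspanD strcls). Qed.

Lemma spanMn u n : span u -> span (u *+ n).
Proof. exact: (@lspanMn strcls). Qed.

Lemma spanMz u c : span u -> span (u *~ c).
Proof. exact: (@lspanMz strcls). Qed.

Lemma span_sum (I : Type) (r : seq I) (p : pred I) (f : I -> repring L) :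
  (forall i, p i -> span (f i)) -> span (\sum_(i <- r | p i) f i).
Proof. exact: (@lspan_sum strcls). Qed.

Lemma rmulBl : left_distributive (@rmul k L) (fun u v => u - v).
Proof.
move=> u v w; have e := rmulDl (u - v) v w; rewrite subrK in e.
by rewrite e addrK.
Qed.

(** Packaging multiplication by [v] as an additive map gives distributivity over sums and integer
    multiples in a ring without identity. *)
Definition rmulr (v u : repring L) : repring L := rmul u v.

Lemma rmulr_is_zmod_morphism v : zmod_morphism (rmulr v).
Proof. by move=> u w; apply: rmulBl. Qed.

HB.instance Definition _ v := GRing.isZmodMorphism.Build (repring L) (repring L)
  (rmulr v) (rmulr_is_zmod_morphism v).

Lemma repring_diff (r : repring L) :
  exists m n : lmodule L, r = rcls m - rcls n.
Proof.
elim/grothW: r => -[a b]; elim/isoclassW: a => m; elim/isoclassW: b => n.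
exists m, n; rewrite /rcls /gcls -!/(gpi _).
apply/eqP; rewrite eq_sym subr_eq; apply/eqP; rewrite gpiD /=.
by apply/gpiP; exists 0; rewrite /= !addr0.
Qed.

Lemma cpush_span (X : cshape L) (o : arrow (sdom X) -> bool) s
    (A : arrow (sdom X) -> 'M[k]_s) :
  chainlike o -> acyclic o -> (forall a, A a \in unitmx) -> span (rcls (lpush A)).
Proof.
move=> cho ac uA; have [S _ ->] := chain_decomposition cho ac => //.
by apply: span_sum => F _; apply/spanMn/span_string.
Qed.

Lemma push_chi (X : cshape L) (I : {set vert (sdom X)}) :
  rep_iso (push_down (smap X) (chi_rep k I))
    (push_down (smap (csub I)) (crep (fun _ => 1%:M : 'M[k]_1))).
Proof.
apply: rep_iso_sym; rewrite !push_downE.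
have vP x' (u : pd_basis (smap (csub I)) (crep (fun _ => 1%:M : 'M[k]_1)) x') :
    (smap X).1 (val (val (tag u))) == x'.
  by have := valP (tag u); rewrite /= ffunE.
have vI x' (u : pd_basis (smap (csub I)) (crep (fun _ => 1%:M : 'M[k]_1)) x') :
    1%N = (val (val (tag u)) \in I) by rewrite (valP (val (tag u))).
pose f x' (u : pd_basis (smap (csub I)) (crep (fun _ => 1%:M : 'M[k]_1)) x') :
    pd_basis (smap X) (chi_rep k I) x' :=
  existT (fun v : {v : vert (sdom X) | (smap X).1 v == x'} =>
      'I_((val v \in I) : nat)) (exist _ (val (val (tag u))) (vP _ u))
    (cast_ord (vI _ u) (tagged u)).
apply: (@frep_iso _ _ _ _ _ _ f) => [x'|x' y' a' v u].
  apply: inj_surj_bij => [u v e|[[u hu] i]].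
    apply: pdb_eq; last by rewrite (ord1 (tagged u)) (ord1 (tagged v)).
    by have := congr1 (fun w => val (tag w)) e => /= h; apply: val_inj.
  have uI : u \in I by move: i => /=; case: (u \in I) => // -[].
  have hu' : (smap (csub I)).1 (exist _ u uI) == x' by rewrite /= ffunE.
  exists (@pdbI _ _ (csub I) _ (fun _ => 1%:M : 'M[k]_1) x' _ hu' ord0).
  rewrite /f /=; move: (vP _ _) (vI _ _) => /= h1 h2.
  rewrite (bool_irrelevance h1 hu); congr existT; apply: val_inj => /=.
  by move: i h2 => /=; rewrite uI => i _; rewrite (ord1 i).
have [[b [ba bt bh]]|no] := pselect (exists b : arrow (sdom (csub I)),
    [/\ (smap (csub I)).2 b = val a', val (tag u) = tail b &
        val (tag v) = head b]).
  rewrite (@crep_entry1 _ _ (csub I) _ (fun _ => 1%:M : 'M[k]_1) _ _ a' v u b) //.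
  rewrite (ord1 (tagged u)) (ord1 (tagged v)) mxE eqxx /pd_entry.
  case: pickP => [c _|]; first by rewrite mxE.
  have hb : (tail (val b) == val (tag (f _ u))) && (head (val b) == val (tag (f _ v))).
    by rewrite /f /= bt bh /= !eqxx.
  by move/(_ (exist _ (val b) hb)); rewrite /= -ba /= ffunE eqxx.
rewrite [RHS]crep_entry0 => [|b ba bt bh]; last by apply: no; exists b.
rewrite /pd_entry; case: pickP => // c /eqP ca; case: no.
have /andP[/eqP ct /eqP ch] := valP c.
have hc : (tail (val c) \in I) && (head (val c) \in I).
  by rewrite ct ch /f /= (valP (val (tag u))) (valP (val (tag v))).
exists (exist _ (val c) hc); split; first by rewrite /= ffunE.
  by apply: val_inj; rewrite /= ct.
by apply: val_inj; rewrite /= ch.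
Qed.

(** Induction on the total dimension: split off [chi_rep I], whose push-down comes from the subshape
    on [I] and is a sum of strings by the chain decomposition. *)
Lemma push_linear_span (F : linear_shape L) (m : rep k (sdom F)) :
  span (rcls (lpush_down m)).
Proof.
have lF := linear_shapeP F.
move: {2}(\sum_x rdim m x).+1 (ltnSn (\sum_x rdim m x)) => N.
elim: N m => // N IH m leN.
have [m0|/existsPn] := boolP [exists x, rdim m x != 0%N]; last first.
  move=> m0; have -> : rcls (lpush_down m) = 0.
    rewrite -rcls0; apply/rcls_iso/push_down_empty => x.
    by apply/eqP; rewrite -[_ == _]negbK.
  exact: span0.
have /existsP[x0 x0m] := m0.
have [I [m' [I0 im]]] := linear_chi_summand lF x0m.
rewrite (@rcls_sum _ _ _ (@lpush k L (csub I) 1 (fun _ => 1%:M)) (lpush_down m')); last first.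
  apply: rep_iso_trans (push_down_iso _ im) _.
  apply: rep_iso_trans (push_down_sum _ _ _) _.
  exact/rsum_iso/rep_iso_refl/push_chi.
apply: spanD; last first.
  apply: IH; apply: leq_trans (ltnSE leN).
  rewrite [X in (_ < X)%N](eq_bigr (fun x => (x \in I) + rdim m' x)%N) => [|x _].
    rewrite big_split /= -[X in (X < _)%N]add0n ltn_add2r.
    by have /set0Pn[x xI] := I0; rewrite (bigD1 x) //= xI.
  by rewrite (rep_iso_dim x im).
have [o cho ac] := linear_orientation lF.
have st := factoring_strict (sub_inclP I).
apply: (@cpush_span (csub I) (fun a => o ((sub_incl I).2 a))).
- exact: chainlike_map st cho.
- exact: acyclic_map (strict_wrapping_qmor st) ac.
- by move=> a; apply: unitmx1.
Qed.

Lemma span_ideal : is_ring_ideal span.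
Proof.
have mulS m F : span (rmul (rcls (string F)) (rcls m)).
  rewrite (@rcls_tens _ _ _ _ (lpush_down (pullback F m))).
    exact: push_linear_span.
  exact: push_proj.
have mul u v : span v -> span (rmul v u).
  case=> n [F [c ->]]; rewrite -/(rmulr u _) raddf_sum.
  apply: span_sum => i _; rewrite raddfMz /= /rmulr; apply: spanMz.
  have [m [m' ->]] := repring_diff u.
  rewrite rmulC rmulBl !(rmulC _ (rcls (string _))).
  exact: spanB.
split; [exact: span0|exact: spanB|].
by move=> u v sv; rewrite (rmulC u); split; apply: mul.
Qed.
End Span.

(** * Counting factorings by multiplicities *)

Section CoordinateSubspace.
Variable k : fieldType.

Definition cmx d (T : {set 'I_d}) : 'M[k]_d :=
  \matrix_(i, j) ((i == j) && (i \in T))%:R.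

Lemma mul_cmx m d (T : {set 'I_d}) (U : 'M[k]_(m, d)) r i :
  (U *m cmx T) r i = if i \in T then U r i else 0.
Proof.
rewrite mxE (bigD1 i) //= mxE eqxx /= big1 ?addr0 => [|j ne].
  by case: (i \in T); rewrite ?mulr1 ?mulr0.
by rewrite mxE (negPf ne) mulr0.
Qed.

Lemma sub_cmx m d (T : {set 'I_d}) (U : 'M[k]_(m, d)) :
  reflect (forall r i, i \notin T -> U r i = 0) (U <= cmx T)%MS.
Proof.
apply: (iffP idP) => [/submxP[D ->] r i iT|U0].
  by rewrite mul_cmx (negPf iT).
apply/submxP; exists U; apply/matrixP => r i; rewrite mul_cmx.
by case: ifP => // /negbT /U0 ->.
Qed.

Lemma rank_cmx d (T : {set 'I_d}) : \rank (cmx T) = #|T|.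
Proof.
pose E : 'M[k]_(#|T|, d) := \matrix_(i, j) (enum_val i == j)%:R.
have EE : E *m E^T = 1%:M.
  apply/matrixP => i j; rewrite !mxE (bigD1 (enum_val i)) //= !mxE eqxx mul1r.
  rewrite big1 ?addr0 => [|l ne]; first by rewrite (inj_eq enum_val_inj) eq_sym.
  by rewrite !mxE eq_sym (negPf ne) mul0r.
have -> : \rank (cmx T) = \rank E.
  apply/eqmx_rank/andP; split; last first.
    apply/sub_cmx => r i iT; rewrite mxE; case: eqP => // e.
    by rewrite -e enum_valP in iT.
  apply/row_subP => i; have [iT|iT] := boolP (i \in T); last first.
    suff -> : row i (cmx T) = 0 by apply: sub0mx.
    by apply/rowP => j; rewrite !mxE (negPf iT) andbF.
  suff -> : row i (cmx T) = row (enum_rank_in iT i) E by apply: row_sub.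
  by apply/rowP => j; rewrite !mxE iT andbT enum_rankK_in.
by apply/eqP; rewrite -/(row_free E); apply/row_freeP; exists E^T.
Qed.

Section PartialInjection.
Variables (d e : nat) (R : 'I_d -> 'I_e -> bool) (A : 'M[k]_(d, e)).
Hypothesis AR : forall i j, A i j = (R i j)%:R.
Hypothesis Rfun : forall i j j', R i j -> R i j' -> j = j'.
Hypothesis Rinj : forall i i' j, R i j -> R i' j -> i = i'.

Lemma img_cmx (T : {set 'I_d}) :
  (cmx T *m A :=: cmx [set j | [exists i in T, R i j]])%MS.
Proof.
apply/eqmxP/andP; split.
  apply/sub_cmx => r j; rewrite inE => /existsPn nj.
  rewrite mxE big1 // => i _; rewrite mxE AR.
  case: eqP => [->|_] /=; last by rewrite mul0r.
  have := nj i; case: (i \in T) => /=; last by rewrite mul0r.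
  by move=> /negPf ->; rewrite mulr0.
apply/row_subP => j; set T' := [set j | _].
have [jT|jT] := boolP (j \in T'); last first.
  suff -> : row j (cmx T') = 0 by apply: sub0mx.
  by apply/rowP => l; rewrite !mxE (negPf jT) andbF.
move: (jT); rewrite inE => /existsP[i /andP[iT Rij]].
suff -> : row j (cmx T') = row i (cmx T *m A) by apply: row_sub.
apply/rowP => l; rewrite !mxE jT andbT (bigD1 i) //= mxE eqxx iT mul1r AR.
rewrite big1 ?addr0 => [|i' ne].
  by congr (_ : bool)%:R; apply/eqP/idP => [<-//|Ril]; apply: Rfun Rij Ril.
by rewrite mxE eq_sym (negPf ne) mul0r.
Qed.

(** A coordinate without partner spans a line in the kernel of [A], hence the implication rather
    than a conjunction. *)
Lemma pre_cmx (T : {set 'I_e}) :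
  (premx (cmx T) A :=: cmx [set i | [forall j, R i j ==> (j \in T)]])%MS.
Proof.
apply: eqmxI => m U; rewrite sub_premx.
have UA r i j : R i j -> (U *m A) r j = U r i.
  move=> Rij; rewrite mxE (bigD1 i) //= AR Rij mulr1 big1 ?addr0 // => i' ne.
  rewrite AR; case Rij' : (R i' j); last by rewrite mulr0.
  by rewrite (Rinj Rij Rij') eqxx in ne.
apply/sub_cmx/sub_cmx => H r i.
  rewrite inE => /forallPn[j]; rewrite negb_imply => /andP[Rij jT].
  by rewrite -(UA _ _ _ Rij) H.
move=> iT; rewrite mxE big1 // => j _; rewrite AR; case Rji: (R j i).
  rewrite H ?mul0r // inE; apply/forallPn; exists i.
  by rewrite negb_imply Rji iT.
by rewrite mulr0.
Qed.
End PartialInjection.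
End CoordinateSubspace.

Section Lifts.
Variables (Q : quiver) (F : shape Q) (n : nat) (vtx : nat -> vert (sdom F)).
Hypothesis ce : chain_enum n vtx.

(* The vertices of X at which some lift to X of the walk vtx 0, ..., vtx i
   ends. *)
Fixpoint walk_end (X : shape Q) i (x : vert (sdom X)) : Prop :=
  if i is i.+1 then
    exists b a, (smap X).2 a = (smap F).2 b /\
      ([/\ tail b = vtx i, head b = vtx i.+1, head a = x & walk_end i (tail a)] \/
       [/\ head b = vtx i, tail b = vtx i.+1, tail a = x & walk_end i (head a)])
  else (smap X).1 x = (smap F).1 (vtx 0).

Variable X : shape Q.

Lemma walk_end_fiber i x : walk_end (X := X) i x -> (smap X).1 x = (smap F).1 (vtx i).
Proof.
case: i => //= i [b [a [ab [] [_ <- <- _]]]].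
  by rewrite !qmor_head ?smor // ab.
by rewrite !qmor_tail ?smor // ab.
Qed.

Lemma walk_end_factoring G i : G \in factoring X F -> (i <= n)%N ->
  walk_end i (G.1 (vtx i)).
Proof.
move=> GP; have qG := factoring_qmor GP; elim: i => [|i IH] lt_in /=.
  exact: factoring_vert GP.
have [b [] [bt bh]] := chain_edge ce lt_in; exists b, (G.2 b);
split; rewrite ?(factoring_arrow _ GP) //; [left|right]; split=> //.
- by rewrite -qmor_head // bh.
- by rewrite -qmor_tail // bt; apply: IH; apply: ltnW.
- by rewrite -qmor_tail // bt.
- by rewrite -qmor_head // bh; apply: IH; apply: ltnW.
Qed.

Lemma walk_end_seq i x : walk_end (X := X) i x -> exists y : nat -> vert (sdom X),
  [/\ y i = x, forall j, (j <= i)%N -> (smap X).1 (y j) = (smap F).1 (vtx j) &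
   forall j, (j < i)%N -> exists b a, (smap X).2 a = (smap F).2 b /\
     ([/\ tail b = vtx j, head b = vtx j.+1, head a = y j.+1 & tail a = y j] \/
      [/\ head b = vtx j, tail b = vtx j.+1, tail a = y j.+1 & head a = y j])].
Proof.
elim: i x => [|i IH] x.
  by move=> h; exists (fun _ => x); split=> // j; rewrite leqn0 => /eqP ->.
move=> h; have fx := walk_end_fiber h.
case: h => b [a [ab h]].
have [z zi [y [yi yF yE]]] : exists2 z, ([/\ tail b = vtx i, head b = vtx i.+1,
    head a = x & tail a = z] \/ [/\ head b = vtx i, tail b = vtx i.+1,
    tail a = x & head a = z]) & exists y : nat -> vert (sdom X),
  [/\ y i = z, forall j, (j <= i)%N -> (smap X).1 (y j) = (smap F).1 (vtx j) &
   forall j, (j < i)%N -> exists b a, (smap X).2 a = (smap F).2 b /\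
     ([/\ tail b = vtx j, head b = vtx j.+1, head a = y j.+1 & tail a = y j] \/
      [/\ head b = vtx j, tail b = vtx j.+1, tail a = y j.+1 & head a = y j])].
  case: h => -[h1 h2 h3 /IH h4]; [exists (tail a)|exists (head a)] => //;
  by [left|right].
exists (fun j => if j == i.+1 then x else y j); split; first by rewrite eqxx.
  move=> j; rewrite leq_eqVlt => /orP[/eqP ->|ji]; first by rewrite eqxx.
  by rewrite ltn_eqF // yF.
move=> j; rewrite ltnS leq_eqVlt eqSS => /orP[/eqP ->|ji]; last first.
  by rewrite (ltn_eqF ji) (ltn_eqF (leqW ji)); apply: yE.
exists b, a; split=> //; rewrite eqxx (ltn_eqF (ltnSn i)).
by case: zi => -[h1 h2 h3 h4]; [left|right]; split=> //; rewrite h4.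
Qed.

Lemma factoring_walk_end x : walk_end (X := X) n x ->
  exists2 G, G \in factoring X F & G.1 (vtx n) = x.
Proof.
case/walk_end_seq=> y [yn yF yE].
have H z : exists i, (i <= n)%N /\ vtx i = z.
  by have [i] := chain_vert ce z; exists i.
pose idx z := projT1 (cid (H z)).
have idxn z : (idx z <= n)%N by rewrite /idx; case: cid => i [].
have idxK z : vtx (idx z) = z by rewrite /idx; case: cid => i [].
have vtxK i : (i <= n)%N -> idx (vtx i) = i.
  by move=> li; apply: (chain_inj ce).
have K b : exists a, [/\ (smap X).2 a = (smap F).2 b, tail a = y (idx (tail b)) &
    head a = y (idx (head b))].
  have [j jn jb] := chain_arrow ce b; have [b' [a [ab' h]]] := yE j jn.
  have eb : b = b'.
    apply: (chain_uniq ce) jn jb _.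
    by case: h => -[? ? _ _]; [left|right].
  exists a; rewrite eb; split=> //; case: h => -[e1 e2 ta ha];
  by rewrite ?e1 ?e2 vtxK // ltnW.
pose G : qmap (sdom F) (sdom X) :=
  ([ffun z => y (idx z)], [ffun b => projT1 (cid (K b))]).
exists G; last by rewrite ffunE vtxK.
apply: factoringI => [|z|b]; rewrite ?ffunE.
- by apply: is_qmorI => b; rewrite !ffunE; case: cid => a [].
- by rewrite yF // idxK.
- by case: cid => a [].
Qed.

(** Once one end of an edge is placed, strictness leaves one lift of the edge; agreement at a vertex
    therefore spreads along the chain in both directions. *)
Lemma factoring_rigid G G' i : G \in factoring X F -> G' \in factoring X F ->
  (i <= n)%N -> G.1 (vtx i) = G'.1 (vtx i) -> G = G'.
Proof.
move=> GP GP' li e.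
have qG := factoring_qmor GP; have qG' := factoring_qmor GP'.
have arrE b : (smap X).2 (G.2 b) = (smap X).2 (G'.2 b).
  by rewrite (factoring_arrow _ GP) (factoring_arrow _ GP').
have tailE b : G.1 (tail b) = G'.1 (tail b) -> G.2 b = G'.2 b.
  by move=> h; apply: (strict_tail (sstrict X)) => //; rewrite -!qmor_tail.
have headE b : G.1 (head b) = G'.1 (head b) -> G.2 b = G'.2 b.
  by move=> h; apply: (strict_head (sstrict X)) => //; rewrite -!qmor_head.
have stepE j : (j < n)%N ->
    (G.1 (vtx j) = G'.1 (vtx j) <-> G.1 (vtx j.+1) = G'.1 (vtx j.+1)).
  move=> jn; have [b [] [<- <-]] := chain_edge ce jn.
    by split=> [/tailE|/headE] h; rewrite ?qmor_tail ?qmor_head // h.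
  by split=> [/headE|/tailE] h; rewrite ?qmor_tail ?qmor_head // h.
have e0 : G.1 (vtx 0) = G'.1 (vtx 0).
  elim: i li e => // i IH li /(stepE _ li); exact/IH/ltnW.
have ev j : (j <= n)%N -> G.1 (vtx j) = G'.1 (vtx j).
  by elim: j => // j IH jn; apply/(stepE _ jn)/IH/ltnW.
have eV z : G.1 z = G'.1 z by have [j jn <-] := chain_vert ce z; apply: ev.
rewrite [G]surjective_pairing [G']surjective_pairing; congr (_, _).
  exact/ffunP.
by apply/ffunP => b; apply: tailE.
Qed.

Lemma nfact_walk_end : nfact X F = #|[set x | `[< walk_end (X := X) n x >]]|.
Proof.
rewrite /nfact -(card_in_imset (f := fun G : qmap (sdom F) (sdom X) => G.1 (vtx n))).
  apply: eq_card => x; rewrite inE; apply/imsetP/asboolP.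
    by case=> G GP ->; apply: walk_end_factoring.
  by case/factoring_walk_end=> G GP <-; exists G.
by move=> G G' GP GP'; apply: factoring_rigid.
Qed.
End Lifts.

Lemma walk_end_prod (Q : quiver) (F : shape Q) n (vtx : nat -> vert (sdom F))
    (X Y : shape Q) i (x : fp_vert X Y) : chain_enum n vtx -> (i <= n)%N ->
  walk_end vtx (X := fp_shape X Y) i x <->
  walk_end vtx (X := X) i (val x).1 /\ walk_end vtx (X := Y) i (val x).2.
Proof.
move=> ce; elim: i x => [|i IH] x li /=.
  by rewrite ffunE; split=> [h|[]//]; split=> //; rewrite -(eqP (valP x)).
split.
  case=> b [a [ab h]]; rewrite /= ffunE in ab.
  split; exists b.
    exists (val a).1; split=> //; case: h => -[h1 h2 <- /IH[]] //=.
    + exact: ltnW.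
    + by move=> h3 _; left.
    + exact: ltnW.
    + by move=> h3 _; right.
  exists (val a).2; rewrite -(eqP (valP a)); split=> //.
  case: h => -[h1 h2 <- /IH[]] //=.
  + exact: ltnW.
  + by move=> _ h3; left.
  + exact: ltnW.
  + by move=> _ h3; right.
case=> -[b [a [ab h]]] [b' [a' [ab' h']]].
have eb : b' = b.
  apply: (chain_uniq ce (i := i)) => //.
    by case: h' => -[? ? _ _]; [left|right].
  by case: h => -[? ? _ _]; [left|right].
subst b'.
have ha : (smap X).2 (a, a').1 == (smap Y).2 (a, a').2 by rewrite /= ab ab'.
exists b, (exist _ (a, a') ha : arrow (fp_quiver X Y)); split.
  by rewrite /= ffunE.
have ne := chain_neqS ce li.
case: h => -[h1 h2 h3 h4]; case: h' => -[h1' h2' h3' h4'].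
- left; split=> //; last by apply/IH => //; exact: ltnW.
  by apply: val_inj; rewrite /= h3 h3' -surjective_pairing.
- by rewrite -h1 h2' eqxx in ne.
- by rewrite -h1' h2 eqxx in ne.
- right; split=> //; last by apply/IH => //; exact: ltnW.
  by apply: val_inj; rewrite /= h3 h3' -surjective_pairing.
Qed.

(** The universal property of the fibre product, counted through end vertices: a walk lifts to pairs
    exactly when it lifts to both components. *)
Lemma nfact_prod (Q : quiver) (F X Y : shape Q) : linear_quiver (sdom F) ->
  nfact (fp_shape X Y) F = (nfact X F * nfact Y F)%N.
Proof.
move=> /linear_chain_enum[n [vtx ce]]; rewrite !(nfact_walk_end ce).
rewrite -cardsX -(card_imset _ val_inj); apply: eq_card => -[x y].
rewrite !inE /=; apply/imsetP/andP.
  case=> -[[x' y'] hz]; rewrite inE => /asboolP h /= [-> ->].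
  by have [h1 h2] := (walk_end_prod _ ce (leqnn n)).1 h; split; apply/asboolP.
case=> /asboolP h1 /asboolP h2.
have hz : (smap X).1 (x, y).1 == (smap Y).1 (x, y).2.
  by rewrite /= (walk_end_fiber h1) (walk_end_fiber h2).
exists (exist _ (x, y) hz : fp_vert X Y) => //; rewrite inE; apply/asboolP.
exact/(walk_end_prod _ ce (leqnn n)).
Qed.

Section ZrankLifts.
Variables (k : fieldType) (Q : quiver) (F X : shape Q).
Variables (n : nat) (vtx : nat -> vert (sdom F)).
Hypothesis ce : chain_enum n vtx.

Let C : rep k (sdom X) := crep (fun _ => 1%:M : 'M_1).
Let V : rep k (sdom F) := pullback F (push_down (smap X) C).

Definition lift_rel x y (a : arr x y) (u : pd_basis (smap X) C ((smap F).1 x))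
    (v : pd_basis (smap X) C ((smap F).1 y)) : bool :=
  [exists c, [&& (smap X).2 c == (smap F).2 (val a), tail c == val (tag u) &
                 head c == val (tag v)]].

Lemma tmx_lift_rel x y (a : arr x y) i j :
  tmx V a i j = (lift_rel a (enum_val i) (enum_val j))%:R.
Proof.
rewrite !mxE /lift_rel; case: existsP => [[c /and3P[/eqP ca /eqP ct /eqP ch]]|no].
  rewrite (@crep_entry1 _ _ X _ _ _ _ _ _ _ c) // mxE.
  by rewrite (ord1 (tagged _)) (ord1 (tagged (enum_val i))) eqxx.
rewrite crep_entry0 // => c ca ct ch; case: no; exists c.
by rewrite ca ct ch !eqxx.
Qed.

Lemma lift_rel_fun x y (a : arr x y) u v v' :
  lift_rel a u v -> lift_rel a u v' -> v = v'.
Proof.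
move=> /existsP[c /and3P[/eqP ca /eqP ct /eqP ch]].
move=> /existsP[d /and3P[/eqP da /eqP dt /eqP dh]].
apply: pdb_eq; last by rewrite (ord1 (tagged v)) (ord1 (tagged v')).
rewrite -ch -dh; congr head; apply: (strict_tail (sstrict X)).
  by rewrite ca da.
by rewrite ct dt.
Qed.

Lemma lift_rel_inj x y (a : arr x y) u u' v :
  lift_rel a u v -> lift_rel a u' v -> u = u'.
Proof.
move=> /existsP[c /and3P[/eqP ca /eqP ct /eqP ch]].
move=> /existsP[d /and3P[/eqP da /eqP dt /eqP dh]].
apply: pdb_eq; last by rewrite (ord1 (tagged u)) (ord1 (tagged u')).
rewrite -ct -dt; congr tail; apply: (strict_head (sstrict X)).
  by rewrite ca da.
by rewrite ch dh.
Qed.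

Lemma pdb_fiber x (u : vert (sdom X)) : (smap X).1 u = (smap F).1 x ->
  exists i : 'I_(rdim V x), val (tag (enum_val i)) = u.
Proof.
move=> /eqP hu.
by exists (enum_rank (@pdbI _ _ X _ (fun _ => 1%:M : 'M[k]_1) _ _ hu ord0));
  rewrite enum_rankK.
Qed.

(** All subspaces on the zigzag are coordinate subspaces, because lifting is a partial injection.
    Coordinates that a backward step adds from its kernel enter both [T] and [T']; what remains in
    the difference are the ends of lifts of the whole walk. *)
Lemma zz_lifts i : (i <= n)%N -> exists T T' : {set 'I_(rdim V (vtx i))},
  [/\ (zz (V := V) 1%:M i :=: cmx k T)%MS, (zz (V := V) 0 i :=: cmx k T')%MS,
      T' \subset T & forall j, (j \in T :\: T') =
        `[< walk_end vtx i (val (tag (enum_val j))) >]].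
Proof.
elim: i => [|i IH] li.
  exists [set: _], set0; split; first 1 last.
  - apply/eqmxP; rewrite sub0mx andTb; suff -> : cmx k set0 = 0 by apply: sub0mx.
    by move=> d; apply/matrixP => r j; rewrite !mxE inE andbF.
  - exact: sub0set.
  - move=> j; rewrite !inE; apply/esym/asboolP => /=.
    exact/eqP/(valP (tag (enum_val j))).
  - by apply/eqmxP; rewrite submx1 andbT; apply/sub_cmx => r j; rewrite inE.
have [T [T' [zT zT' sT hT]]] := IH (ltnW li).
have hT1 j : j \in T -> j \notin T' -> walk_end vtx i (val (tag (enum_val j))).
  by move=> jT jT'; apply/asboolP; rewrite -hT inE jT jT'.
have [[a ea]|[a [ea eb]]] := chain_dich ce li.
  pose R (u : 'I_(rdim V (vtx i))) (v : 'I_(rdim V (vtx i.+1))) :=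
    lift_rel a (enum_val u) (enum_val v).
  have Rf u v v' : R u v -> R u v' -> v = v'.
    by move=> h h'; apply: enum_val_inj; apply: lift_rel_fun h h'.
  have Ri u u' v : R u v -> R u' v -> u = u'.
    by move=> h h'; apply: enum_val_inj; apply: lift_rel_inj h h'.
  have step (Y : 'M[k]_(rdim V (vtx i))) Z : (Y :=: cmx k Z)%MS ->
      (zstep Y :=: cmx k [set j | [exists i in Z, R i j]])%MS.
    move=> YZ; rewrite /zstep ea; apply: eqmx_trans (genmxE _) _.
    apply: eqmx_trans (eqmxMr _ YZ) _; apply: img_cmx => //; exact: tmx_lift_rel.
  exists [set j | [exists i in T, R i j]], [set j | [exists i in T', R i j]].
  split; [exact: step|exact: step| |].
    apply/subsetP => j; rewrite !inE => /existsP[l /andP[lT Rlj]].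
    by apply/existsP; exists l; rewrite Rlj (subsetP sT).
  have /andP[/eqP at_ /eqP ah] := valP a.
  move=> j; rewrite !inE; apply/andP/asboolP.
    case=> /existsPn n1 /existsP[l /andP[lT Rlj]].
    have /existsP[c /and3P[/eqP ca /eqP ct /eqP ch]] := Rlj.
    exists (val a), c; split=> //; left; split=> //; rewrite ct; apply: hT1 => //.
    by have := n1 l; rewrite Rlj andbT.
  case=> b [c [cb h]].
  have eb : b = val a.
    apply: (chain_uniq ce li); last exact: joinsF.
    by case: h => -[? ? _ _]; [left|right].
  subst b; case: h => -[h1 h2 h3 h4]; last first.
    by case/eqP: (chain_neqS ce li); apply: etrans (esym at_) h2.
  have [l lE] := pdb_fiber (walk_end_fiber h4).
  have Rlj : R l j by apply/existsP; exists c; rewrite cb lE h3 !eqxx.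
  have : l \in T :\: T' by rewrite hT; apply/asboolP; rewrite lE.
  rewrite inE => /andP[lT' lT]; split; last by apply/existsP; exists l; rewrite lT.
  apply/existsPn => l'; apply/negP => /andP[l'T' Rl'j].
  by rewrite (Ri _ _ _ Rlj Rl'j) l'T' in lT'.
pose R (v : 'I_(rdim V (vtx i.+1))) (u : 'I_(rdim V (vtx i))) :=
  lift_rel a (enum_val v) (enum_val u).
have Rf u v v' : R u v -> R u v' -> v = v'.
  by move=> h h'; apply: enum_val_inj; apply: lift_rel_fun h h'.
have Ri u u' v : R u v -> R u' v -> u = u'.
  by move=> h h'; apply: enum_val_inj; apply: lift_rel_inj h h'.
have step (Y : 'M[k]_(rdim V (vtx i))) Z : (Y :=: cmx k Z)%MS ->
    (zstep Y :=: cmx k [set i | [forall j, R i j ==> (j \in Z)]])%MS.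
  move=> YZ; rewrite /zstep ea /bmx eb.
  apply: eqmx_trans (pre_cmx (tmx_lift_rel a) Ri Z).
  by apply: eqmxI => m U; rewrite !sub_premx YZ.
exists [set i | [forall j, R i j ==> (j \in T)]].
exists [set i | [forall j, R i j ==> (j \in T')]].
split; [exact: step|exact: step| |].
  apply/subsetP => j; rewrite !inE => /forallP h; apply/forallP => l.
  by apply/implyP => Rjl; have /implyP/(_ Rjl) := h l; apply: subsetP.
have /andP[/eqP at_ /eqP ah] := valP a.
move=> j; rewrite !inE; apply/andP/asboolP.
  case=> /forallPn[l]; rewrite negb_imply => /andP[Rjl lT'] /forallP/(_ l).
  rewrite Rjl => /= lT.
  have /existsP[c /and3P[/eqP ca /eqP ct /eqP ch]] := Rjl.
  by exists (val a), c; split=> //; right; split=> //; rewrite ch; apply: hT1.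
case=> b [c [cb h]].
have ebb : b = val a.
  apply: (chain_uniq ce li); last exact: joinsB.
  by case: h => -[? ? _ _]; [left|right].
subst b; case: h => -[h1 h2 h3 h4].
  by case/eqP: (chain_neqS ce li); apply: etrans (esym h1) at_.
have [l lE] := pdb_fiber (walk_end_fiber h4).
have Rlj : R j l by apply/existsP; exists c; rewrite cb lE h3 !eqxx.
have : l \in T :\: T' by rewrite hT; apply/asboolP; rewrite lE.
rewrite inE => /andP[lT' lT]; split.
  by apply/forallPn; exists l; rewrite Rlj.
by apply/forallP => l'; apply/implyP => /(Rf _ _ _ Rlj) <-.
Qed.

Lemma zrank_push : zrank vtx n V = (nfact X F)%:Z.
Proof.
have [T [T' [zT zT' sT hT]]] := zz_lifts (leqnn n).
rewrite /zrank zT zT' !rank_cmx subzn ?subset_leq_card //; congr Posz.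
rewrite -cardsDS // (nfact_walk_end ce).
rewrite -(card_in_imset (f := fun j : 'I_(rdim V (vtx n)) => val (tag (enum_val j)))).
  apply: eq_card => x; rewrite inE; apply/imsetP/asboolP.
    by case=> j; rewrite hT => /asboolP h ->.
  move=> h; have [j jE] := pdb_fiber (walk_end_fiber h).
  by exists j => //; rewrite hT; apply/asboolP; rewrite jE.
move=> i j _ _ e; apply/enum_val_inj/pdb_eq => //.
by rewrite (ord1 (tagged (enum_val i))) (ord1 (tagged (enum_val j))).
Qed.
End ZrankLifts.

(** * Multiplicities as additive functions on the representation ring *)

Section Multiplicity.
Variables (k : fieldType) (L : string_category k).
Implicit Types (F : linear_shape L) (m : lmodule L).

Lemma pullback_iso (Q : quiver) (F : shape Q) (m n : rep k Q) :
  rep_iso m n -> rep_iso (pullback F m) (pullback F n).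
Proof.
move=> [g [h [gh nat]]].
exists (fun x => g ((smap F).1 x)), (fun x => h ((smap F).1 x)).
by split=> [x|x y a]; [apply: gh|apply: nat].
Qed.

Definition lchain F :=
  cid (linear_chain_enum (linear_shapeP F)).

Definition mult F m : int :=
  zrank (projT1 (cid (projT2 (lchain F)))) (projT1 (lchain F)) (pullback F m).

Lemma mult_iso F (m n : lmodule L) : rep_iso m n -> mult F m = mult F n.
Proof. by move=> mn; apply/zrank_iso/pullback_iso. Qed.

Lemma mult_sum F (m n : lmodule L) : mult F (lsum m n) = mult F m + mult F n.
Proof. exact: (zrank_sum _ _ (pullback F m) (pullback F n)). Qed.

Definition imult F (u : isoclass L) : int := mult F (repr u).

Lemma imultE F m : imult F (icls m) = mult F m.
Proof. by apply/mult_iso/iclsP; rewrite icls_repr. Qed.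

Lemma imultD F u v : imult F (u + v) = imult F u + imult F v.
Proof.
elim/isoclassW: u => m; elim/isoclassW: v => n.
by rewrite {1}/+%R /= iaddE !imultE mult_sum.
Qed.

Definition phi F (r : repring L) : int :=
  imult F (repr r).1 - imult F (repr r).2.

Lemma phi_gpi F u : phi F (gpi u) = imult F u.1 - imult F u.2.
Proof.
have /gpiP[p] := gpi_repr (gpi u).
by move/(congr1 (imult F)); rewrite !imultD /phi -/(repr _); lia.
Qed.

Lemma phi_is_zmod_morphism F : zmod_morphism (phi F).
Proof.
move=> u v; elim/grothW: u => u; elim/grothW: v => v.
have -> : gpi u - gpi v = gpi (u.1 + v.2, u.2 + v.1).
  apply/eqP; rewrite subr_eq eq_sym; apply/eqP.
  rewrite gpiD; apply/gpiP; exists 0 => /=; rewrite !addr0.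
  by rewrite [LHS](AC (3*1) ((1*2*4)*3)) /= [RHS](AC (1*3) ((1*4*2)*3)).
by rewrite !phi_gpi /= !imultD; lia.
Qed.

HB.instance Definition _ F := GRing.isZmodMorphism.Build (repring L) int
  (phi F) (phi_is_zmod_morphism F).

Lemma phi_rcls F m : phi F (rcls m) = mult F m.
Proof.
have imult0 : imult F 0 = 0.
  by apply: (addrI (imult F 0)); rewrite -imultD !addr0.
by rewrite phi_gpi /= imultE -[RHS]subr0; congr (_ - _).
Qed.

(** Here [X] is any compatible shape, connected or not, so fibre products and subshapes are
    covered. *)
Lemma phi_push F (X : cshape L) :
  phi F (rcls (lpush (fun _ : arrow (sdom X) => 1%:M : 'M[k]_1))) = (nfact X F)%:Z.
Proof.
rewrite phi_rcls; apply: zrank_push; exact: (projT2 (cid (projT2 (lchain F)))).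
Qed.

Lemma phi_string F F' : phi F (rcls (string F')) = (nfact F' F)%:Z.
Proof. exact: (phi_push F F'). Qed.
End Multiplicity.

(** * Factorings between linear shapes *)

Lemma chain_card_vert P n vtx : @chain_enum P n vtx -> #|vert P| = n.+1.
Proof.
move=> ce; pose f (i : 'I_n.+1) := vtx i.
have fb : bijective f.
  apply: inj_surj_bij => [i j /(chain_inj ce) e|x].
    by apply: val_inj; apply: e; rewrite -ltnS.
  have [i li ix] := chain_vert ce x.
  by exists (Ordinal (li : (i < n.+1)%N)).
by rewrite -(bij_eq_card fb) card_ord.
Qed.

Lemma chain_card_arrow P n vtx : @chain_enum P n vtx -> #|arrow P| = n.
Proof.
move=> ce; have H (i : 'I_n) : exists e, joins e (vtx i) (vtx i.+1).
  exact: (chain_edge ce).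
pose f i := projT1 (cid (H i)).
have fP i : joins (f i) (vtx i) (vtx i.+1) by rewrite /f; case: cid.
have fb : bijective f.
  apply: inj_surj_bij => [i j e|e].
    have hi := fP i; have hj := fP j; rewrite e in hi.
    have [li lj] := (ltn_ord i, ltn_ord j).
    have I u v := @chain_inj _ _ _ ce u v.
    have h1 := I i j (ltnW li) (ltnW lj); have h2 := I i.+1 j.+1 li lj.
    have h3 := I i j.+1 (ltnW li) lj; have h4 := I i.+1 j li (ltnW lj).
    apply: val_inj => /=; case: hi => -[a1 b1]; case: hj => -[a2 b2].
    - exact: h1 (etrans (esym a1) a2).
    - by have := h3 (etrans (esym a1) a2); have := h4 (etrans (esym b1) b2); lia.
    - by have := h3 (etrans (esym b1) b2); have := h4 (etrans (esym a1) a2); lia.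
    - exact: h1 (etrans (esym b1) b2).
  have [i li ie] := chain_arrow ce e; exists (Ordinal li).
  exact: (chain_uniq ce) li (fP (Ordinal li)) ie.
by rewrite -(bij_eq_card fb) card_ord.
Qed.

Lemma monotone_walk (p : nat -> nat) m :
  (forall i, (i < m)%N -> p i.+1 = (p i).+1 \/ p i = (p i.+1).+1) ->
  (forall i, (i.+1 < m)%N -> p i <> p i.+2) ->
  (forall i, (i <= m)%N -> p i = (p 0 + i)%N) \/
  (forall i, (i <= m)%N -> p 0%N = (p i + i)%N).
Proof.
move=> adj nob.
have dir i : (i < m)%N -> (p i.+1 = (p i).+1 <-> p 1%N = (p 0%N).+1).
  elim: i => // i IH lim; have := IH (ltnW lim); have := adj i (ltnW lim).
  have := adj i.+1 lim; have := nob i lim; lia.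
have [d|d] := pselect (p 1%N = (p 0%N).+1); [left|right].
  elim=> [|i IH] im; first by rewrite addn0.
  by have := IH (ltnW im); have [_ /(_ d)] := dir i im; lia.
elim=> [|i IH] im; first by rewrite addn0.
have := IH (ltnW im); have [h _] := dir i im; have := adj i im; lia.
Qed.

Section LinearFactoring.
Variables (Q : quiver) (X F : shape Q).
Variables (n m : nat) (vX : nat -> vert (sdom X)) (vF : nat -> vert (sdom F)).
Hypotheses (cX : chain_enum n vX) (cF : chain_enum m vF).

Lemma factoring_positions G : G \in factoring X F ->
  exists p : nat -> nat, [/\ forall i, G.1 (vF i) = vX (p i),
    forall i, (p i <= n)%N &
    (forall i, (i <= m)%N -> p i = (p 0 + i)%N) \/
    (forall i, (i <= m)%N -> p 0%N = (p i + i)%N)].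
Proof.
move=> GP; have qG := factoring_qmor GP.
have H z : exists i, (i <= n)%N /\ vX i = z.
  by have [i] := chain_vert cX z; exists i.
pose idx z := projT1 (cid (H z)).
have idxn z : (idx z <= n)%N by rewrite /idx; case: cid => i [].
have idxK z : vX (idx z) = z by rewrite /idx; case: cid => i [].
have vK i : (i <= n)%N -> idx (vX i) = i by move=> li; apply: (chain_inj cX).
pose p i := idx (G.1 (vF i)).
have pE i : G.1 (vF i) = vX (p i) by rewrite idxK.
have gj b u v : joins b u v -> joins (G.2 b) (G.1 u) (G.1 v).
  by case=> -[<- <-]; [left|right]; rewrite !qmor_tail ?qmor_head.
have adj i : (i < m)%N -> exists2 j, (j < n)%N &
    (p i = j /\ p i.+1 = j.+1) \/ (p i = j.+1 /\ p i.+1 = j).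
  move=> im; have [b bE] := chain_edge cF im.
  have [j jn jE] := chain_arrow cX (G.2 b); exists j => //.
  move: (gj _ _ _ bE) jE; rewrite /joins /p.
  by case=> -[<- <-] [] [-> ->]; rewrite !vK //; try exact: ltnW;
    [left|right|right|left].
exists p; split=> // [i|]; first exact: idxn.
apply: monotone_walk => i im; first by have [j _] := adj i im; lia.
(* If the image turned back at [vF i.+1], both edges there would have the same image arrow. When
   they share a tail or a head, strictness identifies them; otherwise the two ends of the image
   arrow would coincide. *)
move=> e; have im' := ltnW im.
have [b bE] := chain_edge cF im'; have [c cE] := chain_edge cF im.
have [j jn jE] := adj i im'.
have J b' u v : joins b' (vX u) (vX v) -> (u = j /\ v = j.+1) \/ (u = j.+1 /\ v = j) ->
    joins b' (vX j) (vX j.+1).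
  by move=> h [] [e1 e2]; move: h; rewrite e1 e2 // /joins => -[]; [right|left].
have bc : G.2 b = G.2 c.
  apply: (chain_uniq cX jn).
    by apply: J jE; rewrite -!pE; apply: gj.
  have jE' : (p i.+1 = j /\ p i.+2 = j.+1) \/ (p i.+1 = j.+1 /\ p i.+2 = j).
    by rewrite -e; case: jE => -[]; [right|left].
  by apply: J jE'; rewrite -!pE; apply: gj.
have I u v := @chain_inj _ _ _ cF u v.
have pp : vX (p i) <> vX (p i.+1).
  by move/(chain_inj cX) => h; have := h (idxn _) (idxn _); lia.
have tG : tail (G.2 b) = tail (G.2 c) by rewrite bc.
have st := factoring_strict GP.
have nbc : b <> c.
  move=> ebc; move: cE; rewrite -ebc /joins; case: bE => -[-> ->] [] [].
  - by move/I => h; have := h (ltnW im') im'; lia.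
  - by move/I => h; have := h (ltnW im') im; lia.
  - by move=> _ /I => h; have := h (ltnW im') im; lia.
  - by move=> _ /I => h; have := h (ltnW im') im'; lia.
move: tG; rewrite -!qmor_tail //.
case: bE => -[bt bh]; case: cE => -[ct ch].
- by rewrite bt ct !pE => /pp.
- by move=> _; apply: nbc; apply: (strict_head st bc); rewrite bh ch.
- by move=> _; apply: nbc; apply: (strict_tail st bc); rewrite bt ct.
- by rewrite bt ct !pE -e => /esym/pp.
Qed.

Lemma factoring_inj_vert G : G \in factoring X F -> injective G.1.
Proof.
move=> GP u v; have [p [pE pn pm]] := factoring_positions GP.
have [i li <-] := chain_vert cF u; have [j lj <-] := chain_vert cF v.
rewrite !pE => /(chain_inj cX) e; have {}e := e (pn _) (pn _).
by congr vF; case: pm => h; have := h i li; have := h j lj; lia.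
Qed.

(** Both maps run through the chain, in the same or in opposite directions. Opposite runs cross at a
    middle vertex, where rigidity applies, or interchange the ends of a middle edge. *)
Lemma surjective_factoring_uniq G G' :
  G \in factoring X F -> G' \in factoring X F ->
  (forall x, exists y, G.1 y = x) -> (forall x, exists y, G'.1 y = x) -> G = G'.
Proof.
move=> GP GP' sG sG'.
have bij H : H \in factoring X F -> (forall x, exists y, H.1 y = x) -> n = m.
  move=> HP sH; apply/eqP; rewrite -eqSS -(chain_card_vert cX) -(chain_card_vert cF).
  by apply/eqP/esym/bij_eq_card/(inj_surj_bij (factoring_inj_vert HP)).
have nm := bij _ GP sG.
have [p [pE pn pm]] := factoring_positions GP.
have [p' [pE' pn' pm']] := factoring_positions GP'.
have rig i : (i <= m)%N -> p i = p' i -> G = G'.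
  by move=> li e; apply: (factoring_rigid cF GP GP' li); rewrite pE pE' e.
have key q q' : (forall i, (i <= m)%N -> q i = (q 0 + i)%N) ->
    (forall i, (i <= m)%N -> q' 0%N = (q' i + i)%N) -> (forall i, (q i <= n)%N) ->
    (forall i, (q' i <= n)%N) ->
    (exists2 i, (i <= m)%N & q i = q' i) \/
    (exists2 i, (i < m)%N & q i = q' i.+1 /\ q i.+1 = q' i).
  move=> h h' hn hn'; have := h m (leqnn _); have := h' m (leqnn _).
  have := hn m; have := hn' 0%N => b1 b2 b3 b4.
  have q0 : q 0%N = 0%N by lia.
  have q0' : q' 0%N = m by lia.
  have em := odd_double_half m; case om : (odd m) em => em; [right|left].
    have lm : (m./2 < m)%N by lia.
    exists m./2 => //; have := h m./2 (ltnW lm); have := h m./2.+1 lm.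
    have := h' m./2 (ltnW lm); have := h' m./2.+1 lm; lia.
  have lm : (m./2 <= m)%N by lia.
  by exists m./2 => //; have := h m./2 lm; have := h' m./2 lm; lia.
(* The arrows [G.2 b] and [G'.2 b] join the same adjacent vertices, hence are equal; comparing their
   tails or heads forces [p i.+1 = p i], so the maps agree at [vF i]. *)
have noflip i : (i < m)%N -> p i = p' i.+1 -> p i.+1 = p' i -> G = G'.
  move=> im e1 e2; have [b bE] := chain_edge cF im.
  have [qG qG'] := (factoring_qmor GP, factoring_qmor GP').
  have st := sstrict X.
  have bF := (factoring_arrow b GP, factoring_arrow b GP').
  have [j jn jE] := chain_arrow cX (G.2 b).
  have [j' jn' jE'] := chain_arrow cX (G'.2 b).
  have I u v := @chain_inj _ _ _ cX u v.
  have eb : G.2 b = G'.2 b.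
    apply: (chain_uniq cX jn jE).
    have ej : j = j'; last by rewrite ej.
    have [l1 l2] := (ltnW jn, ltnW jn').
    case: bE jE jE' => -[bt bh] [] [] + + [] [];
    rewrite -!qmor_tail -?qmor_head // bt bh !pE !pE' e1 e2;
    move=> /I h1 /I h2 /I h3 /I h4; have := h1 (pn' _) ; have := h2 (pn' _);
    have := h3 (pn' _); have := h4 (pn' _); lia.
  have bad : p i.+1 = p i.
    apply: (I _ _ (pn _) (pn _)); case: bE => -[bt bh].
      by rewrite {1}e2 -pE -pE' -bt !qmor_tail // eb.
    by rewrite {1}e2 -pE -pE' -bh !qmor_head // eb.
  by apply: (rig i (ltnW im)); lia.
case: pm => h; case: pm' => h'.
- apply: (rig m (leqnn _)); have := h m (leqnn _); have := h' m (leqnn _).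
  have := pn m; have := pn' m; lia.
- by case: (key p p' h h' pn pn') => [[i li e]|[i li [e1 e2]]];
    [apply: rig li e|apply: noflip li e1 e2].
- by case: (key p' p h' h pn' pn) => [[i li e]|[i li [e1 e2]]];
    [apply: rig li (esym e)|apply: noflip li (esym e2) (esym e1)].
- apply: (rig 0%N) => //; have := h m (leqnn _); have := h' m (leqnn _).
  have := pn 0%N; have := pn' 0%N; lia.
Qed.

Lemma surjective_factoring_qiso G : G \in factoring X F ->
  (forall x, exists y, G.1 y = x) -> is_qiso G.
Proof.
move=> GP sG; have Ginj := factoring_inj_vert GP.
have bG := inj_surj_bij Ginj sG.
split=> //; first exact: factoring_qmor GP.
apply: inj_card_bij; first exact: factoring_inj_arrow GP Ginj.
rewrite (chain_card_arrow cX) (chain_card_arrow cF).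
by rewrite -ltnS -(chain_card_vert cX) -(chain_card_vert cF) (bij_eq_card bG).
Qed.
End LinearFactoring.

(** * Surjective factorings and inclusion-exclusion *)

Section SurjectiveCount.
Variable Q : quiver.
Implicit Types X F : shape Q.

Definition surj_factoring X F : {set qmap (sdom F) (sdom X)} :=
  [set G in factoring X F | G.1 @: [set: vert (sdom F)] == [set: vert (sdom X)]].

Lemma surj_factoringP X F G :
  reflect (G \in factoring X F /\ forall x, exists y, G.1 y = x)
    (G \in surj_factoring X F).
Proof.
rewrite [G \in surj_factoring X F]inE; apply: (iffP andP) => -[GP sG]; split=> //.
  move=> x; have : x \in [set: vert (sdom X)] by [].
  by rewrite -(eqP sG) => /imsetP[y _ ->]; exists y.
apply/eqP/setP => x; rewrite !inE; apply/imsetP.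
by have [y <-] := sG x; exists y.
Qed.

Lemma card_surj_factoring X F :
  linear_quiver (sdom X) -> linear_quiver (sdom F) ->
  #|surj_factoring X F| = `[< shape_iso F X >] :> nat.
Proof.
move=> /linear_chain_enum[n [vX cX]] /linear_chain_enum[m [vF cF]].
case: asboolP => [[s [qs [t sK tK] _] sE]|no].
  rewrite (@eq_card1 _ s) // => G; apply/idP/eqP => [/surj_factoringP[GP sG]|->].
    apply: (surjective_factoring_uniq cX cF GP) => // [|x].
      by apply/factoringP.
    by exists (t x).
  apply/surj_factoringP; split; first exact/factoringP.
  by move=> x; exists (t x).
apply: eq_card0 => G; apply/negP => /surj_factoringP[GP sG]; apply: no.
exists G; first exact: (surjective_factoring_qiso cX cF GP sG).
by case/factoringP: GP.
Qed.

Lemma nfact_sub X F (A : {set vert (sdom X)}) :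
  nfact (sub_shape A) F =
  #|[set G in factoring X F | G.1 @: [set: vert (sdom F)] \subset A]|.
Proof.
pose f (G : qmap (sdom F) (sub_quiver A)) := qcomp (sub_incl A) G.
have fI : injective f.
  move=> [G1 G2] [H1 H2] [/ffunP e1 /ffunP e2]; congr (_, _); apply/ffunP => x.
    by have := e1 x; rewrite !ffunE /=; apply: val_inj.
  by have := e2 x; rewrite !ffunE /=; apply: val_inj.
rewrite /nfact -(card_imset _ fI); apply: eq_card => G.
rewrite [RHS]inE; apply/imsetP/andP => [[H HP ->]|[GP /subsetP GA]].
  split; first exact: factoring_comp (sub_inclP A) HP.
  apply/subsetP => x /imsetP[y _ ->]; rewrite !ffunE; exact: (valP (H.1 y)).
have qG := factoring_qmor GP.
have vA z : G.1 z \in A by apply: GA; apply: imset_f.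
have aA b : (tail (G.2 b) \in A) && (head (G.2 b) \in A).
  by rewrite -qmor_tail // -qmor_head // !vA.
pose H : qmap (sdom F) (sub_quiver A) :=
  ([ffun z => exist _ (G.1 z) (vA z)], [ffun b => exist _ (G.2 b) (aA b)]).
exists H.
  apply: factoringI => [|z|b]; rewrite ?ffunE /= ?ffunE /=.
  - by apply: is_qmorI => b; rewrite !ffunE; apply: val_inj;
      rewrite /= -?qmor_tail -?qmor_head.
  - exact: factoring_vert GP.
  - exact: factoring_arrow GP.
rewrite [LHS]surjective_pairing; congr (_, _); apply/ffunP => x; by rewrite !ffunE.
Qed.

(** Expand the product over [i] of 1 plus a term that is 0 on [B] and -1 off [B]. Sets not
    containing [B] contribute 0, and any [i] outside [B] makes a factor vanish. *)
Lemma signed_supersets (T : finType) (B : {set T}) :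
  \sum_(A : {set T} | B \subset A) (-1) ^+ #|~: A| = (B == [set: T])%:R :> int.
Proof.
transitivity (\prod_(i : T) (1 + (if i \in B then 0 else -1)) : int); last first.
  have [->|/eqP nB] := eqVneq B setT.
    by apply: big1 => i _; rewrite inE addr0.
  have [i iB] : exists i, i \notin B.
    apply: contrapT => /forallNP h; apply: nB; apply/setP => i; rewrite inE.
    by apply: contraT => hi; case: (h i).
  by rewrite (bigD1 i) //= (negPf iB) subrr mul0r.
rewrite bigA_distr big_mkcond /=; apply: eq_bigr => A _.
case: ifP => [/subsetP BA|/negbT/subsetPn[i iB iA]].
  rewrite (bigID (mem A)) /= big1 ?mul1r => [|i ->//].
  rewrite (eq_bigr (fun _ => -1)) => [|i iA]; last first.
    by rewrite (negPf iA) ifN //; apply: contra iA; apply: BA.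
  by rewrite prodr_const; congr (_ ^+ _); apply: eq_card => i; rewrite !inE.
by rewrite (bigD1 i) //= (negPf iA) iB mul0r.
Qed.
End SurjectiveCount.

(** * The basis of idempotents *)

Lemma shape_iso_refl (Q : quiver) (F : shape Q) : shape_iso F F.
Proof.
exists (qidmap (sdom F)).
  split; first by apply: is_qmorI => a; rewrite !ffunE.
    by exists id => x; rewrite ffunE.
  by exists id => x; rewrite ffunE.
rewrite [LHS]surjective_pairing; congr (_, _); apply/ffunP => x; by rewrite !ffunE.
Qed.

Section Basis.
Variables (k : fieldType) (L : string_category k).
Implicit Types F : linear_shape L.
Notation span := (@string_span k L).

Lemma rcls_string_iso F F' : shape_iso F F' -> rcls (string F) = rcls (string F').
Proof.
case=> s [qs bs1 bs2] sE; have sP : s \in factoring F' F by apply/factoringP.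
(* An isomorphism is treated as a splitting whose second piece is empty. *)
have := @lpush_split k L F' F (csub set0) s (sub_incl set0) 1
  (fun _ => 1%:M) sP (sub_inclP _) (bij_inj bs1) (@sub_incl_inj _ _ _).
rewrite (@lpush_empty _ _ (csub set0)) ?addr0.
  move=> H; apply/esym; apply: H => [x y|x|a].
  - by have := valP y; rewrite inE.
  - by case: bs1 => t _ tK; left; exists (t x).
  - by case: bs2 => t _ tK; left; exists (t a).
by apply: eq_card0 => -[x hx]; have := hx; rewrite inE.
Qed.

Definition push1 (X : cshape L) : repring L :=
  rcls (lpush (fun _ : arrow (sdom X) => 1%:M : 'M[k]_1)).

(** The list of chains is independent of the module, so both sides expand over the same strings. *)
Lemma lpush_acyclic (X : cshape L) (o : arrow (sdom X) -> bool) s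
    (A : arrow (sdom X) -> 'M[k]_s) :
  chainlike o -> acyclic o -> (forall a, A a \in unitmx) ->
  rcls (lpush A) = push1 X *+ s.
Proof.
move=> cho ac uA; have [S _ dec] := chain_decomposition cho ac.
rewrite dec // /push1 dec => [|a]; last exact: unitmx1.
by rewrite -sumrMnl; apply: eq_bigr => F _; rewrite mulr1n.
Qed.

(** The idempotent of [F]. All vertex subsets occur, not only intervals, so that the signs form
    plain inclusion-exclusion; the disconnected subshapes still push down to sums of strings. *)
Definition shape_mobius F : repring L :=
  \sum_(A : {set vert (sdom F)}) push1 (csub A) *~ (-1) ^+ #|~: A|.

Lemma csub_span F (A : {set vert (sdom F)}) : exists2 S : seq (linear_shape L),
  (forall F', List.In F' S -> #|vert (sdom F')| <= #|A|)%N &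
  push1 (csub A) = \sum_(F' <- S) rcls (string F').
Proof.
have [o cho ac] := linear_orientation (linear_shapeP F).
have st := factoring_strict (sub_inclP A).
have [S sz dec] := @chain_decomposition _ _ (csub A) _ (chainlike_map st cho)
  (acyclic_map (strict_wrapping_qmor st) ac).
exists S; last first.
  rewrite /push1 dec => [|a]; last exact: unitmx1.
  by apply: eq_bigr => F' _; rewrite mulr1n.
move=> F' /sz h; apply: leq_trans h _; rewrite card_sig.
by apply: eq_leq; apply: eq_card.
Qed.

Lemma shape_mobius_span F : span (shape_mobius F).
Proof.
apply: span_sum => A _; apply: spanMz; have [S _ ->] := csub_span A.
by apply: span_sum => F' _; apply: span_string.
Qed.

Lemma phi_shape_mobius F F' : phi F' (shape_mobius F) = `[< shape_iso F' F >]%:Z.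
Proof.
rewrite raddf_sum /= -(card_surj_factoring (linear_shapeP F) (linear_shapeP F')).
transitivity (\sum_(A : {set vert (sdom F)}) \sum_(G in factoring F F' |
    G.1 @: [set: vert (sdom F')] \subset A) ((-1) ^+ #|~: A| : int)).
  apply: eq_bigr => A _; rewrite raddfMz /= phi_push nfact_sub.
  rewrite -(eq_bigl _ _ (fun G => in_set _ G)) sumr_const.
  by rewrite -mulrzr intz -mulr_natl natz.
(* After the exchange each factoring carries the signed sum over the supersets of its image, which
   is 1 for a surjective one and 0 otherwise. *)
rewrite (exchange_big_dep (fun G => G \in factoring F F')) /=; last first.
  by move=> A G _ /andP[].
rewrite (eq_bigr (fun G : qmap (sdom F') (sdom F) =>
    (G.1 @: [set: vert (sdom F')] == setT)%:R)) => [|G GP]; last first.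
  by rewrite -signed_supersets; apply: eq_bigl => A; rewrite GP.
rewrite -natr_sum natz; congr Posz; rewrite -sum1_card big_mkcond [RHS]big_mkcond /=.
apply: eq_bigr => G _; rewrite [G \in surj_factoring F F']inE.
by case: (G \in factoring F F') => //=; case: (_ == _).
Qed.

(** [kap] picks the same representative index for isomorphic members; coefficients are collected
    along its fibres. *)
Lemma noniso_reindex n (F : 'I_n -> linear_shape L) :
  exists N (f : 'I_N -> 'I_n), noniso (F \o f) /\
    forall g : linear_shape L -> repring L, class_function g ->
    forall c : 'I_n -> int, exists d : 'I_N -> int,
      \sum_i g (F i) *~ c i = \sum_j g (F (f j)) *~ d j.
Proof.
pose kap i := odflt i [pick j | `[< shape_iso (F i) (F j) >]].
have kapP i : shape_iso (F i) (F (kap i)).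
  rewrite /kap; case: pickP => [j /asboolP //|/(_ i)].
  by rewrite asboolT //; apply: shape_iso_refl.
have kapE i j : shape_iso (F i) (F j) -> kap i = kap j.
  move=> ij; rewrite /kap (eq_pick (Q := fun l => `[< shape_iso (F j) (F l) >])).
    case: pickP => [//|/(_ j)]; rewrite asboolT //; exact: shape_iso_refl.
  move=> l; apply/asboolP/asboolP; last exact: shape_iso_trans.
  exact/shape_iso_trans/shape_iso_sym.
pose K := [set kap i | i : 'I_n].
exists #|K|, enum_val; split.
  move=> i j /= /kapE e; apply: enum_val_inj.
  have fixK (l : 'I_#|K|) : kap (enum_val l) = enum_val l.
    have /imsetP[l' _ ->] := enum_valP l; exact/kapE/shape_iso_sym/kapP.
  by rewrite -(fixK i) -(fixK j).
move=> g cg c; exists (fun j => \sum_(i | kap i == enum_val j) c i).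
rewrite (partition_big kap (mem K)) /= => [|i _]; last exact: imset_f.
rewrite big_enum_val; apply: eq_bigr => j _.
rewrite mulrz_sumr; apply: eq_bigr => i /eqP <-.
by rewrite (cg _ _ (kapP i)).
Qed.

Lemma string_class : class_function (fun F => rcls (string F)).
Proof. by move=> F F'; apply: rcls_string_iso. Qed.

Lemma nfact_size F F' : nfact F F' != 0%N ->
  (#|vert (sdom F')| <= #|vert (sdom F)|)%N.
Proof.
rewrite -lt0n => /card_gt0P[G GP].
have [n [vX cX]] := linear_chain_enum (linear_shapeP F).
have [m [vF cF]] := linear_chain_enum (linear_shapeP F').
exact: leq_card (factoring_inj_vert cX cF GP).
Qed.

Lemma nfact_same_size F F' : nfact F F' != 0%N ->
  #|vert (sdom F')| = #|vert (sdom F)| -> nfact F F' = 1%N /\ shape_iso F' F.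
Proof.
move=> FF' sz; have [n [vX cX]] := linear_chain_enum (linear_shapeP F).
have [m [vF cF]] := linear_chain_enum (linear_shapeP F').
have E : surj_factoring F F' = factoring F F'.
  apply/setP => G; apply/surj_factoringP/idP => [[]//|GP]; split=> // x.
  have [H GK HK] : bijective G.1.
    apply: inj_card_bij; first exact: (factoring_inj_vert cX cF GP).
    by rewrite sz.
  by exists (H x).
have := card_surj_factoring (linear_shapeP F) (linear_shapeP F').
rewrite E -/(nfact F F') => e; move: FF'; rewrite e.
by case: asboolP.
Qed.

Lemma span_phi_inj r : span r -> (forall F, phi F r = 0) -> r = 0.
Proof.
case=> n [F [c ->]] phi0.
have [N [f [nF cF]]] := noniso_reindex F.
have {cF} [d e] := cF _ string_class c; rewrite /= in e.
rewrite e; apply: big1 => j _; suff -> : d j = 0 by rewrite mulr0z.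
apply/eqP; apply: contraT => dj.
(* Unitriangularity: a factoring from [F (f i)] to another member with nonzero coefficient needs at
   least as many vertices there, so by maximality an isomorphism, which [nF] excludes. *)
have [i di imax] := @arg_maxnP _ j (fun j => d j != 0)
  (fun j => #|vert (sdom (F (f j)))|) dj.
have := phi0 (F (f i)); rewrite e raddf_sum (bigD1 i) //= raddfMz /= phi_string.
have -> : nfact (F (f i)) (F (f i)) = 1%N.
  suff h : nfact (F (f i)) (F (f i)) != 0%N.
    by case: (nfact_same_size h (erefl _)).
  rewrite -lt0n; apply/card_gt0P; exists (qidmap (sdom (F (f i)))).
  apply/factoringP; split; first by apply: is_qmorI => a; rewrite !ffunE.
  rewrite [LHS]surjective_pairing; congr (_, _); apply/ffunP => x.
    by rewrite !ffunE.
  by rewrite !ffunE.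
rewrite big1 ?addr0 => [/eqP|l li].
  by rewrite -mulrzr mul1r intz (negPf di).
rewrite raddfMz /= phi_string.
have [->|dl] := eqVneq (d l) 0; first by rewrite mulr0z.
have [->|nz] := eqVneq (nfact (F (f l)) (F (f i))) 0%N; first by rewrite mul0rz.
have sz : #|vert (sdom (F (f i)))| = #|vert (sdom (F (f l)))|.
  by apply/eqP; rewrite eqn_leq nfact_size //; apply: imax.
have [_ /nF il] := nfact_same_size nz sz.
by rewrite il eqxx in li.
Qed.

Lemma span_phi_eq r r' : span r -> span r' ->
  (forall F, phi F r = phi F r') -> r = r'.
Proof.
move=> sr sr' e; apply/eqP; rewrite -subr_eq0; apply/eqP/span_phi_inj.
  exact: spanB.
by move=> F; rewrite raddfB /= e subrr.
Qed.

Lemma shape_mobius_class : class_function shape_mobius.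
Proof.
move=> F F' FF'; apply: span_phi_eq; try exact: shape_mobius_span.
move=> F1; rewrite !phi_shape_mobius; congr (nat_of_bool _)%:Z.
apply/asboolP/asboolP => h; first exact: shape_iso_trans FF'.
exact/(shape_iso_trans h)/shape_iso_sym.
Qed.

(** The term of the full vertex set in [shape_mobius F] is the string of [F]; all others are sums of
    strings with fewer vertices, so induction inverts the definition. *)
Lemma shape_mobius_spans r : span r -> lspan shape_mobius r.
Proof.
have strings N F : (#|vert (sdom F)| < N)%N -> lspan shape_mobius (rcls (string F)).
  elim: N F => // N IH F FN.
  have pT : push1 (csub [set: vert (sdom F)]) = rcls (string F).
    have hT a : (tail a \in [set: vert (sdom F)]) = (head a \in [set: vert (sdom F)]).
      by rewrite !inE.
    have := lpush_closed (fun _ : arrow (sdom F) => 1%:M : 'M[k]_1) hT.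
    rewrite [X in _ + X](@lpush_empty _ _ (csub (~: setT))) ?addr0 => [//|].
    by apply: eq_card0 => -[x hx]; have := hx; rewrite !inE.
  have -> : rcls (string F) = shape_mobius F -
      \sum_(A | A != [set: vert (sdom F)]) push1 (csub A) *~ (-1) ^+ #|~: A|.
    rewrite /shape_mobius (bigD1 [set: vert (sdom F)]) //= addrK pT.
    by rewrite setCT cards0 expr0 mulr1z.
  apply: lspanB; first exact: lspan_gen.
  apply: lspan_sum => A nA; apply: lspanMz; have [S sz ->] := csub_span A.
  have lA : (#|A| < N)%N.
    apply: leq_trans (ltnSE FN); rewrite -cardsT; apply: proper_card.
    by rewrite properEneq nA subsetT.
  elim: S sz => [|F1 S IHS] sz; first by rewrite big_nil; apply: lspan0.
  rewrite big_cons; apply: lspanD.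
    by apply: IH; apply: leq_ltn_trans lA; apply: sz; left.
  by apply: IHS => F' F'S; apply: sz; right.
case=> n [F [c ->]]; apply: lspan_sum => i _; apply: lspanMz.
exact: strings (leqnn _).
Qed.

Lemma span_expansion r : span r -> exists n (F : 'I_n -> linear_shape L),
  [/\ noniso F, forall i, phi (F i) r != 0,
      forall F', phi F' r != 0 -> exists i, shape_iso F' (F i) &
      r = \sum_i shape_mobius (F i) *~ phi (F i) r].
Proof.
move=> sr; have [n [F0 [c rE]]] := shape_mobius_spans sr.
have [N [f [nF cF]]] := noniso_reindex F0.
have {cF} [d e] := cF _ shape_mobius_class c; rewrite -rE in e.
pose F := F0 \o f; rewrite -/F in nF.
have phiE F' : phi F' r = \sum_j `[< shape_iso F' (F j) >]%:Z *~ d j.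
  by rewrite e raddf_sum; apply: eq_bigr => j _; rewrite raddfMz /= phi_shape_mobius.
have phid i : phi (F i) r = d i.
  rewrite phiE (bigD1 i) //= asboolT; last exact: shape_iso_refl.
  rewrite big1 ?addr0 => [|j ne]; first by rewrite -mulrzr mul1r intz.
  by case: asboolP => [/nF ij|_]; [rewrite ij eqxx in ne|rewrite mul0rz].
pose K := [set i | d i != 0].
exists #|K|, (fun i => F (enum_val i)); split.
- by move=> i j /nF /enum_val_inj.
- by move=> i; rewrite phid; have := enum_valP i; rewrite inE.
- move=> F' F'r; have [i dF'] : exists i, `[< shape_iso F' (F i) >] && (d i != 0).
    apply: contrapT => /forallNP no; case/eqP: F'r; rewrite phiE big1 // => i _.
    have := no i; case: asboolP => /= [_ /negP|]; last by rewrite mul0rz.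
    by rewrite negbK => /eqP ->; rewrite mulr0z.
  case/andP: dF' => /asboolP iso di; have iK : i \in K by rewrite inE.
  by exists (enum_rank_in iK i); rewrite enum_rankK_in.
- rewrite {1}e (bigID (mem K)) /= [X in _ + X]big1 ?addr0 => [|i].
    by rewrite big_enum_val; apply: eq_bigr => i _; rewrite phid.
  by rewrite inE negbK => /eqP ->; rewrite mulr0z.
Qed.

(** Turns each infinite-looking expansion in the theorem into membership in the span and a
    computation of [phi]. *)
Lemma class_sum_span (D : linear_shape L -> Prop) (N : linear_shape L -> nat) r :
  span r -> (forall F, phi F r = (N F)%:Z) -> (forall F, N F != 0%N -> D F) ->
  class_sum D (fun F => shape_mobius F *+ N F) r.
Proof.
move=> sr phiN ND; have [n [F [nF phiF supp e]]] := span_expansion sr.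
exists n, F; split=> //.
- by move=> i; apply: ND; have := phiF i; rewrite phiN.
- move=> F' _ nz; apply: supp; rewrite phiN.
  by apply: contra_notN nz => /eqP[->]; rewrite mulr0n.
- by rewrite {1}e; apply: eq_bigr => i _; rewrite phiN.
Qed.

Lemma tens_unit s t (A : 'M[k]_s) (B : 'M[k]_t) :
  A \in unitmx -> B \in unitmx -> A *t B \in unitmx.
Proof.
move=> uA uB; have e : (A *t B) *m (invmx A *t invmx B) = 1%:M.
  by rewrite tensmx_mul !mulmxV // tens11.
by case: (mulmx1_unit e).
Qed.

(** The fibre product takes its traversal from [F] through the second projection, so it is acyclic
    even when [X] has cycles. *)
Lemma lpush_mul_string (X : cshape L) s (A : arrow (sdom X) -> 'M[k]_s) F :
  (forall a, A a \in unitmx) ->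
  span (rmul (rcls (lpush A)) (rcls (string F))) /\ forall F',
  phi F' (rmul (rcls (lpush A)) (rcls (string F))) = (s * nfact X F')%:Z * phi F' (rcls (string F)).
Proof.
move=> uA.
have -> : rmul (rcls (lpush A)) (rcls (string F)) =
    rcls (@lpush _ _ (cprod X F) _ (fun a => A (val a).1 *t (1%:M : 'M[k]_1))).
  apply: rcls_tens.
  exact: (push_prod A (fun _ : arrow (sdom F) => 1%:M : 'M[k]_1)).
have [o cho ac] := linear_orientation (linear_shapeP F).
have st := factoring_strict (fp_sndP X F).
have cho' := chainlike_map st cho.
have ac' := acyclic_map (strict_wrapping_qmor st) ac.
have uA' (a : arrow (fp_quiver X F)) : A (val a).1 *t (1%:M : 'M[k]_1) \in unitmx.
  by apply: tens_unit; rewrite ?unitmx1.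
split; first exact: (@cpush_span _ _ (cprod X F) _ _ _ cho' ac').
move=> F'; rewrite (@lpush_acyclic (cprod X F) _ _ _ cho' ac') // raddfMn /=.
rewrite phi_push nfact_prod; last exact: linear_shapeP.
rewrite phi_string -mulr_natr natz -!PoszM; congr Posz; lia.
Qed.
End Basis.

(** * Walks in cyclic shapes *)

Section CyclicOrientation.
Variable P : quiver.

Record cyclic_orient (o : arrow P -> bool) : Prop := CyclicOrient {
  cyclic_chainlike : chainlike o;
  cyclic_src_surj : forall x, exists a, osrc o a = x;
  cyclic_connected : forall B : {set vert P}, B != set0 ->
    (forall a, osrc o a \in B -> otgt o a \in B) -> B = setT
}.

Lemma osrc_neg (o : arrow P -> bool) : osrc (fun a => ~~ o a) = otgt o.
Proof. by apply/funext => a; rewrite /osrc /otgt; case: (o a). Qed.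

Lemma otgt_neg (o : arrow P -> bool) : otgt (fun a => ~~ o a) = osrc o.
Proof. by apply/funext => a; rewrite /osrc /otgt; case: (o a). Qed.

(** A cycle can be run through in two directions; prescribing the value at [a0] lets the traversals
    of two cycles be matched on a first edge. *)
Lemma cyclic_orientation (a0 : arrow P) (b : bool) : cyclic_quiver P ->
  exists2 o, cyclic_orient o & o a0 = b.
Proof.
case=> n [v [a [[v' vK v'K] [a' aK a'K] va]]].
pose o e := tail e == v (a' e).
have se i : osrc o (a i) = v i.
  rewrite /osrc /o aK; case: eqP => // ne.
  by case: (va i) => -[t h] //; rewrite t in ne.
have te i : otgt o (a i) = v (ordS i).
  rewrite /otgt /o aK; case: eqP => ne.
    by case: (va i) => -[t h] //; rewrite h -ne t.
  by case: (va i) => -[t h] //; rewrite t in ne.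
have iterS m (i : 'I_n.+1) : val (iter m (@ordS _) i) = ((i + m) %% n.+1)%N.
  elim: m => [|m IH]; first by rewrite addn0 modn_small.
  by rewrite iterS /= IH -addn1 modnDml addn1 addnS.
have inj_s : injective (osrc o).
  move=> x y; rewrite -(a'K x) -(a'K y) !se => /(can_inj vK) -> //.
have inj_t : injective (otgt o).
  by move=> x y; rewrite -(a'K x) -(a'K y) !te => /(can_inj vK)/ordS_inj ->.
have conn (B : {set vert P}) : B != set0 ->
    (forall a, osrc o a \in B -> otgt o a \in B) -> B = setT.
  case/set0Pn=> x xB hB; apply/setP => y; rewrite inE -(v'K y).
  have iterB m : v (iter m (@ordS _) (v' x)) \in B.
    elim: m => [|m IH] /=; first by rewrite v'K.
    by rewrite -te; apply: hB; rewrite se.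
  (* The forward distance from [x] to [y] up to a full turn; adding [n.+1] keeps the natural
     subtraction exact. *)
  suff -> : v' y = iter (n.+1 - v' x + v' y) (@ordS _) (v' x) by apply: iterB.
  apply: val_inj; rewrite iterS addnA subnKC ?modnDl ?modn_small //.
  exact: ltnW.
have co : cyclic_orient o.
  by split=> // x; exists (a (v' x)); rewrite se v'K.
have [e|ne] := eqVneq (o a0) b; first by exists o.
exists (fun a => ~~ o a); last by move: ne; case: (o a0); case: b.
split; rewrite /chainlike ?osrc_neg ?otgt_neg //.
- move=> x; exists (a (ord_pred (v' x))); by rewrite te ord_predK v'K.
(* A set closed under the reversed traversal has a complement closed under the original one. *)
- move=> B /set0Pn[x xB] hB; apply/setP => y; rewrite inE.
  apply: contraT => yB; have : x \in ~: B; last by rewrite inE xB.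
  rewrite (conn (~: B)) ?inE //; first by apply/set0Pn; exists y; rewrite inE.
  by move=> e; rewrite !inE; apply: contra; apply: hB.
Qed.
End CyclicOrientation.

Section Walks.
Variables (Q : quiver).

Section Transfer.
Variables (G1 G2 : shape Q) (o1 : arrow (sdom G1) -> bool)
  (o2 : arrow (sdom G2) -> bool) (e1 : nat -> arrow (sdom G1))
  (e2 : nat -> arrow (sdom G2)).
Hypotheses (c1 : cyclic_orient o1) (c2 : cyclic_orient o2).
Hypothesis w1 : forall i, osrc o1 (e1 i.+1) = otgt o1 (e1 i).
Hypothesis w2 : forall i, osrc o2 (e2 i.+1) = otgt o2 (e2 i).
Hypothesis e12 : forall i, (smap G1).2 (e1 i) = (smap G2).2 (e2 i).
Hypothesis o12 : forall i, o1 (e1 i) = o2 (e2 i).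

Lemma walk_surj i (a : arrow (sdom G2)) : exists t, e2 (t + i)%N = a.
Proof.
have [[si _] _ conn] := c2.
pose B := [set x | `[< exists t, osrc o2 (e2 (t + i)%N) = x >]].
have : osrc o2 a \in B.
  rewrite (conn B) ?inE //.
    by apply/set0Pn; exists (osrc o2 (e2 i)); rewrite inE; apply/asboolP; exists 0%N.
  move=> b; rewrite !inE => /asboolP[t /si <-]; apply/asboolP; exists t.+1.
  by rewrite addSn w2.
by rewrite inE => /asboolP[t /si e]; exists t.
Qed.

(* If the first walk closes up after k steps then k is a period of the labels of
   the second walk, so rotating it by k steps is an automorphism of G2. *)
Lemma walk_transfer : trivial_aut G2 -> forall i j, e1 i = e1 j -> e2 i = e2 j.
Proof.
move=> aut i j; wlog ij : i j / (i <= j)%N.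
  move=> W; case: (leqP i j) => [/W //|/ltnW/W h /esym/h ->//].
have [[si1 ti1] _ _] := c1; have [[si2 ti2] src2 _] := c2.
move=> eij; pose m := (j - i)%N.
have per t : e1 (t + i)%N = e1 (t + j)%N.
  elim: t => // t IH; apply: si1; rewrite !addSn !w1; by rewrite IH.
(* [E z] is the edge leaving [z]; [S] and [N] below rotate vertices and arrows by one step. *)
pose E z := projT1 (cid (src2 z)).
have EK z : osrc o2 (E z) = z by rewrite /E; case: cid.
have KE a : E (osrc o2 a) = a by apply: si2; rewrite EK.
pose S z := otgt o2 (E z); pose N a := E (otgt o2 a).
have sN a : osrc o2 (N a) = S (osrc o2 a) by rewrite EK /S KE.
have tN a : otgt o2 (N a) = S (otgt o2 a) by [].
have SI : injective S by move=> x y /ti2 e; rewrite -(EK x) e EK.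
have NI : injective N.
  by move=> x y e; apply: ti2; rewrite -[LHS]EK -[RHS]EK; congr (osrc o2 _).
have iI (T : Type) (f : T -> T) l : injective f -> injective (iter l f).
  by move=> fI; elim: l => [|l IH] x y //= /fI/IH.
have sNm l a : osrc o2 (iter l N a) = iter l S (osrc o2 a).
  by elim: l => //= l IH; rewrite sN IH.
have tNm l a : otgt o2 (iter l N a) = iter l S (otgt o2 a).
  by elim: l => //= l IH; rewrite tN IH.
have e2N l t : e2 (l + t)%N = iter l N (e2 t).
  by elim: l => //= l IH; apply: si2; rewrite addSn w2 IH EK.
have NmE t : iter m N (e2 (t + i)%N) = e2 (t + j)%N.
  by rewrite -e2N; congr e2; rewrite /m; lia.
(* From index [i] on the first walk has period [m], and the second one still meets every arrow
   there, so rotation by [m] steps preserves labels. *)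
have GN a : (smap G2).2 (iter m N a) = (smap G2).2 a.
  by have [t <-] := walk_surj i a; rewrite NmE -!e12 per.
have oN a : o2 (iter m N a) = o2 a.
  by have [t <-] := walk_surj i a; rewrite NmE -!o12 per.
have tailN a : tail (iter m N a) = iter m S (tail a).
  have := sNm m a; have := tNm m a; rewrite /osrc /otgt oN; by case: ifP.
have headN a : head (iter m N a) = iter m S (head a).
  have := sNm m a; have := tNm m a; rewrite /osrc /otgt oN; by case: ifP.
pose s : qmap (sdom G2) (sdom G2) := ([ffun z => iter m S z], [ffun a => iter m N a]).
have sid : s = qidmap (sdom G2).
  apply: aut.
    split=> /=; first by apply: is_qmorI => a; rewrite !ffunE.
      by apply/injF_bij => x y; rewrite !ffunE; apply: iI.
    by apply/injF_bij => x y; rewrite !ffunE; apply: iI.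
  rewrite [LHS]surjective_pairing; congr (_, _); apply/ffunP => x; rewrite !ffunE //.
  have [a <-] := src2 x; have q2 := smor G2; rewrite /osrc; case: ifP => _.
    by rewrite -tailN !qmor_tail // GN.
  by rewrite -headN !qmor_head // GN.
have /ffunP/(_ (e2 i)) := congr1 snd sid; rewrite !ffunE => <-.
by have := NmE 0%N; rewrite !add0n.
Qed.
End Transfer.

(** Transfer in both directions shows that the two walks repeat at the same times, so sending the
    [i]-th edge of one to that of the other is a well-defined bijection. *)
Lemma walk_shape_iso (G1 G2 : shape Q) (o1 : arrow (sdom G1) -> bool)
    (o2 : arrow (sdom G2) -> bool) (e1 : nat -> arrow (sdom G1))
    (e2 : nat -> arrow (sdom G2)) :
  cyclic_orient o1 -> cyclic_orient o2 ->
  (forall i, osrc o1 (e1 i.+1) = otgt o1 (e1 i)) ->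
  (forall i, osrc o2 (e2 i.+1) = otgt o2 (e2 i)) ->
  (forall i, (smap G1).2 (e1 i) = (smap G2).2 (e2 i)) ->
  (forall i, o1 (e1 i) = o2 (e2 i)) ->
  trivial_aut G1 -> trivial_aut G2 ->
  exists2 s : qmap (sdom G1) (sdom G2),
    is_qiso s /\ smap G1 = qcomp (smap G2) s & forall i, s.2 (e1 i) = e2 i.
Proof.
move=> c1 c2 w1 w2 e12 o12 aut1 aut2.
have tr := walk_transfer c1 c2 w1 w2 e12 o12 aut2.
have tr' := walk_transfer c2 c1 w2 w1 (fun i => esym (e12 i)) (fun i => esym (o12 i)) aut1.
have [[si1 ti1] src1 _] := c1; have [[si2 ti2] src2 _] := c2.
have ex1 a : exists i, e1 i = a.
  by have [t h] := walk_surj c1 w1 0%N a; exists (t + 0)%N.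
have ex2 a : exists i, e2 i = a.
  by have [t h] := walk_surj c2 w2 0%N a; exists (t + 0)%N.
pose idx a := projT1 (cid (ex1 a)).
have idxK a : e1 (idx a) = a by rewrite /idx; case: cid.
pose E z := projT1 (cid (src1 z)).
have EK z : osrc o1 (E z) = z by rewrite /E; case: cid.
have KE a : E (osrc o1 a) = a by apply: si1; rewrite EK.
pose s : qmap (sdom G1) (sdom G2) :=
  ([ffun z => osrc o2 (e2 (idx (E z)))], [ffun a => e2 (idx a)]).
have sE i : s.2 (e1 i) = e2 i by rewrite ffunE; apply: tr.
have sS i : s.1 (osrc o1 (e1 i)) = osrc o2 (e2 i).
  by rewrite ffunE KE; congr (osrc o2 _); apply: tr.
have sT i : s.1 (otgt o1 (e1 i)) = otgt o2 (e2 i) by rewrite -w1 sS w2.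
have qs : is_qmor s.
  apply: is_qmorI => a; have [i <-] := ex1 a; rewrite sE.
    have := sS i; have := sT i; rewrite /osrc /otgt o12; by case: ifP.
  have := sS i; have := sT i; rewrite /osrc /otgt o12; by case: ifP.
exists s => //; split; first split=> //.
- apply: inj_surj_bij => [x y|y].
    have [a <-] := src1 x; have [b <-] := src1 y.
    have [i <-] := ex1 a; have [j <-] := ex1 b; rewrite !sS => /si2 /tr' ->//.
  by have [b <-] := src2 y; have [i <-] := ex2 b; exists (osrc o1 (e1 i)).
- apply: inj_surj_bij => [a b|b].
    by have [i <-] := ex1 a; have [j <-] := ex1 b; rewrite !sE => /tr' ->.
  by have [i <-] := ex2 b; exists (e1 i).
have sA a : (smap G2).2 (s.2 a) = (smap G1).2 a.
  by have [i <-] := ex1 a; rewrite sE e12.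
rewrite [LHS]surjective_pairing; congr (_, _); apply/ffunP => x; rewrite [RHS]ffunE //.
have [a <-] := src1 x; have [q1 q2] := (smor G1, smor G2); rewrite /osrc.
by case: ifP => _; rewrite ?(qmor_tail _ qs) ?(qmor_head _ qs) ?qmor_tail ?qmor_head // sA.
Qed.

Section CyclicProduct.
Variables (G1 G2 : shape Q) (o1 : arrow (sdom G1) -> bool).
Hypotheses (c1 : cyclic_orient o1) (cyc2 : cyclic_quiver (sdom G2)).
Hypotheses (aut1 : trivial_aut G1) (aut2 : trivial_aut G2).

Let X := fp_shape G1 G2.
Let o (a : arrow (sdom X)) : bool := o1 ((fp_fst G1 G2).2 a).

(** Successors inside [A] give an infinite walk in the fibre product, whose projections have equal
    labels. The point of [A] on the graph of [s] is what places the cycle on the diagonal when [s]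
    is the identity. *)
Lemma cyclic_product_walk (A : {set vert (sdom X)}) : A != set0 ->
  (forall x, x \in A -> exists2 a, osrc o a = x & otgt o a \in A) ->
  exists2 s : qmap (sdom G1) (sdom G2), is_qiso s /\ smap G1 = qcomp (smap G2) s &
    exists2 x, x \in A & s.1 (val x).1 = (val x).2.
Proof.
case/set0Pn=> x0 x0A hA; have [e0 e0x e0A] := hA _ x0A.
pose nx (a : arrow (sdom X)) : arrow (sdom X) :=
  if [pick b | (osrc o b == otgt o a) && (otgt o b \in A)] is Some b then b else a.
pose eps i := iter i nx e0.
have nxP a : otgt o a \in A -> osrc o (nx a) = otgt o a /\ otgt o (nx a) \in A.
  move=> /hA[b bs bt]; rewrite /nx; case: pickP => [c /andP[/eqP ? ?] //|/(_ b)].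
  by rewrite bs bt eqxx.
have epsA i : otgt o (eps i) \in A.
  by elim: i => //= i /nxP[].
have wX i : osrc o (eps i.+1) = otgt o (eps i) by case: (nxP _ (epsA i)).
have qf : is_qmor (fp_fst G1 G2) := factoring_qmor (fp_fstP G1 G2).
have q2 : is_qmor (fp_snd G1 G2) := factoring_qmor (fp_sndP G1 G2).
pose e1 i := (val (eps i)).1; pose e2 i := (val (eps i)).2.
have w1 i : osrc o1 (e1 i.+1) = otgt o1 (e1 i).
  have := congr1 (fp_fst G1 G2).1 (wX i); rewrite osrc_map // otgt_map //.
  by rewrite [in LHS]ffunE [in RHS]ffunE.
have [o2 c2 o20] := cyclic_orientation (e2 0%N) (o1 (e1 0%N)) cyc2.
have e12 i : (smap G1).2 (e1 i) = (smap G2).2 (e2 i) by apply/eqP/(valP (eps i)).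
have oE i : o (eps i) = o1 (e1 i) by rewrite /o ffunE.
have tgt2 i : (val (otgt o (eps i))).2 = if o1 (e1 i) then head (e2 i) else tail (e2 i).
  by rewrite /otgt oE; case: ifP.
have src2 i : (val (osrc o (eps i))).2 = if o1 (e1 i) then tail (e2 i) else head (e2 i).
  by rewrite /osrc oE; case: ifP.
have [[si2 ti2] _ _] := c2.
(* If the directions first disagreed at [i.+1], the second walk would turn back on one edge. The
   first walk would then meet two equally labelled edges with a common head or tail; strictness
   makes them equal, against [ob]. *)
have o12 i : o1 (e1 i) = o2 (e2 i).
  elim: i => // i IH; apply/eqP; apply: contraT => ne.
  have eo : o2 (e2 i.+1) = ~~ o1 (e1 i.+1).
    by move: ne; case: (o1 _); case: (o2 _).
  have e2E : e2 i.+1 = e2 i.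
    apply: ti2; have := congr1 (fun x => (val x).2) (wX i).
    rewrite src2 tgt2 /otgt eo IH; by case: (o1 (e1 i.+1)).
  have ob : o1 (e1 i.+1) = ~~ o1 (e1 i).
    by rewrite IH -e2E eo negbK.
  have a12 : (smap G1).2 (e1 i.+1) = (smap G1).2 (e1 i) by rewrite !e12 e2E.
  have := w1 i; rewrite /osrc /otgt ob; case oi: (o1 (e1 i)) => /=.
    by move/(strict_head (sstrict G1) a12) => h; move: ob; rewrite h oi.
  by move/(strict_tail (sstrict G1) a12) => h; move: ob; rewrite h oi.
have w2 i : osrc o2 (e2 i.+1) = otgt o2 (e2 i).
  have := congr1 (fun x => (val x).2) (wX i).
  by rewrite src2 tgt2 /osrc /otgt -!o12.
have [s [qs sE] s12] := walk_shape_iso c1 c2 w1 w2 e12 o12 aut1 aut2.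
exists s => //; exists (otgt o (eps 0%N)) => //.
have qms : is_qmor s by case: qs.
have t1 : (val (otgt o (eps 0%N))).1 = otgt o1 (e1 0%N).
  by rewrite /otgt oE; case: ifP.
rewrite t1 tgt2 /otgt; case: ifP => _.
  by rewrite qmor_head // s12.
by rewrite qmor_tail // s12.
Qed.
End CyclicProduct.
End Walks.

(** * Products of bands *)

Section Bands.
Variables (k : fieldType) (L : string_category k).
Notation span := (@string_span k L).

Lemma jordan_unit lam s : lam != 0 -> jordan lam s \in (@unitmx k s).
Proof.
move=> l0; rewrite unitmxE -det_tr det_trig.
  rewrite unitfE; apply/prodf_neq0 => i _; by rewrite !mxE eqxx.
apply/is_trig_mxP => i j ij; rewrite !mxE.
by case: eqP => [e|_]; [move: ij; rewrite e ltnn|rewrite gtn_eqF // ltnS ltnW].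
Qed.

Lemma band_unit (P : quiver) (gam : arrow P) lam s (a : arrow P) : lam != 0 ->
  (if a == gam then jordan lam s else 1%:M) \in (@unitmx k s).
Proof. by move=> l0; case: ifP => _; rewrite ?jordan_unit ?unitmx1. Qed.

Definition loop_push (X : cshape L) (gam : arrow (sdom X)) d (M : 'M[k]_d) :
    repring L :=
  rcls (lpush (fun a : arrow (sdom X) => if a == gam then M else 1%:M)).

Lemma loop_push_block (X : cshape L) (gam : arrow (sdom X)) d e
    (M : 'M[k]_d) (N : 'M[k]_e) :
  loop_push gam (block_mx M 0 0 N) = loop_push gam M + loop_push gam N.
Proof.
apply: rcls_sum; apply: rep_iso_trans (push_down_sum _ _ _).
apply: push_down_iso; exists (fun x => 1%:M), (fun x => 1%:M).
split=> [x|x y a] /=; rewrite !mulmx1 ?mul1mx //.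
by case: ifP => _ //; rewrite -scalar_mx_block.
Qed.

Lemma loop_push_mxdiag (X : cshape L) (gam : arrow (sdom X)) n (p : 'I_n -> nat)
    (M : forall i, 'M[k]_(p i)) :
  loop_push gam (\mxdiag_i M i) = \sum_i loop_push gam (M i).
Proof.
elim: n p M => [|n IH] p M.
  rewrite [RHS]big_ord0 -rcls0; apply/rcls_iso/push_down_empty => x /=.
  by rewrite big_ord0.
rewrite [RHS]big_ord_recl mxdiag_recl -IH -loop_push_block.
by case: _ / mxsize_recl; rewrite castmx_id.
Qed.

Lemma loop_push_conj (X : cshape L) (gam : arrow (sdom X)) d e
    (M : 'M[k]_d) (N : 'M[k]_e) (g : 'M_(e, d)) (h : 'M_(d, e)) :
  g *m h = 1%:M -> h *m g = 1%:M -> g *m M = N *m g ->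
  loop_push gam M = loop_push gam N.
Proof.
move=> gh hg gM; apply/rcls_iso/push_down_iso.
apply: (@crep_gauge _ _ _ _ _ _ (fun _ => g) (fun _ => h)) => // a.
by case: ifP => _; rewrite ?gM // mulmx1 mul1mx.
Qed.

Lemma lpush_mul_span (X : cshape L) s (A : arrow (sdom X) -> 'M[k]_s) r :
  (forall a, A a \in unitmx) -> span r ->
  span (rmul (rcls (lpush A)) r) /\ forall F : linear_shape L,
  phi F (rmul (rcls (lpush A)) r) = (s * nfact X F)%:Z * phi F r.
Proof.
move=> uA [n [F [c ->]]]; rewrite rmulC -/(rmulr _ _) raddf_sum.
split=> [|F'].
  apply: span_sum => i _; rewrite raddfMz; apply: spanMz.
  by rewrite /= /rmulr rmulC; case: (lpush_mul_string (F i) uA).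
rewrite !raddf_sum mulr_sumr; apply: eq_bigr => i _.
rewrite !raddfMz /= /rmulr rmulC.
by case: (lpush_mul_string (F i) uA) => _ ->; rewrite mulrzAr.
Qed.

(** On the span [phi] is multiplicative, so products there are computed pointwise and the
    idempotents behave as indicator functions. *)
Lemma phi_rmul r r' F : span r -> span r' ->
  phi F (rmul r r') = phi F r * phi F r'.
Proof.
case=> n [G [c ->]] sr'; rewrite -/(rmulr r' _) !raddf_sum mulr_suml.
apply: eq_bigr => i _; rewrite !raddfMz /= /rmulr.
have [_ H] := @lpush_mul_span (G i) 1 (fun _ => 1%:M) r' (fun _ => unitmx1 _ _) sr'.
by rewrite [phi F (rmul _ _)]H mul1n phi_string mulrzAl.
Qed.

Lemma span_rmul r r' : span r -> span r' -> span (rmul r r').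
Proof.
by move=> sr sr'; have [_ _ H] := span_ideal L; case: (H r r' sr').
Qed.

Lemma nfact_iso (Q : quiver) (X F F' : shape Q) : shape_iso F F' ->
  nfact X F = nfact X F'.
Proof.
have le (F1 F2 : shape Q) : shape_iso F1 F2 -> (nfact X F2 <= nfact X F1)%N.
  case=> s [qs [t1 sK1 tK1] [t2 sK2 tK2]] sE.
  have sI : {in factoring X F2 &, injective (fun G : qmap (sdom F2) (sdom X) => qcomp G s)}.
    move=> [G1 G2] [H1 H2] _ _ [/ffunP e1 /ffunP e2].
    congr (_, _); apply/ffunP => x.
      by rewrite -(tK1 x); have := e1 (t1 x); rewrite !ffunE.
    by rewrite -(tK2 x); have := e2 (t2 x); rewrite !ffunE.
  rewrite /nfact -(card_in_imset sI); apply: subset_leq_card.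
  apply/subsetP => _ /imsetP[G GP ->]; apply: factoring_comp GP _.
  exact/factoringP.
by move=> iso; apply/eqP; rewrite eqn_leq !le //; apply: shape_iso_sym.
Qed.

(** The common source of the product formulas for strings and for bands: invertible matrices enter
    only through their size. *)
Lemma lpush_mul_mobius (X : cshape L) s (A : arrow (sdom X) -> 'M[k]_s)
    (F : linear_shape L) : (forall a, A a \in unitmx) ->
  rmul (rcls (lpush A)) (shape_mobius F) = shape_mobius F *+ (s * nfact X F).
Proof.
move=> uA; have [sB phiB] := lpush_mul_span uA (shape_mobius_span F).
apply: span_phi_eq => [||F']; [exact: sB|exact/spanMn/shape_mobius_span|].
rewrite phiB raddfMn /= phi_shape_mobius; case: asboolP => [FF|_].
  by rewrite (nfact_iso X FF) mulr1 -natz.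
by rewrite mulr0 mul0rn.
Qed.

Lemma band_mul_mobius (G : cyclic_shape L) gam lam s (F : linear_shape L) :
  lam != 0 ->
  rmul (rcls (@band _ _ G gam lam s)) (shape_mobius F) =
  shape_mobius F *+ (s * nfact G F).
Proof.
move=> l0; exact: (@lpush_mul_mobius G s
  (fun a => if a == gam then jordan lam s else 1%:M) F (fun a => band_unit gam s a l0)).
Qed.

Lemma string_mul_mobius (F F' : linear_shape L) :
  rmul (rcls (string F)) (shape_mobius F') = shape_mobius F' *+ nfact F F'.
Proof.
rewrite -[nfact F F']mul1n.
exact: (@lpush_mul_mobius F 1 (fun _ => 1%:M) F' (fun _ => unitmx1 _ _)).
Qed.

Lemma mobius_mul (F F' : linear_shape L) :
  rmul (shape_mobius F) (shape_mobius F') =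
  if `[< shape_iso F F' >] then shape_mobius F else 0.
Proof.
apply: span_phi_eq => [||F1].
- by apply: span_rmul; apply: shape_mobius_span.
- by case: ifP => _; [apply: shape_mobius_span|apply: span0].
rewrite phi_rmul; try exact: shape_mobius_span.
rewrite !phi_shape_mobius; case: asboolP => [F1F|nF1F]; last first.
  rewrite mul0r; case: ifP => _; last by rewrite raddf0.
  by rewrite phi_shape_mobius asboolF.
rewrite mul1r; case: asboolP => [F1F'|nF1F'].
  rewrite asboolT ?phi_shape_mobius ?asboolT //.
  exact: shape_iso_trans (shape_iso_sym F1F) F1F'.
rewrite asboolF ?raddf0 // => FF'; apply: nF1F'; exact: shape_iso_trans FF'.
Qed.

Lemma band_mul (G1 G2 : cyclic_shape L) gam1 gam2 lam mu s t :
  rmul (rcls (@band _ _ G1 gam1 lam s)) (rcls (@band _ _ G2 gam2 mu t)) =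
  rcls (@lpush _ _ (cprod G1 G2) _ (fun a =>
    (if (val a).1 == gam1 then jordan lam s else 1%:M) *t
    (if (val a).2 == gam2 then jordan mu t else 1%:M))).
Proof.
apply: rcls_tens; exact: (push_prod
  (fun a : arrow (sdom G1) => if a == gam1 then jordan lam s else 1%:M)
  (fun a : arrow (sdom G2) => if a == gam2 then jordan mu t else 1%:M)).
Qed.

Section Product.
Variables (G1 G2 : cyclic_shape L) (gam1 : arrow (sdom G1)) (gam2 : arrow (sdom G2)).
Variables (lam mu : k) (s t : nat).
Hypotheses (lam0 : lam != 0) (mu0 : mu != 0).

Let A (a : arrow (fp_quiver G1 G2)) : 'M[k]_(s * t) :=
  (if (val a).1 == gam1 then jordan lam s else 1%:M) *t
  (if (val a).2 == gam2 then jordan mu t else 1%:M).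

Lemma band_mul_unit a : A a \in unitmx.
Proof. by apply: tens_unit; apply: band_unit. Qed.

Lemma band_mul_noniso : ~ shape_iso G1 G2 ->
  span (rmul (rcls (band gam1 lam s)) (rcls (band gam2 mu t))) /\
  forall F : linear_shape L,
    phi F (rmul (rcls (band gam1 lam s)) (rcls (band gam2 mu t))) =
    (s * t * nfact G1 F * nfact G2 F)%:Z.
Proof.
move=> niso; rewrite band_mul.
have [o1 c1 _] := cyclic_orientation gam1 true (cyclic_shapeP G1).
pose o (a : arrow (sdom (cprod G1 G2))) := o1 ((fp_fst G1 G2).2 a).
have cho : chainlike o.
  exact: chainlike_map (factoring_strict (fp_fstP G1 G2)) (cyclic_chainlike c1).
have ac : acyclic o.
  move=> B hB; apply/eqP; apply: contraT => B0; case: niso.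
  have [s' [qs sE] _] := cyclic_product_walk c1 (cyclic_shapeP G2)
    (@cyclic_shape_aut _ _ G1) (@cyclic_shape_aut _ _ G2) B0 hB.
  by exists s'.
split; first exact: (@cpush_span _ _ (cprod G1 G2) _ _ _ cho ac band_mul_unit).
move=> F; rewrite (@lpush_acyclic _ _ (cprod G1 G2) _ _ _ cho ac band_mul_unit).
rewrite raddfMn /= phi_push nfact_prod; last exact: linear_shapeP.
by rewrite -mulr_natr natz -PoszM; congr Posz; lia.
Qed.
End Product.

(** * Products of bands on one shape: the diagonal and its complement *)

Section Square.
Variables (G : cyclic_shape L) (gam : arrow (sdom G)).
Variables (lam mu : k) (s t : nat).
Hypotheses (lam0 : lam != 0) (mu0 : mu != 0).

Definition diagonal : {set fp_vert G G} := [set x | (val x).1 == (val x).2].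

Lemma diag_vert_proof (x : vert (sdom G)) :
  (smap G).1 (x, x).1 == (smap G).1 (x, x).2.
Proof. by []. Qed.

Lemma diag_arrow_proof (a : arrow (sdom G)) :
  (smap G).2 (a, a).1 == (smap G).2 (a, a).2.
Proof. by []. Qed.

Definition diag_map : qmap (sdom G) (fp_quiver G G) :=
  ([ffun x => exist _ (x, x) (diag_vert_proof x)],
   [ffun a => exist _ (a, a) (diag_arrow_proof a)]).

Lemma diag_mapP : diag_map \in factoring (fp_shape G G) G.
Proof.
apply: factoringI => [|x|a]; rewrite ?ffunE //= ?ffunE //=.
by apply: is_qmorI => a; rewrite !ffunE; apply: val_inj.
Qed.

(** The diagonal is closed under adjacency: the two components of an arrow have the same label, so
    by strictness they are equal as soon as one end is diagonal. *)
Lemma lpush_diagonal d (B : arrow (fp_quiver G G) -> 'M[k]_d) :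
  rcls (@lpush _ _ (cprod G G) _ B) =
  rcls (@lpush _ _ G _ (fun a => B (exist _ (a, a) (diag_arrow_proof a)))) +
  rcls (@lpush _ _ (@csub _ _ (cprod G G) (~: diagonal)) _
    (fun b : sub_arrow (F := fp_shape G G) (~: diagonal) => B (val b))).
Proof.
rewrite (@lpush_split _ _ (cprod G G) G (@csub _ _ (cprod G G) (~: diagonal))
  _ _ _ B diag_mapP (sub_inclP _)).
- congr (_ + _).
    by apply: (congr1 (fun f => rcls (@lpush k L G d f))); apply/funext => a; rewrite ffunE.
  apply: (congr1 (fun f => rcls (@lpush k L (@csub _ _ (cprod G G) (~: diagonal)) d f))).
  by apply/funext => a; rewrite ffunE.
- by move=> x y; rewrite !ffunE => /(congr1 val) [].
- exact: sub_incl_inj.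
- move=> x y; rewrite !ffunE; apply: contraTneq (valP y) => <-.
  by rewrite !inE negbK.
- move=> x; have [xD|xD] := boolP (x \in diagonal).
    left; exists (val x).1; rewrite ffunE; apply: val_inj => /=.
    by move: xD; rewrite inE => /eqP {2}->; rewrite -surjective_pairing.
  have xD' : x \in ~: diagonal by rewrite inE.
  by right; exists (exist _ x xD'); rewrite ffunE.
- move=> a; have [aD|aD] := eqVneq (val a).1 (val a).2.
    left; exists (val a).1; rewrite ffunE; apply: val_inj => /=.
    by rewrite {2}aD -surjective_pairing.
  have aP : (smap G).2 (val a).1 = (smap G).2 (val a).2 by apply/eqP/(valP a).
  have aC : (tail a \in ~: diagonal) && (head a \in ~: diagonal).
    rewrite !inE /=; apply/andP; split; apply: contraNneq aD => e; apply/eqP.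
      exact: (strict_tail (sstrict G)).
    exact: (strict_head (sstrict G)).
  by right; exists (exist _ a aC); rewrite ffunE.
Qed.

Definition off_diagonal : repring L :=
  push1 (@csub _ _ (cprod G G) (~: diagonal)).

(** A cycle off the diagonal would yield an automorphism of [G] relating the components of one of
    its vertices; being trivial, it puts that vertex on the diagonal. *)
Lemma off_diagonal_acyclic :
  exists o : arrow (sub_quiver (F := fp_shape G G) (~: diagonal)) -> bool,
    chainlike o /\ acyclic o.
Proof.
have [o1 c1 _] := cyclic_orientation gam true (cyclic_shapeP G).
pose o (a : arrow (fp_quiver G G)) := o1 ((fp_fst G G).2 a).
have cho : chainlike o.
  exact: chainlike_map (factoring_strict (fp_fstP G G)) (cyclic_chainlike c1).
have iP := sub_inclP (F := fp_shape G G) (~: diagonal).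
have qi := factoring_qmor iP.
exists (fun a => o ((sub_incl (F := fp_shape G G) (~: diagonal)).2 a)).
split; first exact: chainlike_map (factoring_strict iP) cho.
move=> B hB; apply/eqP; apply: contraT => B0.
pose B' := (sub_incl (F := fp_shape G G) (~: diagonal)).1 @: B.
have B'0 : B' != set0 by rewrite imset_eq0.
have hB' x : x \in B' -> exists2 a, osrc o a = x & otgt o a \in B'.
  case/imsetP=> y /hB[a <- ta] ->.
  exists ((sub_incl (F := fp_shape G G) (~: diagonal)).2 a).
    by rewrite osrc_map.
  by rewrite -otgt_map // imset_f.
have [s' [qs sE] [x xB sx]] := cyclic_product_walk c1 (cyclic_shapeP G)
  (@cyclic_shape_aut _ _ G) (@cyclic_shape_aut _ _ G) B'0 hB'.
have sid := cyclic_shape_aut qs sE.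
case/imsetP: xB => y _ xy; have := valP y; rewrite !inE.
by move: sx; rewrite sid xy !ffunE => ->; rewrite eqxx.
Qed.

Lemma off_diagonal_span : span off_diagonal.
Proof.
have [o [cho ac]] := off_diagonal_acyclic.
apply: (@cpush_span _ _ (@csub _ _ (cprod G G) (~: diagonal)) _ _ _ cho ac).
by move=> a; apply: unitmx1.
Qed.

Lemma phi_off_diagonal (F : linear_shape L) :
  phi F off_diagonal = (nfact G F * (nfact G F - 1))%:Z.
Proof.
clear lam0 mu0.
have : push1 (cprod G G) = push1 G + off_diagonal := lpush_diagonal (fun _ => 1%:M).
move/(congr1 (phi F)); rewrite raddfD /= (phi_push F (cprod G G)) (phi_push F G).
rewrite nfact_prod; last exact: linear_shapeP.
(* If there is no factoring, the truncated [nfact G F - 1] is multiplied by 0. *)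
by case: (nfact G F) => [|n]; lia.
Qed.

Lemma band_mul_square l : jordan_type lam mu s t l ->
  rmul (rcls (band gam lam s)) (rcls (band gam mu t)) =
  \sum_(q <- l) rcls (band gam (lam * mu) q) + off_diagonal *+ (s * t).
Proof.
case=> _ _ [g [h [gh hg gJ]]]; rewrite band_mul lpush_diagonal; congr (_ + _).
  (* On the diagonal the matrix at [gam] is the tensor product of the Jordan blocks and the others
     are identities, so a constant base change splits the module. *)
  rewrite (big_nth 0%N) big_mkord -(loop_push_mxdiag (X := G) gam
    (fun i : 'I_(size l) => jordan (lam * mu) (nth 0%N l i))).
  rewrite -(loop_push_conj _ gh hg gJ).
  apply: (congr1 (fun f => rcls (@lpush k L G _ f))); apply/funext => a /=.
  by case: ifP => // _; rewrite tens11.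
have [o [cho ac]] := off_diagonal_acyclic.
apply: (@lpush_acyclic _ _ (@csub _ _ (cprod G G) (~: diagonal)) _ _ _ cho ac).
by move=> a; apply: tens_unit; apply: band_unit.
Qed.
End Square.
End Bands.

Theorem theorem4 (k : closedFieldType) (L : string_category k) :
  is_ring_ideal (@string_span k L) /\
  exists! e : linear_shape L -> repring L,
    [/\ (* a basis of I, indexed by isomorphism classes of linear shapes, of
           pairwise orthogonal idempotents *)
        [/\ class_function e,
            is_basis (@string_span k L) e,
            forall F : linear_shape L, rmul (e F) (e F) = e F &
            forall F F' : linear_shape L,
              ~ shape_iso F F' -> rmul (e F) (e F') = 0],
        (* 1 *)
        forall F : linear_shape L,
          [/\ class_sum (fun _ => True) (fun F' => e F' *+ nfact F F')
                (rcls (string F)),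
              class_sum (fun F' => subshape F' F) (fun F' => e F' *+ nfact F F')
                (rcls (string F)) &
              forall F' : linear_shape L,
                rmul (rcls (string F)) (e F') = e F' *+ nfact F F'],
        (* 2 *)
        forall (G : cyclic_shape L) (gam : arrow (sdom G)) (lam : k) (s : nat)
               (F' : linear_shape L),
          lam != 0 -> (0 < s)%N ->
          rmul (rcls (band gam lam s)) (e F') = e F' *+ (s * nfact G F'),
        (* 3, non-isomorphic shapes *)
        forall (G1 G2 : cyclic_shape L)
               (gam1 : arrow (sdom G1)) (gam2 : arrow (sdom G2))
               (lam mu : k) (s t : nat),
          ~ shape_iso G1 G2 -> lam != 0 -> mu != 0 -> (0 < s)%N -> (0 < t)%N ->
          class_sum (fun _ => True)
            (fun F' => e F' *+ (s * t * nfact G1 F' * nfact G2 F'))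
            (rmul (rcls (band gam1 lam s)) (rcls (band gam2 mu t))) &
        (* 3, equal shapes *)
        forall (G1 : cyclic_shape L) (gam1 : arrow (sdom G1))
               (lam mu : k) (s t : nat) (l : seq nat),
          lam != 0 -> mu != 0 -> (0 < s)%N -> (0 < t)%N ->
          jordan_type lam mu s t l ->
          exists2 r : repring L,
            class_sum (fun _ => True)
              (fun F' => e F' *+ (s * t * nfact G1 F' * (nfact G1 F' - 1))) r &
            rmul (rcls (band gam1 lam s)) (rcls (band gam1 mu t)) =
            \sum_(q <- l) rcls (band gam1 (lam * mu) q) + r].
Proof.
split; first exact: span_ideal.
have phi_e (F F' : linear_shape L) : phi F' (shape_mobius F) = `[< shape_iso F' F >]%:Z.
  exact: phi_shape_mobius.
exists (@shape_mobius k L); split.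
  split.
  - split; first exact: shape_mobius_class.
    + split; first exact: shape_mobius_span.
        exact: shape_mobius_spans.
      move=> n F c nF e0 i; have := congr1 (phi (F i)) e0.
      rewrite raddf0 raddf_sum (bigD1 i) //= raddfMz /= phi_e asboolT; last first.
        exact: shape_iso_refl.
      rewrite big1 ?addr0 => [|j ne]; first by rewrite -mulrzr mul1r intz.
      rewrite raddfMz /= phi_e asboolF ?mul0rz // => /nF ij.
      by rewrite ij eqxx in ne.
    + by move=> F; rewrite mobius_mul asboolT //; apply: shape_iso_refl.
    + by move=> F F' nFF'; rewrite mobius_mul asboolF.
  - move=> F; split; last by move=> F'; apply: string_mul_mobius.
      apply: class_sum_span => // [|F']; first exact: span_string.
      exact: phi_string.
    apply: class_sum_span => [|F'|F' /negPf nz]; first exact: span_string.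
      exact: phi_string.
    have /card_gt0P[G GP] : (0 < nfact F F')%N by rewrite lt0n nz.
    have [n [vX cX]] := linear_chain_enum (linear_shapeP F).
    have [m [vF cF]] := linear_chain_enum (linear_shapeP F').
    have Ginj := factoring_inj_vert cX cF GP.
    by exists G => //; split=> //; apply: factoring_inj_arrow GP Ginj.
  - by move=> G gam lam s F' l0 _; apply: band_mul_mobius.
  - move=> G1 G2 gam1 gam2 lam mu s t niso l0 m0 _ _.
    have [sp ph] := @band_mul_noniso k L G1 G2 gam1 gam2 lam mu s t l0 m0 niso.
    exact: class_sum_span.
  - move=> G gam lam mu s t l l0 m0 _ _ jt.
    exists (off_diagonal G *+ (s * t)); last exact: band_mul_square.
    apply: class_sum_span => // [|F].
      exact/spanMn/(off_diagonal_span gam).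
    rewrite raddfMn /= phi_off_diagonal -mulr_natr natz -PoszM; congr Posz.
    by rewrite mulnC mulnA.
move=> e' [[ce' be' ie' oe'] he' _ _ _]; apply/funext => F.
have [se' _ inde'] := be'.
(* Statement 1 gives the action of strings on [e'], and linearity extends it to the span. With [r]
   the idempotent of [F] this gives [e1]; exchanging the roles gives [e2]. *)
have mulE (r : repring L) (F' : linear_shape L) : string_span r ->
    rmul r (e' F') = e' F' *~ phi F' r.
  case=> n [G [c ->]]; rewrite -/(rmulr (e' F') _) !raddf_sum.
  apply: eq_bigr => i _; rewrite !raddfMz /= /rmulr phi_string.
  by have [_ _ ->] := he' (G i).
have e1 : rmul (shape_mobius F) (e' F) = e' F.
  rewrite mulE; last exact: shape_mobius_span.
  by rewrite phi_e asboolT ?mulr1z //; apply: shape_iso_refl.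
have mulE2 (r : repring L) (F' : linear_shape L) : string_span r ->
    rmul r (shape_mobius F') = shape_mobius F' *~ phi F' r.
  case=> n [G [c ->]]; rewrite -/(rmulr (shape_mobius F') _) !raddf_sum.
  apply: eq_bigr => i _; rewrite !raddfMz /= /rmulr phi_string.
  by rewrite string_mul_mobius.
pose c := phi F (e' F).
have e2 : e' F = shape_mobius F *~ c by rewrite -e1 rmulC mulE2.
have cc : c * c = c.
  by rewrite -phi_rmul ?ie'.
have idem (z : int) : z * z = z -> z = 0 \/ z = 1 by nia.
(* The scalar is idempotent because [e' F] is; the value 0 would make a basis element zero, against
   independence of a one-member family. *)
have [c0|c1] := idem c cc.
  have e0 : e' F = 0 by rewrite e2 c0 mulr0z.
  have := inde' 1%N (fun _ => F) (fun _ => 1).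
  rewrite big_ord1 e0 mul0rz => /(_ _ erefl ord0) H.
  by have := H (fun i j _ => etrans (ord1 i) (esym (ord1 j))).
by rewrite e2 c1 mulr1z.
Qed.
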